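(* Let $q\in\mathbb N\cup\{0\}$, $\xi>\sqrt2$ and $\nu\in(0,1)$ be fixed, let $h\in L^2(\Omega)$, $f\in L^\infty(0,\tau;L^2(\Omega))$, let $g\in L^2(\Omega)$ be the solution of $Tg=\Upsilon_{h,f}$, and suppose $g\in S_{\varrho,p}$ for some $\varrho,p>0$. There is $\delta_0>0$ such that for every $\delta\in(0,\delta_0)$ with $(\xi+\sqrt2)\delta^\nu\le\|\Upsilon_{h,f}\|$ and all $h^\delta\in L^2(\Omega)$, $f^\delta\in L^\infty(0,\tau;L^2(\Omega))$ with $\|h-h^\delta\|^2+\theta\|f-f^\delta\|^2_{L^\infty(0,\tau;L^2(\Omega))}\le\delta^2$, the following holds, where $\beta_\delta,\tilde\beta_\delta>0$ are the unique positive numbers with $\Phi(\beta_\delta)=\xi\delta$ and $\Phi(\tilde\beta_\delta)=\xi\delta^\nu$, $\Phi(\beta)=\|Tu_\beta^\delta(0)-\Upsilon_{h^\delta,f^\delta}\|$. There are constants $C_{13}'>0$ depending only on $C_3,p,\xi$; $C_{14}>0$ depending only on $C_5,C_{11},\xi,p$; $C_{15}>0$ depending only on $C_5,C_{12},\xi,q$; and $C_{16}>0$ depending only on $\xi,\lambda_1,p$, such that: (i) if $q\ne0$ and $0<p<q$, then $\|g-u^\delta_{\beta_\delta}(0)\|\le C_{13}'\varrho^{2/(p+2)}\delta^{p/(p+2)}+C_{14}\varrho^{2/(p+2)}\delta^{p/(p+2)}$; (ii) if $q\ne0$ and $p\ge q$, then $\|g-u^\delta_{\beta_\delta}(0)\|\le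 C_{13}'\varrho^{2/(p+2)}\delta^{p/(p+2)}+C_{15}\varrho^{2/(q+2)}\delta^{q/(q+2)}$; (iii) if $q=0$, then $\|g-u^\delta_{\tilde\beta_\delta}(0)\|\le C_{13}'\varrho^{2/(p+2)}\delta^{p\nu/(p+2)}+C_{16}\,\varrho\,\delta^{1-\nu}$.
   Context: Setting: $d\in\{1,\dots,7\}$, $\Omega\subset\mathbb R^d$ is a bounded domain with sufficiently smooth boundary, $\tau>0$, $\alpha\in(0,1)$, $\mathbb N=\{1,2,\dots\}$; $\|\cdot\|$ and $\langle\cdot,\cdot\rangle$ are the norm and inner product of $L^2(\Omega)$. $0<\lambda_1<\lambda_2\le\cdots\to\infty$ are the Dirichlet eigenvalues of $-\Delta$ on $\Omega$ with eigenfunctions $\varphi_n\in H_0^1(\Omega)\cap H^2(\Omega)$ forming an orthonormal basis of $L^2(\Omega)$; $w_n=\langle w,\varphi_n\rangle$ for $w\in L^2(\Omega)$, and $z_n(s)=\langle z(s),\varphi_n\rangle$ for $z\in L^\infty(0,\tau;L^2(\Omega))$. $\theta=\sum_{n=1}^\infty\lambda_n^{-4}<\infty$. Mittag-Leffler function: $E_{\gamma,b}(z)=\sum_{k=0}^\infty z^k/\Gamma(k\gamma+b)$. $C_1,C_2>0$ are fixed constants with $\frac{C_1}{\Gamma(1-\alpha)}\frac1{1-x}\le E_{\alpha,1}(x)\le\frac{C_2}{\Gamma(1-\alpha)}\frac1{1-x}$ for all $x\le0$ (known to exist). For $h\in L^2(\Omega)$, $f\in L^\infty(0,\tau;L^2(\Omega))$: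 $\Psi_f^{\alpha,n}(t)=\int_0^t(t-s)^{\alpha-1}E_{\alpha,\alpha}(-\lambda_n^2(t-s)^\alpha)f_n(s)\,ds$, $\Upsilon_{h,f}^{\alpha,n}=h_n-\Psi_f^{\alpha,n}(\tau)$, $\Upsilon_{h,f}=\sum_n\Upsilon_{h,f}^{\alpha,n}\varphi_n\in L^2(\Omega)$ (and similarly for $h^\delta,f^\delta$). The operator $T:L^2(\Omega)\to L^2(\Omega)$ is $T\phi=\sum_nE_{\alpha,1}(-\lambda_n^2\tau^\alpha)\langle\phi,\varphi_n\rangle\varphi_n$. Source set: $S_{\varrho,p}=\{\phi\in L^2(\Omega):\|\phi\|_{H_p}\le\varrho\}$, $\|\phi\|_{H_p}^2=\sum_n\lambda_n^{2p}|\langle\phi,\varphi_n\rangle|^2$. Regularized solution, for $\beta>0$: $u_\beta^\delta(0)=\sum_{n=1}^\infty\frac{\Upsilon^{\alpha,n}_{h^\delta,f^\delta}}{E_{\alpha,1}(-\lambda_n^2\tau^\alpha)+\beta\lambda_n^q}\varphi_n$. Constants: $C_3=\frac{(1+\lambda_1^2\tau^\alpha)\Gamma(1-\alpha)}{C_1\lambda_1^2}$; $C_4=1/C_3$; $C_5=\sqrt2\,(2C_4/q)^{2/(q+2)}\frac{q}{C_4(1+q)}$ (for $q\ne0$); $C_{10}=\frac{C_2}{\Gamma(1-\alpha)\tau^\alpha}$; $C_{11}=C_{10}\,C_4^{-(p+2)/(q+2)}$; $C_{12}=\frac{C_{10}}{C_4\lambda_1^{p-q}}$. *)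

(* Defs.v *)
From HB Require Import structures.
From mathcomp Require Import all_boot all_order all_algebra.
From mathcomp Require Import all_classical all_reals all_analysis.
From mathcomp Require Import ess_sup_inf.

Set Implicit Arguments.
Unset Strict Implicit.
Unset Printing Implicit Defensive.

Import Order.TTheory GRing.Theory Num.Theory.
Import numFieldNormedType.Exports.

Local Open Scope classical_set_scope.
Local Open Scope ring_scope.

Section lebesgue_measure_on_open_sets.
Context {R : realType} {d : nat}.
Local Open Scope ereal_scope.

Definition box (a b : 'rV[R]_d) : set 'rV[R]_d :=
  [set x | forall i, (a ord0 i < x ord0 i <= b ord0 i)%R].

(* +oo (infimum of the empty set) on the sets that are not boxes, so that
   only covers by boxes contribute to the induced outer measure. *)
Definition box_volume (B : set 'rV[R]_d) : \bar R :=
  if B == set0 then 0 else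
  ereal_inf [set v | exists a b : 'rV[R]_d,
    [/\ forall i, (a ord0 i <= b ord0 i)%R, B = box a b &
        v = (\prod_(i < d) (b ord0 i - a ord0 i))%:E]].

Let boxes : set (set 'rV[R]_d) := [set box a b | a in setT & b in setT].

Definition lebesgue_outer : set 'rV[R]_d -> \bar R :=
  @mu_ext _ (g_sigma_algebraType boxes) R box_volume.

(* Lebesgue outer measure of the part of A inside Omega. When Omega is
   Lebesgue measurable, the Caratheodory measurable sets of this outer measure
   are the A such that A `&` Omega is Lebesgue measurable, and the resulting
   measure is the restriction to Omega of the d-dimensional Lebesgue measure. *)
Definition lebesgue_on (Omega A : set 'rV[R]_d) : \bar R :=
  lebesgue_outer (A `&` Omega).

Let box_volume0 : box_volume set0 = 0.
Proof. by rewrite /box_volume eqxx. Qed.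

Let box_volume_ge0 B : 0 <= box_volume B.
Proof.
rewrite /box_volume; case: ifPn => // _.
apply: le_ereal_inf_tmp => _ [a [b [ab _ ->]]].
by rewrite lee_fin prodr_ge0// => i _; rewrite subr_ge0.
Qed.

Variable Omega : set 'rV[R]_d.

Let lebesgue_on0 : lebesgue_on Omega set0 = 0.
Proof. by rewrite /lebesgue_on set0I /lebesgue_outer mu_ext0. Qed.

Let lebesgue_on_ge0 A : 0 <= lebesgue_on Omega A.
Proof. exact: mu_ext_ge0. Qed.

Let le_lebesgue_on :
  {homo lebesgue_on Omega : A B / (A `<=` B)%classic >-> A <= B}.
Proof. by move=> A B AB; apply: le_mu_ext; exact: setSI. Qed.

Let lebesgue_on_subadditive : sigma_subadditive (lebesgue_on Omega).
Proof.
move=> A; rewrite /lebesgue_on setI_bigcupl.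
exact: (@mu_ext_sigma_subadditive _ (g_sigma_algebraType boxes) R box_volume
  box_volume_ge0 (fun n => A n `&` Omega)%classic).
Qed.

HB.instance Definition _ := isOuterMeasure.Build R 'rV[R]_d (lebesgue_on Omega)
  lebesgue_on0 lebesgue_on_ge0 le_lebesgue_on lebesgue_on_subadditive.

End lebesgue_measure_on_open_sets.

Section smoothness.
Context {R : realType} {d : nat}.

Definition partial (i : 'I_d) (f : 'rV[R]_d -> R) : 'rV[R]_d -> R :=
  fun x => 'D_(delta_mx ord0 i) f x.

Fixpoint Ck (k : nat) (U : set 'rV[R]_d) (f : 'rV[R]_d -> R) : Prop :=
  (forall x, U x -> {for x, continuous f}) /\
  match k with
  | 0 => True
  | k'.+1 => forall i : 'I_d,
      (forall x, U x -> derivable f x (delta_mx ord0 i)) /\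
      Ck k' U (partial i f)
  end.

(* Near each boundary point, Omega is a strict sublevel set of a C^k function
   without critical points. *)
Definition Ck_boundary (k : nat) (Omega : set 'rV[R]_d) : Prop :=
  forall x0, (closure Omega `\` interior Omega) x0 ->
  exists (U : set 'rV[R]_d) (rho : 'rV[R]_d -> R),
    [/\ open U, U x0, Ck k U rho,
        (forall x, U x -> exists i, partial i rho x != 0) &
        Omega `&` U = [set x | rho x < 0] `&` U].

Definition bounded_domain (Omega : set 'rV[R]_d) : Prop :=
  [/\ Omega !=set0, open Omega, connected Omega & bounded_set Omega].

Definition test_function (Omega : set 'rV[R]_d) (psi : 'rV[R]_d -> R) : Prop :=
  [/\ forall k, Ck k setT psi,
      compact (closure [set x | psi x != 0]) &
      closure [set x | psi x != 0] `<=` Omega].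

End smoothness.

Section spaces.
Context {R : realType} {d : nat} (Omega : set 'rV[R]_d).

Definition lebesgue_measure_on :
    {measure set (caratheodory_type (lebesgue_on Omega)) -> \bar R} :=
  (lebesgue_on Omega : {outer_measure set 'rV[R]_d -> \bar R}).

Local Notation mu := lebesgue_measure_on.

(* Representatives of the elements of L^2(Omega): equality in L^2(Omega) is
   almost everywhere equality. *)
Definition L2 := LfunType mu (lee1n 2).

Definition norm2 (u : L2) : R := fine ('N[mu]_2[EFin \o u])%E.

Definition inner (u v : L2) : R := \int[mu]_x (u x * v x).

Definition L2_cvg (u : nat -> L2) (l : L2) : Prop :=
  norm2 (u n - l) @[n --> \oo] --> (0 : R).

Definition weak_partial (i : 'I_d) (u v : L2) : Prop :=
  forall psi, test_function Omega psi ->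
  \int[mu]_x (u x * partial i psi x) = - \int[mu]_x (v x * psi x).

(* Closure of the test functions for the H^1 norm; the limits g i of the
   partial derivatives are the weak partial derivatives of u. *)
Definition H10 (u : L2) : Prop :=
  exists (psi : nat -> 'rV[R]_d -> R) (g : 'I_d -> L2),
  [/\ forall k, test_function Omega (psi k),
      (fun k => 'N[mu]_2[(fun x => (psi k x - u x)%:E)]%E) @ \oo --> 0%E &
      forall i,
        (fun k => 'N[mu]_2[(fun x => (partial i (psi k) x - g i x)%:E)]%E) @ \oo
          --> 0%E].

(* u belongs to H^2(Omega) with weak second derivatives H i j. *)
Definition H2_with (u : L2) (H : 'I_d -> 'I_d -> L2) : Prop :=
  exists g : 'I_d -> L2,
    (forall i, weak_partial i u (g i)) /\
    (forall i j, weak_partial j (g i) (H i j)).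

Definition dirichlet_eigenpair (lam : R) (u : L2) : Prop :=
  H10 u /\ exists H, H2_with u H /\
  {ae mu, forall x, - (\sum_(i < d) H i i) x = lam * u x}.

Definition orthonormal_basis (phi : nat -> L2) : Prop :=
  (forall m n, inner (phi m) (phi n) = (m == n)%:R) /\
  (forall w : L2, L2_cvg (fun N => \sum_(n < N) inner w (phi n) *: phi n) w).

(* The eigenvalues are indexed from 0: lam 0 is the first eigenvalue. *)
Definition dirichlet_eigensystem (lam : nat -> R) (phi : nat -> L2) : Prop :=
  [/\ 0 < lam 0 /\ lam 0 < lam 1,
      nondecreasing_seq lam,
      lam n @[n --> \oo] --> +oo,
      forall n, dirichlet_eigenpair (lam n) (phi n) &
      orthonormal_basis phi].

(* L^2 sum of the series sum_n c n phi n (the choice of a limit is immaterial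
   up to almost everywhere equality; 0 if the series diverges). *)
Definition L2_sum (phi : nat -> L2) (c : nat -> R) : L2 :=
  xget 0 [set w | L2_cvg (fun N => \sum_(n < N) c n *: phi n) w].

Definition simple_in_time (s : R -> L2) : Prop :=
  exists (N : nat) (A : 'I_N -> set (measurableTypeR R)) (v : 'I_N -> L2),
    (forall i, measurable (A i)) /\
    s = (fun t => \sum_(i < N) \1_(A i) t *: v i).

Definition strongly_measurable (tau : R) (f : R -> L2) : Prop :=
  exists s : nat -> R -> L2, (forall k, simple_in_time (s k)) /\
  {ae lebesgue_measure, forall t, t \in `]0, tau[ -> L2_cvg (s ^~ t) (f t)}.

Definition Linfty_norm (tau : R) (f : R -> L2) : \bar R :=
  ess_sup (mrestr lebesgue_measure (measurable_itv `]0%R, tau[))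
    (fun t => (norm2 (f t))%:E).

(* Membership in L^infty(0, tau; L^2(Omega)); the values of f outside ]0, tau[
   play no role. *)
Definition Linfty (tau : R) (f : R -> L2) : Prop :=
  strongly_measurable tau f /\ (Linfty_norm tau f < +oo)%E.

End spaces.

Section mittag_leffler.
Context {R : realType}.

Definition Gamma (x : R) : R :=
  \int[lebesgue_measure]_(t in `]0, +oo[) (t `^ (x - 1) * expR (- t)).

Definition mittag_leffler (g b z : R) : R :=
  limn (series (fun k => z ^+ k / Gamma (k%:R * g + b))).

End mittag_leffler.

Section problem.
Context {R : realType} {d : nat} {Omega : set 'rV[R]_d}.
Variables (lam : nat -> R) (phi : nat -> L2 Omega) (alpha tau : R).
Implicit Types (h w : L2 Omega) (f : R -> L2 Omega).

(* Finite in dimension d <= 7 by Weyl's law; no finiteness is assumed. *)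
Definition theta : \bar R := (\sum_(0 <= n <oo) (lam n ^- 4)%:E)%E.

Definition Psi f (n : nat) (t : R) : R :=
  \int[lebesgue_measure]_(s in `]0, t[)
    ((t - s) `^ (alpha - 1)
     * mittag_leffler alpha alpha (- (lam n ^+ 2 * (t - s) `^ alpha))
     * inner (f s) (phi n)).

Definition Upsilon_coef h f (n : nat) : R := inner h (phi n) - Psi f n tau.

Definition Upsilon h f : L2 Omega := L2_sum phi (Upsilon_coef h f).

Definition E_tau (n : nat) : R :=
  mittag_leffler alpha 1 (- (lam n ^+ 2 * tau `^ alpha)).

Definition T_op w : L2 Omega :=
  L2_sum phi (fun n => E_tau n * inner w (phi n)).

Definition Hp_norm (p : R) w : \bar R :=
  ((\sum_(0 <= n <oo) (lam n `^ (2 * p) * inner w (phi n) ^+ 2)%:E) `^ 2^-1)%E.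

Definition source_set (rho p : R) : set (L2 Omega) :=
  [set w | (Hp_norm p w <= rho%:E)%E].

Definition u_reg (q : nat) h f (beta : R) : L2 Omega :=
  L2_sum phi (fun n => Upsilon_coef h f n / (E_tau n + beta * lam n ^+ q)).

Definition discrepancy (q : nat) h f (beta : R) : R :=
  norm2 (T_op (u_reg q h f beta) - Upsilon h f).

End problem.

Section constants.
Context {R : realType}.

Definition C3 (C1 lam1 alpha tau : R) : R :=
  (1 + lam1 ^+ 2 * tau `^ alpha) * Gamma (1 - alpha) / (C1 * lam1 ^+ 2).

Definition C4 (C1 lam1 alpha tau : R) : R := (C3 C1 lam1 alpha tau)^-1.

Definition C5 (C1 lam1 alpha tau : R) (q : nat) : R :=
  let c4 := C4 C1 lam1 alpha tau in
  Num.sqrt 2 * (2 * c4 / q%:R) `^ (2 / (q%:R + 2)) * (q%:R / (c4 * (1 + q%:R))).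

Definition C10 (C2 alpha tau : R) : R :=
  C2 / (Gamma (1 - alpha) * tau `^ alpha).

Definition C11 (C1 C2 lam1 alpha tau p : R) (q : nat) : R :=
  C10 C2 alpha tau
  * C4 C1 lam1 alpha tau `^ (- ((p + 2) / (q%:R + 2))).

Definition C12 (C1 C2 lam1 alpha tau p : R) (q : nat) : R :=
  C10 C2 alpha tau / (C4 C1 lam1 alpha tau * lam1 `^ (p - q%:R)).

End constants.

(* Main.v *)
(** With [E_n] the multipliers of [T] and
    [w_n = beta lam_n^q / (E_n + beta lam_n^q)], the residual of the regularized
    solution is the data multiplied by [w_n], so that [Phi] is continuous and
    strictly increasing in [beta], and [g - u(beta)] is the sum of [w_n g_n] and
    of the data error divided by [E_n + beta lam_n^q]. The first part is
    interpolated between the source condition and the discrepancy, because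
    [lam_n^-2 <= C3 E_n]. The second is controlled by a lower bound on [beta],
    which follows from comparing [Phi beta] with the norm of [w_n E_n g_n] and
    using the source condition.

    The data error is at most [sqrt 2 * delta] because the kernel of [Psi] is
    nonnegative with integral [(1 - E_n) / lam_n^2]. The nonnegativity of
    [E_{alpha,alpha}(-x)] comes from Gauss' limit formula for [1 / Gamma]: up to
    normalisation it is the limit, for [c = x / N^alpha], of the coefficient of
    [z^N] in [1 / ((1 - z)^alpha + c)], and these coefficients are nonnegative
    because all the coefficients of [(1 - z)^alpha] but the first one are
    nonpositive. *)

From HB Require Import structures.
Require Import Defs.
From mathcomp Require Import all_boot all_order all_algebra.
From mathcomp Require Import all_classical all_reals all_analysis.
From mathcomp Require Import measurable_realfun ess_sup_inf ring lra.
Import Order.TTheory GRing.Theory Num.Theory.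
Import numFieldNormedType.Exports HBNNSimple.
Local Open Scope classical_set_scope.
Local Open Scope ring_scope.

Set Implicit Arguments.
Unset Strict Implicit.

(** * The fundamental theorem of calculus on open intervals *)

(** The coefficient of [z^N] in [(1 - z)^(-a)] is asymptotic to [N^(a - 1) / Gamma a]. Expanding
    [1 / ((1 - z)^al + c)] in powers of [c = x / N^al] and multiplying by [N^(1 - al)] therefore
    gives, term by term, the series of [E_{al,al}(-x)]. Every power of [c] contributes to the
    coefficient of [z^N], so the expansion is truncated and two limits are taken, under geometric
    majorants that are uniform in [N]. These majorants rest on the decay of [1 / Gamma a], faster
    than any exponential, which is read off Gauss' products instead of Stirling's formula.

    The noise is amplified by at most the supremum of [1 / (E_n + beta lam_n^q)], of order
    [beta^(-2/(q+2))], and the lower bound on [beta] turns this into a power of [delta]. For [q = 0]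
    the amplification is [1 / beta]: at discrepancy [xi delta] the lower bound on [beta] is of order
    [delta], and the amplified noise would only stay bounded. Hence the larger level [xi delta^nu].

    The elements of [L2] are functions and [L2_sum] has the default value 0, so a series must be
    shown to converge before its coefficients are used. *)

(** Monotone convergence for the positive and the negative part; integrability keeps the difference
    of the two limits defined. *)
Lemma cvg_integral_bigcup (R : realType) (d : measure_display)
    (T : measurableType d) (mu : {measure set T -> \bar R})
    (A : (set T)^nat) (f : T -> R) :
  nondecreasing_seq A -> (forall n, measurable (A n)) ->
  mu.-integrable (\bigcup_n A n) (EFin \o f) ->
  (\int[mu]_(x in A n) (f x)%:E)%E @[n --> \oo] -->
    (\int[mu]_(x in \bigcup_n A n) (f x)%:E)%E.
Proof.
move=> ndA mA intf.
have mf : measurable_fun (\bigcup_n A n) (EFin \o f) by case/integrableP : intf.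
have mfn n : measurable_fun (A n) (EFin \o f).
  by apply: measurable_funS mf => //; [exact: bigcup_measurable|exact: bigcup_sup].
rewrite integralE; under eq_fun do rewrite integralE.
apply: cvgeB.
- apply: fin_num_adde_defl; rewrite fin_numN.
  by apply: integrable_neg_fin_num => //; exact: bigcup_measurable.
- apply: ge0_nondecreasing_set_cvg_integral => // n.
  exact/measurable_funepos/mfn.
- apply: ge0_nondecreasing_set_cvg_integral => // n.
  exact/measurable_funeneg/mfn.
Qed.

Section open_FTC.
Context {R : realType}.
Notation mu := (@lebesgue_measure R).
Variables (f F : R -> R) (u v : nat -> R) (la lb : R).
Let D := \bigcup_n [set` `[u n, v n]].
Hypothesis ninc_u : nonincreasing_seq u.
Hypothesis ndec_v : nondecreasing_seq v.
Hypothesis uv : forall n, u n < v n.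
Hypothesis dF : forall x, D x -> is_derive x 1 F (f x).
Hypothesis cf : forall x, D x -> {for x, continuous f}.
Hypothesis Fu : F (u n) @[n --> \oo] --> la.
Hypothesis Fv : F (v n) @[n --> \oo] --> lb.

Let nd : nondecreasing_seq (fun n => [set` `[u n, v n]]).
Proof.
move=> m n mn; apply/subsetPset; apply: subset_itv => /=.
  by rewrite bnd_simp; exact: ninc_u.
by rewrite bnd_simp; exact: ndec_v.
Qed.

Let Dn n x : u n <= x <= v n -> D x.
Proof. by move=> xn; exists n => //=; rewrite in_itv. Qed.

Let cfn n : {within `[u n, v n], continuous f}.
Proof.
apply: continuous_in_subspaceT => x; rewrite inE/= in_itv/= => xn.
exact/cf/(@Dn n).
Qed.

Let FTC_n n : (\int[mu]_(x in [set` `[u n, v n]]) (f x)%:E =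
  (F (v n) - F (u n))%:E)%E.
Proof.
have cF x : D x -> {for x, continuous F}.
  by move=> /dF[dFx _]; exact/differentiable_continuous/derivable1_diffP.
rewrite (@continuous_FTC2 _ f F) ?EFinB//.
- split.
  + move=> x; rewrite in_itv/= => /andP[ux xv].
    by have [] := @dF x (Dn (n := n) _); rewrite ?ltW.
  + apply: cvg_at_right_filter; apply: cF; apply: (@Dn n).
    by rewrite lexx ltW.
  + apply: cvg_at_left_filter; apply: cF; apply: (@Dn n).
    by rewrite lexx ltW.
- move=> x; rewrite in_itv/= => /andP[ux xv].
  have [|_ <-] := @dF x; first by apply: (@Dn n); rewrite !ltW.
  by rewrite derive1E.
Qed.

Let FTC_cvg : ((F (v n) - F (u n))%:E @[n --> \oo] --> (lb - la)%:E)%E.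
Proof. by apply: cvg_EFin; [exact: nearW|exact: cvgB]. Qed.

(** The integrands in view may be singular at an endpoint or live on a half-line, so only the limits
    of [F] along an exhaustion by compact intervals enter. Integrability is assumed since [f] may
    change sign. *)
Lemma integrable_FTC2 : mu.-integrable D (EFin \o f) ->
  (\int[mu]_(x in D) (f x)%:E = (lb - la)%:E)%E.
Proof.
move=> intf.
have mA n : measurable ([set` `[u n, v n]] : set (measurableTypeR R)).
  exact: measurable_itv.
have /= := @cvg_integral_bigcup R _ (measurableTypeR R) mu _ f nd mA intf.
under eq_fun do rewrite FTC_n.
by move=> h; apply: cvg_unique h FTC_cvg.
Qed.

(** For a nonnegative integrand the finite limits of the primitive yield integrability as well, by
    monotone convergence. *)
Lemma ge0_FTC2 : (forall x, D x -> 0 <= f x) ->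
  mu.-integrable D (EFin \o f) /\
  (\int[mu]_(x in D) (f x)%:E = (lb - la)%:E)%E.
Proof.
move=> f0.
have mfn n : measurable_fun ([set` `[u n, v n]] : set (measurableTypeR R))
    (EFin \o f).
  by apply/measurable_EFinP; apply: subspace_continuous_measurable_fun => //; exact: cfn.
have mA n : measurable ([set` `[u n, v n]] : set (measurableTypeR R)).
  exact: measurable_itv.
have mD : measurable (D : set (measurableTypeR R)) by exact: bigcup_measurable.
have mf : measurable_fun (D : set (measurableTypeR R)) (EFin \o f).
  by apply/measurable_fun_bigcup.
have intE : (\int[mu]_(x in D) (f x)%:E = (lb - la)%:E)%E.
  have /= := @ge0_nondecreasing_set_cvg_integral _ (measurableTypeR R) _ _
    (EFin \o f) mu nd mA mfn.
  under eq_fun do rewrite FTC_n.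
  have f0n n x : x \in `[u n, v n] -> (0 <= (f x)%:E)%E.
    by move=> nx; rewrite lee_fin; apply: f0; exists n.
  by move=> /(_ f0n) h; apply: cvg_unique h FTC_cvg.
split => //; apply/integrableP; split => //.
under eq_integral.
  move=> x; rewrite inE => Dx; rewrite gee0_abs ?lee_fin ?f0//.
  over.
by rewrite intE ltry.
Qed.
End open_FTC.

Section exhaustions.
Context {R : realType}.
Implicit Types (t x : R).

(** With [n.+3] the left endpoint stays below [t / 2], so that no interval is degenerate. *)
Lemma itv0t_bigcup t : 0 < t ->
  `]0, t[%classic = \bigcup_n [set` `[t / n.+3%:R, t - t / n.+3%:R]].
Proof.
move=> t0; apply/seteqP; split => x /=.
  rewrite in_itv/= => /andP[x0 xt].
  pose m := Num.trunc (t / Order.min x (t - x)).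
  have m0 : 0 < Order.min x (t - x) by rewrite lt_min x0 subr_gt0.
  have : t / m.+3%:R <= Order.min x (t - x).
    rewrite ler_pdivrMr// -ler_pdivrMl// mulrC.
    have /andP[_ /ltW /le_trans] := Num.Theory.trunc_itv (ltW (divr_gt0 t0 m0)).
    apply; rewrite ler_nat; exact: leq_addl 2 _.
  rewrite le_min => /andP[h1 h2].
  by exists m => //=; rewrite in_itv/= h1/= lerBrDr addrC -lerBrDr.
move=> [n _]/=; rewrite in_itv/= => /andP[h1 h2].
have tn : 0 < t / n.+3%:R by rewrite divr_gt0.
rewrite in_itv/= (lt_le_trans tn h1)/= (le_lt_trans h2)//.
by rewrite ltrBlDr ltrDl.
Qed.

Lemma itv0y_bigcup :
  `]0, +oo[%classic = \bigcup_n [set` `[n.+1%:R^-1 : R, n.+2%:R]].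
Proof.
apply/seteqP; split => x /=.
  rewrite in_itv/= andbT => x0.
  pose m := Num.trunc (x + x^-1).
  have xx : 0 <= x + x^-1 by rewrite addr_ge0// ?invr_ge0 ltW.
  have /andP[_ /ltW h] := Num.Theory.trunc_itv xx.
  exists m => //=; rewrite in_itv/=; apply/andP; split.
    rewrite invf_ple ?posrE// (le_trans _ h)// lerDr ltW//.
  apply: (@le_trans _ _ m.+1%:R); last by rewrite ler_nat.
  by rewrite (le_trans _ h)// lerDl invr_ge0 ltW.
move=> [n _]/=; rewrite in_itv/= => /andP[h1 _].
by rewrite in_itv/= andbT (lt_le_trans _ h1)// invr_gt0.
Qed.
End exhaustions.

Section power_integral.
Context {R : realType}.
Notation mu := (@lebesgue_measure R).

Lemma continuous_powR (b x : R) : 0 < x -> {for x, continuous (@powR R ^~ b)}.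
Proof.
move=> x0; apply/differentiable_continuous/derivable1_diffP.
by apply: derivable_powR; rewrite in_itv/= andbT.
Qed.

Lemma powR_divn_cvg0 (t b : R) : 0 < t -> 0 < b ->
  (t / n.+3%:R) `^ b @[n --> \oo] --> 0.
Proof.
move=> t0 b0.
apply: (@cvg_comp _ _ _ (fun n => t / n.+3%:R) (@powR R ^~ b) _ (0^'+)).
  have h : t / n.+3%:R @[n --> \oo] --> 0.
    rewrite -[X in _ --> X](mulr0 t); apply: cvgMr.
    have := @cvg_harmonic R; rewrite -(cvg_shiftn 2).
    by under eq_fun do rewrite addn2.
  move=> A [e /= e0 eA].
  have [N _ hN] : \forall n \near \oo, `|0 - t / n.+3%:R| < e.
    by move: h => /cvgrPdist_lt/(_ _ e0).
  exists N => // n Nn; apply: eA; first exact: hN.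
  by rewrite divr_gt0.
exact: powR_cvg0.
Qed.

(** These are the terms of the kernel of [Psi]; for [b < 1] the integrand is singular at [s = t]. *)
Lemma integral_powR_subr (t b : R) : 0 < t -> 0 < b ->
  mu.-integrable `]0, t[ (fun s => ((t - s) `^ (b - 1))%:E) /\
  (\int[mu]_(s in `]0%R, t[) ((t - s) `^ (b - 1))%:E = (t `^ b / b)%:E)%E.
Proof.
move=> t0 b0; rewrite (itv0t_bigcup t0).
have Dlt x : (\bigcup_n [set` `[t / n.+3%:R, t - t / n.+3%:R]]) x -> 0 < t - x.
  by rewrite -itv0t_bigcup//= in_itv/= subr_gt0 => /andP[].
have := @ge0_FTC2 R (fun s => (t - s) `^ (b - 1)) (fun s => - ((t - s) `^ b / b))
  (fun n => t / n.+3%:R) (fun n => t - t / n.+3%:R) (- (t `^ b / b)) 0.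
rewrite sub0r opprK; apply.
- by move=> m n mn; rewrite ler_pM2l// lef_pV2 ?posrE// ler_nat.
- by move=> m n mn; rewrite lerB// ler_pM2l// lef_pV2 ?posrE// ler_nat.
- move=> n; have : t / n.+3%:R < t / 2 by rewrite ltr_pM2l// ltf_pV2 ?posrE// ltr_nat.
  by move: (t / n.+3%:R) => y; lra.
- move=> x /Dlt tx.
  have h : is_derive x 1 (fun s : R => t - s) (-1).
    have -> : (-1 : R) = 0 - 1 by rewrite sub0r.
    by apply: is_deriveB.
  have h2 := @is_derive1_comp _ (@powR R ^~ b) (fun s => t - s) x _ _
    (is_derive1_powR b tx) h.
  have h3 := is_deriveN (is_deriveZ b^-1 h2).
  rewrite /= in h3.
  rewrite (_ : (fun s => _) = (- (b^-1 \*: ((@powR R ^~ b) \o (fun s => t - s))))%R).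
    apply: is_derive_eq; rewrite /GRing.scale/=.
    by rewrite mulrN1 mulrN opprK mulrA mulVf ?mul1r// gt_eqF.
  by apply/funext => s /=; rewrite mulrC.
- move=> x /Dlt tx.
  apply: (@continuous_comp _ _ _ (fun s => t - s) (@powR R ^~ (b - 1))).
    by apply: cvgB; [exact: cvg_cst|exact: cvg_id].
  exact: continuous_powR.
- apply: cvgN; apply: cvgMl.
  apply: (@cvg_comp _ _ _ (fun n => t - t / n.+3%:R) (@powR R ^~ b) _ (nbhs t)).
    have h : t - t / n.+3%:R @[n --> \oo] --> t - 0.
      apply: cvgB; first exact: cvg_cst.
      have := powR_divn_cvg0 t0 ltr01.
      by under eq_fun do rewrite powRr1 ?divr_ge0// ?ltW//.
    by rewrite subr0 in h; exact: h.
  exact: continuous_powR.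
- rewrite -oppr0 -[X in _ --> - X](mul0r b^-1); apply: cvgN; apply: cvgMl.
  under eq_fun do rewrite subKr.
  exact: powR_divn_cvg0.
- by move=> x _; exact: powR_ge0.
Qed.
End power_integral.

(** * The Gamma function *)

Section Gamma_theory.
Context {R : realType}.
Notation mu := (@lebesgue_measure R).
Implicit Types (x t a : R).

(** This is [ln y < y] at [y = t / (2 * x)]. Only half of the exponent is spent, which leaves
    [expR (- (t / 2))] for decay. *)
Lemma powR_le_expR x t : 0 < x -> 0 < t -> t `^ x <= (2 * x) `^ x * expR (t / 2).
Proof.
move=> x0 t0; have x20 : 0 < 2 * x by rewrite mulr_gt0.
rewrite /powR !gt_eqF// -expRD ler_expR.
have t20 : 0 < t / (2 * x) by rewrite divr_gt0.
have := ltW (ln_sublinear t20).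
rewrite ln_div ?posrE// lerBlDr => /(ler_wpM2l (ltW x0)) h.
rewrite (le_trans h)// mulrDr addrC lerD2l.
by rewrite invfM [2^-1 * _]mulrC mulrCA mulVKf ?gt_eqF.
Qed.

Lemma expRN_le_inv t : 0 < t -> expR (- t) <= t^-1.
Proof.
move=> t0; rewrite expRN lef_pV2 ?posrE ?expR_gt0//.
by rewrite (le_trans _ (expR_ge1Dx t))// lerDr.
Qed.

Let u (n : nat) : R := n.+1%:R^-1.
Let v (n : nat) : R := n.+2%:R.

Let u_ninc : nonincreasing_seq u.
Proof. by move=> m n mn; rewrite lef_pV2 ?posrE// ler_nat. Qed.

Let v_ndec : nondecreasing_seq v.
Proof. by move=> m n mn; rewrite ler_nat. Qed.

Let uv n : u n < v n.
Proof.
rewrite /u/v (@le_lt_trans _ _ 1) ?invf_le1 ?posrE// ?(ltr_nat _ 1 n.+2)//.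
by rewrite (ler_nat _ 1 n.+1).
Qed.

Let u_cvg x : 0 < x -> u n `^ x @[n --> \oo] --> 0.
Proof.
move=> x0; rewrite -(cvg_shiftn 2)/=.
have -> : (fun n => u (n + 2) `^ x) = (fun n => (1 / n.+3%:R) `^ x).
  by apply/funext => n; rewrite div1r addn2.
exact: powR_divn_cvg0.
Qed.

Let v_cvg (K : R) : K / v n @[n --> \oo] --> 0.
Proof.
rewrite -[X in _ --> X](mulr0 K); apply: cvgMr.
have := @cvg_harmonic R; rewrite -(cvg_shiftn 1).
by under eq_fun do rewrite addn1.
Qed.

Let D0 x : (\bigcup_n [set` `[u n, v n]]) x -> 0 < x.
Proof. by rewrite -itv0y_bigcup/= in_itv/= andbT. Qed.

Let m0y : measurable (`]0, +oo[ : set (measurableTypeR R)).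
Proof. exact: measurable_itv. Qed.

Let is_derive_Gamma x t : 0 < t ->
  is_derive t 1 (fun t : R => t `^ x * expR (- t))
    (x * t `^ (x - 1) * expR (- t) - t `^ x * expR (- t)).
Proof.
move=> t0.
have h1 := is_derive1_powR x t0.
have h2 : is_derive t 1 (fun s : R => expR (- s)) (- expR (- t)).
  have h := @is_derive1_comp _ (@expR R) (fun s => - s) t _ _
    (is_derive_expR _) (is_deriveNid _ _).
  by apply: is_derive_eq h _; rewrite mulrN1.
have h3 := is_deriveM h1 h2.
apply: is_derive_eq h3 _.
by rewrite /GRing.scale/= mulrN addrC; congr (_ + _); rewrite mulrC.
Qed.

(** The majorant [f] is the derivative of [- (1 + t^x)^-1]: it has an explicit bounded primitive and
    the right singularity at 0, so the half-line need not be split. The comparison is the square of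
    [1 + t^x <= K * expR (t / 2)]. *)
Lemma integrable_Gamma x : 0 < x ->
  mu.-integrable `]0, +oo[ (fun t => (t `^ (x - 1) * expR (- t))%:E).
Proof.
move=> x0.
pose f t : R := x * t `^ (x - 1) / (1 + t `^ x) ^+ 2.
have f_ge0 t : 0 <= f t.
  by rewrite divr_ge0 ?mulr_ge0 ?powR_ge0 ?exprn_ge0 ?addr_ge0 ?powR_ge0// ltW.
have tx t : 0 < 1 + t `^ x by rewrite ltr_pwDl// powR_ge0.
have [intf _] : mu.-integrable (\bigcup_n [set` `[u n, v n]]) (EFin \o f) /\
  (\int[mu]_(t in \bigcup_n [set` `[u n, v n]]) (f t)%:E = (0 - (- 1^-1))%:E)%E.
{ apply: (@ge0_FTC2 R f (fun t => - (1 + t `^ x)^-1) u v _ _ u_ninc v_ndec uv).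
  - move=> t /D0 t0.
    have h1 : is_derive t 1 (fun t : R => 1 + t `^ x) (0 + x * t `^ (x - 1)).
      by apply: is_deriveD; exact: is_derive1_powR.
    have h2 := is_deriveN (@is_deriveV _ (fun t => 1 + t `^ x) _ _ _
      (lt0r_neq0 (tx t)) h1).
    apply: is_derive_eq h2 _.
    rewrite /f /GRing.scale/= add0r mulNr opprK mulrC.
    by rewrite -exprVn.
  - move=> t /D0 t0; apply: cvgM.
      by apply: cvgMr; exact: continuous_powR.
    apply: cvgV; first by rewrite expf_neq0// gt_eqF.
    apply: (@continuous_comp _ _ _ (fun t => 1 + t `^ x) (fun y => y ^+ 2)).
      by apply: cvgD; [exact: cvg_cst|exact: continuous_powR].
    exact: exprn_continuous.
  - apply: cvgN; rewrite -[in X in _ --> X](addr0 1); apply: cvgV.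
      by rewrite addr0 oner_neq0.
    by apply: cvgD; [exact: cvg_cst|exact: u_cvg].
  - rewrite -oppr0; apply: cvgN.
    apply: (@squeeze_cvgr _ _ _ _ (fun=> 0) (fun n => u n.+1 `^ x)).
    + apply: nearW => n; rewrite invr_ge0 ltW//=.
      have vn : 0 < v n by rewrite /v ltr0n.
      have -> : u n.+1 `^ x = (v n `^ x)^-1.
        by rewrite /u -powR_inv1// -powRrM mulN1r powRN.
      by rewrite lef_pV2 ?posrE ?powR_gt0// lerDr.
    + exact: cvg_cst.
    + by have := u_cvg x0; rewrite -(cvg_shiftn 1); under eq_fun do rewrite addn1.
  - by move=> t _; exact: f_ge0. }
pose K : R := 1 + (2 * x) `^ x.
move: intf; rewrite -itv0y_bigcup => /(integrableZl m0y (K ^+ 2 / x)).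
apply: le_integrable => //.
  apply/measurable_EFinP; apply: measurable_funM.
    by apply: measurable_funTS; exact: measurable_powR.
  by apply: measurable_funTS; apply: measurableT_comp.
move=> t /=; rewrite in_itv/= andbT => t0.
rewrite lee_fin !ger0_norm; last 2 first.
  by rewrite mulr_ge0 ?f_ge0// divr_ge0 ?exprn_ge0 ?addr_ge0 ?powR_ge0// ltW.
  by rewrite mulr_ge0 ?powR_ge0 ?expR_ge0.
have -> : K ^+ 2 / x * f t = t `^ (x - 1) * (K ^+ 2 / (1 + t `^ x) ^+ 2).
  rewrite /f; move: (lt0r_neq0 (tx t)) (lt0r_neq0 x0).
  by move: (t `^ x) (t `^ (x - 1)) => p q p0 xn0; field; rewrite p0 xn0.
apply: ler_wpM2l; first exact: powR_ge0.
rewrite expRN ler_pdivlMr ?exprn_gt0// mulrC ler_pdivrMr ?expR_gt0//.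
have -> : K ^+ 2 * expR t = (K * expR (t / 2)) ^+ 2.
  by rewrite exprMn -expRM_natr divfK.
rewrite lerXn2r ?nnegrE ?(ltW (tx t))// ?mulr_ge0 ?expR_ge0 ?addr_ge0 ?powR_ge0//.
rewrite /K mulrDl mul1r lerD ?powR_le_expR//.
by rewrite -expR0 ler_expR divr_ge0// ltW.
Qed.

Local Notation Gam := (@Gamma R).

Lemma Gamma1 : Gam 1 = 1.
Proof.
rewrite /Gamma /Rintegral.
have -> : (\int[mu]_(t in `]0%R, +oo[) (t `^ (1 - 1) * expR (- t))%:E =
    \int[mu]_(t in `]0%R, +oo[) (expR (- t))%:E)%E.
  by apply: eq_integral => t _; rewrite subrr powRr0 mul1r.
have := @ge0_FTC2 R (fun t => expR (- t)) (fun t => - expR (- t)) u v (- 1) (- 0)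
  u_ninc v_ndec uv.
rewrite -itv0y_bigcup => h.
have [] := h.
- move=> t _.
  have h1 := @is_derive1_comp _ (@expR R) (fun s => - s) t _ _
    (is_derive_expR _) (is_deriveNid _ _).
  have h2 := is_deriveN h1.
  by apply: is_derive_eq h2 _; rewrite mulrN1 opprK.
- move=> t _; apply: (@continuous_comp _ _ _ (fun t => - t) expR).
    exact: opp_continuous.
  exact: continuous_expR.
- apply: cvgN; rewrite -expR0 -oppr0.
  apply: (@cvg_comp _ _ _ (fun n => - u n) expR _ (nbhs (- 0))).
    by apply: cvgN; exact: cvg_harmonic.
  exact: continuous_expR.
- apply: cvgN; apply: (@squeeze_cvgr _ _ _ _ (fun=> 0) (fun n => 1 / v n)).
  + by apply: nearW => n; rewrite expR_ge0 div1r expRN_le_inv// /v ltr0n.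
  + exact: cvg_cst.
  + exact: v_cvg.
- by move=> t _; exact: expR_ge0.
- by move=> _ ->; rewrite oppr0 sub0r opprK.
Qed.

(** The derivative of [t^x * expR (- t)] integrates to 0, because this function vanishes at both
    ends. *)
Lemma GammaS x : 0 < x -> Gam (x + 1) = x * Gam x.
Proof.
move=> x0.
have x10 : 0 < x + 1 by rewrite addr_gt0.
have i1 := integrable_Gamma x0; have i2 := integrable_Gamma x10.
have i3 := integrableZl m0y x i1.
have i4 := integrableB m0y i3 i2.
have := @integrable_FTC2 R
  (fun t => x * t `^ (x - 1) * expR (- t) - t `^ x * expR (- t))
  (fun t => t `^ x * expR (- t)) u v 0 0 u_ninc v_ndec uv.
rewrite -itv0y_bigcup subrr => h.
have : (\int[mu]_(t in `]0%R, +oo[)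
  (x * t `^ (x - 1) * expR (- t) - t `^ x * expR (- t))%:E = 0%:E)%E.
{ apply: h.
  - by move=> t; rewrite /= in_itv/= andbT; exact: is_derive_Gamma.
  - have cN t : {for t, continuous (fun t : R => expR (- t))}.
      apply: (@continuous_comp _ _ _ (fun t => - t) expR).
        exact: opp_continuous.
      exact: continuous_expR.
    move=> t; rewrite /= in_itv/= andbT => t0; apply: cvgB; apply: cvgM.
    + by apply: cvgMr; exact: continuous_powR.
    + exact: cN.
    + exact: continuous_powR.
    + exact: cN.
  - apply: (@squeeze_cvgr _ _ _ _ (fun=> 0) (fun n => u n `^ x)).
    + apply: nearW => n; rewrite mulr_ge0 ?powR_ge0 ?expR_ge0//=.
      by rewrite ler_piMr ?powR_ge0// expR_le1 oppr_le0 invr_ge0.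
    + exact: cvg_cst.
    + exact: u_cvg.
  - apply: (@squeeze_cvgr _ _ _ _ (fun=> 0) (fun n => (2 * x) `^ x * 2 / v n)).
    + apply: nearW => n; rewrite mulr_ge0 ?powR_ge0 ?expR_ge0//=.
      have vn : 0 < v n by rewrite /v ltr0n.
      rewrite -mulrA.
      rewrite [leLHS](_ : _ = v n `^ x / expR (v n / 2) * expR (- (v n / 2))).
        apply: ler_pM; rewrite ?divr_ge0 ?powR_ge0 ?expR_ge0//.
          by rewrite ler_pdivrMr ?expR_gt0// powR_le_expR.
        by rewrite (le_trans (expRN_le_inv _)) ?divr_gt0// invf_div.
      rewrite -expRN -mulrA -expRD; congr (_ * expR _).
      by rewrite -opprD -splitr.
    + exact: cvg_cst.
    + exact: v_cvg.
  - apply: eq_integrable i4 => // t _ /=.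
    by rewrite -EFinB -mulrA addrK. }
have := @RintegralB _ _ _ mu _ (fun t => x * (t `^ (x - 1) * expR (- t)))
  (fun t => t `^ (x + 1 - 1) * expR (- t)) m0y i3 i2.
rewrite (RintegralZl _ m0y i1) /Rintegral => h1 h2.
apply/esym/eqP; rewrite -subr_eq0 /Gamma /Rintegral -h1.
apply/eqP; rewrite -[RHS]/(fine 0%:E) -h2; congr fine.
by apply: eq_integral => t _; rewrite mulrA addrK.
Qed.

(** With [m] the right-hand side, [ln y <= y - 1] is used at [t / m] and at [1 / m]; weighted by [a]
    and [1 - a], the two upper bounds add up to 0. *)
Lemma powR_le_tangent a t : 0 <= a <= 1 -> 0 < t -> t `^ a <= 1 + a * (t - 1).
Proof.
move=> /andP[a0 a1] t0.
have m0 : 0 < 1 + a * (t - 1).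
  have [->|a_neq] := eqVneq a 1; first by rewrite mul1r addrC subrK.
  have : 0 < (1 - a) + a * t.
    by rewrite ltr_wpDr ?mulr_ge0 ?(ltW t0)// subr_gt0 lt_neqAle a_neq.
  by rewrite (_ : 1 - a + a * t = 1 + a * (t - 1))//; ring.
set m := 1 + _ in m0 *.
rewrite /powR gt_eqF// -ler_ln ?posrE ?expR_gt0// expRK.
have l1 : ln t - ln m <= t / m - 1.
  by rewrite -ln_div ?posrE// -[X in ln X](subrK 1) addrC le_ln1Dx//
    ltrBrDr addNr divr_gt0.
have l2 : - ln m <= m^-1 - 1.
  by rewrite -lnV ?posrE// -[X in ln X](subrK 1) addrC le_ln1Dx//
    ltrBrDr addNr invr_gt0.
have e : a * (t / m - 1) + (1 - a) * (m^-1 - 1) = 0.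
  have m_neq0 : m != 0 by rewrite gt_eqF.
  have -> : a * (t / m - 1) + (1 - a) * (m^-1 - 1) = (1 + a * (t - 1)) / m - 1.
    by ring.
  by rewrite divff// subrr.
have := ler_wpM2l a0 l1; have : 0 <= 1 - a by rewrite subr_ge0.
move=> /ler_wpM2l/(_ _ _ l2).
lra.
Qed.

(** Wendel's inequality. In the integral, [t^a] is replaced by its tangent at [t = x]; the
    first-order term integrates to 0 since [Gam (x + 1) = x * Gam x]. *)
Lemma Gamma_wendel a x : 0 <= a <= 1 -> 0 < x -> Gam (x + a) <= x `^ a * Gam x.
Proof.
move=> a01 x0; have /andP[a0 a1] := a01.
have x10 : 0 < x + 1 by rewrite addr_gt0.
have i1 := integrable_Gamma x0; have i2 := integrable_Gamma x10.
have xa0 : 0 < x + a by rewrite ltr_pwDl.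
have i3 := integrableZl m0y (x `^ a * (1 - a)) i1.
have i4 := integrableZl m0y (x `^ a * (a / x)) i2.
have i5 := integrableD m0y i3 i4.
have : Gam (x + a) <= \int[mu]_(t in `]0, +oo[)
   (x `^ a * (1 - a) * (t `^ (x - 1) * expR (- t)) +
    x `^ a * (a / x) * (t `^ (x + 1 - 1) * expR (- t))).
  apply: (le_Rintegral m0y); first exact: integrable_Gamma.
    by apply: (eq_integrable m0y) i5.
  move=> t /=; rewrite in_itv/= andbT => t0.
  have -> : x + a - 1 = (x - 1) + a by rewrite addrAC.
  have -> : x + 1 - 1 = (x - 1) + 1 by rewrite addrAC.
  rewrite (@powRD _ t (x - 1) a) ?(gt_eqF t0) ?implybT//.
  rewrite (@powRD _ t (x - 1) 1) ?(gt_eqF t0) ?implybT//.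
  rewrite powRr1 ?(ltW t0)//.
  set A := t `^ (x - 1); set B := expR _.
  have -> : x `^ a * (1 - a) * (A * B) + x `^ a * (a / x) * (A * t * B) =
     A * (x `^ a * (1 + a * (t / x - 1))) * B.
    move: (x `^ a) => C; field; by rewrite gt_eqF.
  apply: ler_wpM2r; first exact: expR_ge0.
  apply: ler_wpM2l; first exact: powR_ge0.
  rewrite -[X in X `^ a](divfK (lt0r_neq0 x0)).
  rewrite powRM ?divr_ge0 ?(ltW t0) ?(ltW x0)// mulrC.
  apply: ler_wpM2l; first exact: powR_ge0.
  by apply: powR_le_tangent => //; exact: divr_gt0.
move=> /le_trans; apply.
rewrite (RintegralD m0y i3 i4) (RintegralZl _ m0y i1) (RintegralZl _ m0y i2).
rewrite -/(Gam x) -/(Gam (x + 1)) GammaS// le_eqVlt; apply/orP; left; apply/eqP.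
by move: (x `^ a) (Gam x) => p q; field; rewrite gt_eqF.
Qed.

End Gamma_theory.

(** * Gauss' limit formula *)

Section Gauss_product.
Context {R : realType}.
Local Notation Gam := (@Gamma R).
Implicit Types (a x y : R) (n N : nat).

(* The coefficient of [z^n] in [(1 - z)^(-a)]. *)
Definition rbin a n : R := \prod_(i < n) ((a + i%:R) / i.+1%:R).

Lemma rbin0 a : rbin a 0 = 1.
Proof. by rewrite /rbin big_ord0. Qed.

Lemma rbinS a n : rbin a n.+1 = rbin a n * ((a + n%:R) / n.+1%:R).
Proof. by rewrite /rbin big_ord_recr. Qed.

Lemma rbin_ge0 a n : 0 <= a -> 0 <= rbin a n.
Proof. by move=> a0; apply: prodr_ge0 => i _; rewrite divr_ge0// addr_ge0. Qed.

Lemma rbin_1l n : rbin 1 n = 1.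
Proof.
by rewrite /rbin big1// => i _; rewrite addrC natr1 divff.
Qed.

(** The product of the series of [(1 - z)^(-x)] and [(1 - z)^(-y)]. Writing [n + 1] as
    [i + (n + 1 - i)] amounts to differentiating the product. *)
Lemma rbin_sum x y n :
  \sum_(i < n.+1) rbin x i * rbin y (n - i) = rbin (x + y) n.
Proof.
elim: n => [|n IH]; first by rewrite big_ord1 !rbin0 mulr1.
have n0 : n.+1%:R != 0 :> R by [].
have S a k : rbin a k.+1 * k.+1%:R = rbin a k * (a + k%:R).
  by rewrite rbinS -mulrA divfK.
apply: (mulIf n0); rewrite S -IH.
rewrite (eq_bigr (fun i : 'I_n.+2 => (i%:R + (n.+1 - i)%:R) * (rbin x i *
    rbin y (n.+1 - i)) / n.+1%:R)); last first.
  by move=> i _; rewrite -natrD subnKC -1?ltnS// mulrAC divff// mul1r.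
rewrite -mulr_suml divfK//.
under eq_bigr do rewrite mulrDl.
rewrite big_split/= big_ord_recl/= mul0r add0r [X in _ + X]big_ord_recr/= subnn.
rewrite mul0r addr0 -big_split/= mulr_suml; apply: eq_bigr => i _.
have iN : (i <= n)%N by rewrite -ltnS.
rewrite /bump/= add1n subSS subSn//.
rewrite mulrA [_ * rbin x i.+1]mulrC S mulrCA [_%:R * rbin y _]mulrC S natrB//.
by ring.
Qed.

Lemma rbinD1 a N : 0 < a -> rbin (a + 1) N * a = rbin a N * (a + N%:R).
Proof.
move=> a0; elim: N => [|N IH]; first by rewrite !rbin0 addr0.
rewrite !rbinS mulrAC IH -!mulrA; congr (_ * _).
by rewrite -[in a + N.+1%:R]natr1; ring.
Qed.

(** The parameter is raised by 1 because [rbin (a + 1)] is nondecreasing in its index: one error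
    term at [N] then bounds those at all smaller indices. *)
Lemma le_rbinD1 a m N : 0 <= a -> (m <= N)%N -> rbin a m <= rbin (a + 1) N.
Proof.
move=> a0 /subnKC <-; elim: (N - m)%N => [|k IH].
  rewrite addn0; apply: ler_prod => i _; rewrite divr_ge0 ?addr_ge0//=.
  by rewrite ler_pM2r ?invr_gt0// lerD2r lerDl.
rewrite addnS rbinS (le_trans IH)// ler_peMr ?rbin_ge0 ?addr_ge0//.
by rewrite ler_pdivlMr// mul1r -addrA (addrC 1) natr1 lerDr.
Qed.

(** On [[1, 2]], Wendel's inequality gives [1 = Gam 2 <= (1 + b)^(1 - b) * Gam (1 + b)]; the
    functional equation carries positivity to all positive arguments. *)
Lemma Gamma_gt0 a : 0 < a -> 0 < Gam a.
Proof.
have G1 b : 0 <= b <= 1 -> 0 < Gam (1 + b).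
  move=> /andP[b0 b1].
  have := @Gamma_wendel R (1 - b) (1 + b).
  rewrite subr_ge0 b1/= gerBl b0 => /(_ isT).
  have b10 : 0 < 1 + b by rewrite ltr_pwDl.
  move=> /(_ b10); rewrite addrACA addrN addr0 -{1}[1]/(1%R).
  rewrite (_ : 1 + 1 = 1 + 1 :> R)// GammaS// Gamma1 mulr1 => h.
  rewrite -(pmulr_rgt0 _ (powR_gt0 (1 - b) b10)).
  exact: lt_le_trans ltr01 h.
move=> a0; have : a <= (Num.trunc a).+1%:R.
  by have /andP[_ /ltW] := Num.Theory.trunc_itv (ltW a0).
move: (Num.trunc a) => m; elim: m a a0 => [|m IH] b b0 bm.
  have := G1 b; rewrite (ltW b0) bm => /(_ isT).
  by rewrite addrC GammaS// pmulr_rgt0.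
have [b1|b1] := leP b 1.
  have := G1 b; rewrite (ltW b0) b1 => /(_ isT).
  by rewrite addrC GammaS// pmulr_rgt0.
have b10 : 0 < b - 1 by rewrite subr_gt0.
have -> : b = (b - 1) + 1 by rewrite subrK.
by rewrite GammaS// mulr_gt0// IH// lerBlDr natr1.
Qed.

Lemma Gamma_nat n : Gam n.+1%:R = n`!%:R.
Proof.
elim: n => [|n IH]; first exact: Gamma1.
by rewrite -natr1 GammaS// IH -natrM factS.
Qed.

Lemma Gamma_rbin a N : 0 < a -> Gam (a + N%:R) = Gam a * N`!%:R * rbin a N.
Proof.
move=> a0; elim: N => [|N IH]; first by rewrite addr0 mulr1 rbin0 mulr1.
rewrite -natr1 addrA GammaS ?ltr_pwDl// IH rbinS factS natrM.
by field; rewrite nat1r pnatr_eq0.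
Qed.

(** Since [rbin a N = Gam (a + N) / (Gam a * N!)], this is the sequence of Gauss' formula for
    [1 / Gam a]. *)
Definition gauss a N : R := rbin a N * N%:R `^ (1 - a).

Lemma gauss_ge0 a N : 0 < a -> 0 <= gauss a N.
Proof. by move=> a0; rewrite mulr_ge0 ?powR_ge0 ?rbin_ge0 ?ltW. Qed.

Lemma gaussD1 a N : 0 < a -> (0 < N)%N ->
  Gam (a + 1) * gauss (a + 1) N = Gam a * gauss a N * ((a + N%:R) / N%:R).
Proof.
move=> a0 N0; rewrite /gauss GammaS//.
have N0R : 0 < N%:R :> R by rewrite ltr0n.
have -> : N%:R `^ (1 - a) = N%:R * N%:R `^ (1 - (a + 1)) :> R.
  rewrite -[X in X * _]powRr1 ?ler0n// -powRD ?(gt_eqF N0R) ?implybT//.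
  by congr (_ `^ _); ring.
have := rbinD1 N a0; move: (rbin (a + 1) N) (rbin a N) (N%:R `^ _) => p q r h.
transitivity (Gam a * (p * a) * r); first by ring.
by rewrite h; field; rewrite gt_eqF.
Qed.

(** Wendel's inequality used twice: at [a + N] with exponent [1 - a] for the lower bound, at [N]
    with exponent [a] for the upper one. *)
Lemma gauss_bounds a N : 0 < a <= 1 -> (0 < N)%N ->
  N%:R / (a + N%:R) <= Gam a * gauss a N <= 1.
Proof.
move=> /andP[a0 a1] N0; have N0R : 0 < N%:R :> R by rewrite ltr0n.
have aN : 0 < a + N%:R by rewrite addr_gt0.
have fN : 0 < N`!%:R :> R by rewrite ltr0n fact_gt0.
have e : Gam a * gauss a N = Gam (a + N%:R) * N%:R `^ (1 - a) / N`!%:R.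
  by rewrite Gamma_rbin// /gauss; field; rewrite gt_eqF.
rewrite e; apply/andP; split.
- have := @Gamma_wendel R (1 - a) (a + N%:R).
  rewrite subr_ge0 a1/= gerBl (ltW a0) => /(_ isT aN).
  have -> : a + N%:R + (1 - a) = N.+1%:R by rewrite -natr1; ring.
  rewrite Gamma_nat => h.
  rewrite ler_pdivlMr//.
  have -> : Gam (a + N%:R) * N%:R `^ (1 - a) =
     (N%:R / (a + N%:R)) `^ (1 - a) * ((a + N%:R) `^ (1 - a) * Gam (a + N%:R)).
    rewrite mulrA -powRM ?divr_ge0 ?(ltW aN) ?(ltW N0R)// divfK ?gt_eqF//.
    by rewrite mulrC.
  apply: ler_pM => //; rewrite ?divr_ge0 ?(ltW aN) ?(ltW N0R) ?(ltW fN)//.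
  apply: ger1_powR; last by rewrite gerBl ltW.
  by rewrite divr_gt0//= ler_pdivrMr// mul1r lerDr ltW.
- have := @Gamma_wendel R a N%:R; rewrite (ltW a0) a1 => /(_ isT N0R) h.
  rewrite ler_pdivrMr// mul1r addrC.
  apply: (@le_trans _ _ (N%:R `^ a * Gam N%:R * N%:R `^ (1 - a))).
    by rewrite ler_wpM2r ?powR_ge0// addrC.
  rewrite mulrAC -powRD ?(gt_eqF N0R) ?implybT// addrC subrK powRr1 ?(ltW N0R)//.
  by case: N N0 {h e fN aN N0R} => // N _; rewrite Gamma_nat factS natrM.
Qed.

Lemma gauss_cvg a : 0 < a -> gauss a N @[N --> \oo] --> (Gam a)^-1.
Proof.
move=> a0.
suff h : Gam a * gauss a N @[N --> \oo] --> (1 : R).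
  have -> : gauss a = (fun N => (Gam a)^-1 * (Gam a * gauss a N)).
    by apply/funext => N; rewrite mulKf// gt_eqF// Gamma_gt0.
  by rewrite -[X in _ --> X]mulr1; apply: cvgMr.
have cN b : 0 < b -> (b + N%:R) / N%:R @[N --> \oo] --> (1 : R).
  move=> b0; rewrite -(cvg_shiftn 1)/=.
  have -> : (fun n => (b + (n + 1)%:R) / (n + 1)%:R) =
      (fun n => b * n.+1%:R^-1 + 1 : R).
    by apply/funext => n; rewrite addn1 mulrDl divff.
  have : b * n.+1%:R^-1 + 1 @[n --> \oo] --> (b * 0 + 1 : R).
    by apply: cvgD; [apply: cvgMr; exact: cvg_harmonic|exact: cvg_cst].
  by rewrite mulr0 add0r.
have base b : 0 < b <= 1 -> Gam b * gauss b N @[N --> \oo] --> (1 : R).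
  move=> b01; have /andP[b0 b1] := b01.
  { apply: (@squeeze_cvgr _ _ _ _ (fun N => N%:R / (b + N%:R)) (fun=> 1)).
  - by near=> N; apply: gauss_bounds => //; near: N; exists 1%N.
  - have -> : (fun N => N%:R / (b + N%:R)) = (fun N => ((b + N%:R) / N%:R)^-1).
      by apply/funext => N; rewrite invf_div.
    rewrite -[X in _ --> X]invr1; apply: cvgV; last exact: cN.
    exact: oner_neq0.
  - exact: cvg_cst. }
have : a <= (Num.trunc a).+1%:R.
  by have /andP[_ /ltW] := Num.Theory.trunc_itv (ltW a0).
move: (Num.trunc a) => m; elim: m a a0 => [|m IH] b b0 bm.
- by apply: base; rewrite b0.
- have [b1|b1] := leP b 1; first by apply: base; rewrite b0.
  have b10 : 0 < b - 1 by rewrite subr_gt0.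
  apply: (@cvg_trans _ ((Gam (b - 1) * gauss (b - 1) N *
      ((b - 1 + N%:R) / N%:R)) @[N --> \oo])).
    apply: near_eq_cvg; near=> N; rewrite -gaussD1 ?subrK//.
    by near: N; exists 1%N.
  rewrite -[X in _ `=>` nbhs X]mulr1; apply: cvgM; last exact: cN.
  by apply: IH => //; rewrite lerBlDr natr1.
Unshelve. all: by end_near. Qed.

(** Monotonicity makes a bound at one index valid for all later ones and for the limit. For
    consecutive indices it reads [1 + (a - 1) / (n + 1) <= (1 + 1 / n)^(a - 1)], and
    [expR ((a - 1) / (n + 1))] lies in between. *)
Lemma gauss_nonincr a N M : 1 <= a -> (0 < N)%N -> (N <= M)%N ->
  gauss a M <= gauss a N.
Proof.
move=> a1 N0 /subnKC <-; elim: (M - N)%N => [|k IH]; first by rewrite addn0.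
rewrite addnS (le_trans _ IH)//.
have : (0 < N + k)%N by rewrite ltn_addr.
move: (N + k)%N => n {IH N0} n0.
have a0 : 0 < a by rewrite (lt_le_trans _ a1).
have nR : 0 < n%:R :> R by rewrite ltr0n.
rewrite /gauss rbinS -mulrA; apply: ler_wpM2l; first by rewrite rbin_ge0// ltW.
have -> : n%:R `^ (1 - a) = n.+1%:R `^ (1 - a) * (n.+1%:R / n%:R) `^ (a - 1) :> R.
  have -> : 1 - a = - (a - 1) by rewrite opprB.
  rewrite !powRN powRM ?invr_ge0// mulKf ?gt_eqF ?powR_gt0//.
  have -> : n%:R^-1 = n%:R `^ (-1) :> R by rewrite powR_inv1 ?ler0n.
  by rewrite -powRrM mulN1r powRN.
rewrite mulrC; apply: ler_wpM2l; first exact: powR_ge0.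
have q0 : 0 < n.+1%:R / n%:R :> R by rewrite divr_gt0.
rewrite /powR gt_eqF//.
apply: (@le_trans _ _ (expR ((a - 1) / n.+1%:R))); last first.
  rewrite ler_expR; apply: ler_wpM2l; first by rewrite subr_ge0.
  rewrite -lerN2 -lnV ?posrE// invf_div.
  have -> : n%:R / n.+1%:R = 1 + - n.+1%:R^-1 :> R.
    by rewrite -natr1; field; rewrite natr1 pnatr_eq0.
  by apply: le_ln1Dx; rewrite ltrN2 invf_lt1 ?posrE// ltr1n ltnS.
rewrite (le_trans _ (expR_ge1Dx _))// le_eqVlt; apply/orP; left; apply/eqP.
by rewrite -natr1; field; rewrite natr1 pnatr_eq0.
Qed.

Lemma invGamma_le_gauss a N : 1 <= a -> (0 < N)%N -> (Gam a)^-1 <= gauss a N.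
Proof.
move=> a1 N0; have a0 : 0 < a by rewrite (lt_le_trans _ a1).
rewrite -(cvg_lim _ (gauss_cvg a0))//; apply: limr_le.
  by apply/cvg_ex; exists (Gam a)^-1; exact: gauss_cvg.
by exists N => // M /= NM; exact: gauss_nonincr.
Qed.

(** For fixed [N] the bound decays exponentially in [a] at rate [ln N - 1], as large as desired.
    Each factor of [rbin a N] is at most [1 + a <= N * expR (a / N)]. *)
Lemma gauss_le_exp a N : 1 <= a -> (0 < N)%N ->
  gauss a N <= N%:R ^+ N.+1 * expR (a * (1 - ln N%:R)).
Proof.
move=> a1 N0; have a0 : 0 < a by rewrite (lt_le_trans _ a1).
have NR : 0 < N%:R :> R by rewrite ltr0n.
have h : rbin a N <= (1 + a) ^+ N.
  rewrite -{2}[N]card_ord -prodr_const; apply: ler_prod => i _.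
  rewrite divr_ge0 ?addr_ge0 ?(ltW a0)//= ler_pdivrMr//.
  rewrite -natr1 mulrDl mul1r mulrDr mulr1 addrC.
  have : 0 <= i%:R :> R by [].
  have : 0 <= a * i%:R by rewrite mulr_ge0// ltW.
  lra.
have h2 : (1 + a) ^+ N <= N%:R ^+ N * expR a.
  have -> : expR a = (expR (a / N%:R)) ^+ N by rewrite -expRM_natr divfK ?gt_eqF.
  rewrite -exprMn lerXn2r ?nnegrE ?addr_ge0 ?(ltW a0) ?mulr_ge0 ?expR_ge0//.
  apply: (@le_trans _ _ (N%:R * (1 + a / N%:R))).
    by rewrite mulrDr mulr1 mulrCA divff ?gt_eqF// mulr1 lerD2r (ler_nat _ 1 N).
  by rewrite ler_wpM2l// expR_ge1Dx.
rewrite /gauss exprSr mulrAC -mulrA.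
apply: (@le_trans _ _ (N%:R ^+ N * expR a * N%:R `^ (1 - a))).
  by rewrite ler_wpM2r ?powR_ge0// (le_trans h).
rewrite -!mulrA ler_wpM2l ?exprn_ge0// le_eqVlt; apply/orP; left; apply/eqP.
have NE : N%:R = expR (ln N%:R) :> R by rewrite lnK ?posrE.
by rewrite [X in _ = _ * X]NE /powR (gt_eqF NR) -!expRD; congr expR; ring.
Qed.

Lemma gauss_le_exp_all a N M : 0 < a -> (0 < N)%N -> (N <= M)%N ->
  gauss a M <= 2 * N%:R ^+ N.+1 * expR (a * (1 - ln N%:R)).
Proof.
move=> a0 N0 NM; have [a1|a1] := leP 1 a.
  rewrite (le_trans (gauss_nonincr a1 N0 NM))// (le_trans (gauss_le_exp a1 N0))//.
  rewrite -mulrA ler_peMl ?mulr_ge0 ?exprn_ge0 ?expR_ge0//.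
  by rewrite (ler_nat _ 1 2).
have NR : 0 < N%:R :> R by rewrite ltr0n.
have Ga := Gamma_gt0 a0.
have a10 : 0 < a + 1 by rewrite addr_gt0.
(* [1 / Gam a = a / Gam (a + 1) <= a * (a + 1)], from the first Gauss product at [a + 1]. *)
have iG : (Gam a)^-1 <= 2.
  have a11 : 1 <= a + 1 by rewrite lerDr ltW.
  have := @invGamma_le_gauss (a + 1) 1%N a11 isT.
  rewrite GammaS// invfM /gauss powR1 mulr1 rbinS rbin0 mul1r addr0 divr1.
  rewrite mulrC ler_pdivrMr// => /le_trans; apply.
  by move: a0 a1; nra.
apply: (@le_trans _ _ 2).
  have a01 : 0 < a <= 1 by rewrite a0 ltW.
  have /andP[_] := gauss_bounds a01 (leq_trans N0 NM).
  by rewrite -ler_pdivlMl// mulr1 => /le_trans; exact.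
rewrite -mulrA ler_peMr//.
have e1 : N%:R^-1 <= expR (a * (1 - ln N%:R)).
  rewrite -[N%:R in leLHS](@lnK _ N%:R) ?posrE// -expRN ler_expR.
  have l0 : 0 <= ln N%:R :> R by rewrite ln_ge0// (ler_nat _ 1 N).
  have : 0 <= (1 - a) * ln N%:R by rewrite mulr_ge0// subr_ge0 ltW.
  by move: l0 a0; nra.
apply: (@le_trans _ _ (N%:R * N%:R^-1)); first by rewrite divff ?gt_eqF.
apply: ler_pM => //; rewrite ?invr_ge0//.
by rewrite exprS ler_peMr// exprn_ege1// (ler_nat _ 1 N).
Qed.

Lemma invGamma_le_exp a N : 0 < a -> (0 < N)%N ->
  (Gam a)^-1 <= 2 * N%:R ^+ N.+1 * expR (a * (1 - ln N%:R)).
Proof.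
move=> a0 N0; rewrite -(cvg_lim _ (gauss_cvg a0))//; apply: limr_le.
  by apply/cvg_ex; exists (Gam a)^-1; exact: gauss_cvg.
by exists N => // M /= NM; exact: gauss_le_exp_all.
Qed.

End Gauss_product.

(** * The Mittag-Leffler function *)

Section Mittag_Leffler.
Context {R : realType}.
Local Notation Gam := (@Gamma R).
Local Notation ML := (@mittag_leffler R).
Implicit Types (a x y X al b c z : R) (n N j J : nat).

Lemma exists_decay X al : 0 <= X -> 0 < al ->
  exists2 N, (0 < N)%N & X * expR (al * (1 - ln N%:R)) <= 2^-1.
Proof.
(* If [ln N >= L] the exponent is at most [- (X + 1)], and [X <= expR X] leaves
   [expR (- 1) <= 1 / 2]. *)
move=> X0 al0; pose L := 1 + (X + 1) / al.
exists (Num.trunc (expR L)).+1 => //.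
have NL : L <= ln (Num.trunc (expR L)).+1%:R.
  rewrite -[leLHS]expRK ler_ln ?posrE ?expR_gt0//.
  by have /andP[_ /ltW] := Num.Theory.trunc_itv (expR_ge0 L).
apply: (@le_trans _ _ (expR X * expR (- (X + 1)))).
  apply: ler_pM; rewrite ?expR_ge0//.
    by rewrite (le_trans _ (expR_ge1Dx _))// lerDr.
  rewrite ler_expR -ler_pdivlMl// mulrC mulNr lerBlDl -lerBlDr opprK.
  exact: NL.
rewrite -expRD opprD addNKr expRN lef_pV2 ?posrE ?expR_gt0//.
by rewrite (le_trans _ (expR_ge1Dx _)).
Qed.

Let ab_gt0 al b j : 0 < al -> 0 < b -> 0 < j%:R * al + b.
Proof. by move=> al0 b0; rewrite ltr_wpDl// mulr_ge0// ltW. Qed.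

(** One geometric majorant serves the Mittag-Leffler series and all its Gauss approximations with
    [N >= N0]. Here [N0] is such that [X * expR (al * (1 - ln N0)) <= 1 / 2]. *)
Lemma gauss_series_dominated al b X : 0 < al -> 0 < b -> 0 <= X ->
  exists N0 K, [/\ (0 < N0)%N, 0 <= K,
    forall N j, (N0 <= N)%N ->
      X ^+ j * gauss (j%:R * al + b) N <= K * 2^-1 ^+ j &
    forall j, X ^+ j / Gam (j%:R * al + b) <= K * 2^-1 ^+ j].
Proof.
move=> al0 b0 X0; have [N0 N0_gt0 hN0] := exists_decay X0 al0.
pose K := 2 * N0%:R ^+ N0.+1 * expR (b * (1 - ln N0%:R)).
exists N0, K.
have key j : X ^+ j * (2 * N0%:R ^+ N0.+1 *
    expR ((j%:R * al + b) * (1 - ln N0%:R))) <= K * 2^-1 ^+ j.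
  rewrite [(_ + b) * _]mulrDl expRD -mulrA -[j%:R * _ * _]mulrA.
  rewrite [j%:R * (al * _)]mulrC expRM_natr.
  have -> : forall p q r s : R, X ^+ j * (p * (q * (r ^+ j * s))) =
      p * q * s * (X * r) ^+ j by move=> p q r s; rewrite exprMn; ring.
  rewrite -/K; apply: ler_wpM2l.
    by rewrite !mulr_ge0 ?exprn_ge0 ?expR_ge0.
  by rewrite lerXn2r ?nnegrE ?mulr_ge0 ?expR_ge0 ?invr_ge0.
split => //.
- by rewrite !mulr_ge0 ?exprn_ge0 ?expR_ge0.
- move=> N j N0N; rewrite (le_trans _ (key j))// ler_wpM2l ?exprn_ge0//.
  by apply: gauss_le_exp_all => //; exact: ab_gt0.
- move=> j; rewrite (le_trans _ (key j))// ler_wpM2l ?exprn_ge0//.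
  by apply: invGamma_le_exp => //; exact: ab_gt0.
Qed.

Lemma ge0_geometric C x m :
  (forall n, (m <= n)%N -> - (C * 2^-1 ^+ n) <= x) -> 0 <= x.
Proof.
move=> h; have c0 : - (C * 2^-1 ^+ n) @[n --> \oo] --> (- 0 : R).
  apply: cvgN; apply: cvg_geometric.
  by rewrite ger0_norm ?invr_ge0// invf_lt1// ltr1n.
rewrite -oppr0 -(cvg_lim _ c0)//; apply: limr_le.
  by apply/cvg_ex; exists (- 0).
by exists m.
Qed.

Lemma ML_cvg al b z : 0 < al -> 0 < b ->
  series (fun k => z ^+ k / Gam (k%:R * al + b)) @ \oo --> ML al b z.
Proof.
move=> al0 b0; apply: normed_cvg.
have [N0 [K [_ K0 _ hK]]] := gauss_series_dominated al0 b0 (normr_ge0 z).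
have Gp j := Gamma_gt0 (ab_gt0 j al0 b0).
apply: (@series_le_cvg _ _ (fun k => K * 2^-1 ^+ k)).
- by move=> n; exact: normr_ge0.
- by move=> n; rewrite mulr_ge0// exprn_ge0// invr_ge0.
- by move=> n /=; rewrite normrM normrX normfV [`|Gam _|]ger0_norm ?(ltW (Gp _)).
- by apply: is_cvg_geometric_series; rewrite ger0_norm ?invr_ge0// invf_lt1// ltr1n.
Qed.

(* The sum is the coefficient of [z^N] in the truncation at order [J] of the
   geometric expansion [\sum_j (- c)^j (1 - z)^(- (j + 1) al)] of
   [1 / ((1 - z)^al + c)]; the left-hand side bounds the truncation error. *)
Lemma rbin_alternating al c J N : 0 < al < 1 -> 0 < c ->
  - (c ^+ J * rbin (J%:R * al + (al + 1)) N) <=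
  \sum_(j < J.+1) (- c) ^+ j * rbin (j%:R * al + al) N.
Proof.
move=> /andP[al0 al1] c0.
pose A n := \sum_(j < J.+1) (- c) ^+ j * rbin (j%:R * al + al) n.
pose e := c ^+ J * rbin (J%:R * al + (al + 1)) N.
have JR : 0 <= J%:R * al + al by rewrite addr_ge0 ?mulr_ge0// ltW.
have e0 : 0 <= e.
  by rewrite mulr_ge0 ?exprn_ge0 ?(ltW c0)// rbin_ge0// addrA addr_ge0.
(* Multiplication by [(1 - z)^al] lowers every exponent by one step of [al]. *)
have conv n : \sum_(i < n.+1) rbin (- al) i * A (n - i)%N =
    \sum_(j < J.+1) (- c) ^+ j * rbin (j%:R * al) n.
  under eq_bigr do rewrite mulr_sumr.
  rewrite exchange_big; apply: eq_bigr => j _.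
  rewrite [in RHS](_ : j%:R * al = - al + (j%:R * al + al)); last by ring.
  by rewrite -rbin_sum mulr_sumr; apply: eq_bigr => i _; rewrite mulrCA.
(* The term [j = 0] is the constant series 1, with coefficients [rbin 0]; the others are [- c] times
   [A] without its last term. *)
have shift n : \sum_(j < J.+1) (- c) ^+ j * rbin (j%:R * al) n =
    rbin 0 n - c * (A n - (- c) ^+ J * rbin (J%:R * al + al) n).
  rewrite big_ord_recl mul0r expr0 mul1r; congr (_ + _).
  rewrite /A big_ord_recr/= addrK mulr_sumr -sumrN; apply: eq_bigr => j _.
  rewrite /bump/= add1n exprS -natr1 mulrDl mul1r.
  by rewrite !mulNr mulrA.
have d_le0 i : rbin (- al) i.+1 <= 0.
  elim: i => [|i IH].
    by rewrite rbinS rbin0 mul1r addr0 divr1 oppr_le0 ltW.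
  rewrite rbinS mulr_le0_ge0// divr_ge0// addrC subr_ge0 (le_trans (ltW al1))//.
  by rewrite (ler_nat _ 1 i.+1).
(* Partial sums of the coefficients of [(1 - z)^al] are coefficients of [(1 - z)^(al - 1)], hence
   nonnegative. *)
have d_sum n : \sum_(i < n) - rbin (- al) i.+1 <= 1.
  have := rbin_sum (- al) 1 n; rewrite big_ord_recl rbin0 mul1r rbin_1l.
  under eq_bigr do rewrite rbin_1l mulr1 lift0.
  have : 0 <= rbin (- al + 1) n by rewrite rbin_ge0// addrC subr_ge0 ltW.
  by move=> r0 h; rewrite sumrN lerNl -subr_ge0 opprK addrC h.
suff H n : (n <= N)%N -> - e <= A n by exact: H.
elim/ltn_ind: n => n IH nN.
have := conv n; rewrite shift big_ord_recl rbin0 mul1r subn0.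
under eq_bigr do rewrite lift0.
move=> hA.
have S1 : - e <= \sum_(i < n) - rbin (- al) i.+1 * A (n - i.+1)%N.
  apply: (@le_trans _ _ (\sum_(i < n) - rbin (- al) i.+1 * - e)).
    rewrite -mulr_suml mulrN lerN2 -[leRHS]mul1r ler_wpM2r//.
  apply: ler_sum => i _; apply: ler_wpM2l; first by rewrite oppr_ge0.
  by apply: IH; rewrite ?(leq_trans (leq_subr _ _))// ltn_subrL/= (leq_ltn_trans _ (ltn_ord i)).
have S2 : - e <= (- c) ^+ J * rbin (J%:R * al + al) n.
  apply: (@le_trans _ _ (- (c ^+ J * rbin (J%:R * al + al) n))).
    rewrite lerN2 ler_wpM2l ?exprn_ge0 ?(ltW c0)//.
    by rewrite addrA le_rbinD1.
  rewrite -mulNr ler_wpM2r ?rbin_ge0//.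
  by have := ler_norm (- (- c) ^+ J); rewrite normrN normrX normrN (gtr0_norm c0) lerNl.
have r0 : 0 <= rbin (0 : R) n by apply: rbin_ge0.
(* The last sum has nonnegative weights of total at most 1, so it is at least [- e] by induction;
   the truncation term is at least [- (c * e)]. The factor [1 + c] then cancels. *)
have hA' : (1 + c) * A n = rbin 0 n + c * ((- c) ^+ J * rbin (J%:R * al + al) n) +
   \sum_(i < n) - rbin (- al) i.+1 * A (n - i.+1)%N.
  under eq_bigr do rewrite mulNr.
  rewrite sumrN; move: hA.
  by move: (\sum_(i < n) _) (A n) (rbin 0 n) (_ * rbin _ n) => p q r s; lra.
have c1 : 0 < 1 + c by rewrite addr_gt0.
rewrite -(ler_pM2l c1) hA' mulrDl mul1r.
have S2' := ler_wpM2l (ltW c0) S2.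
by move: r0 S1 S2'; lra.
Qed.

(** The order of the limits matters, because the rescaled truncation error carries a factor [N]. At
    fixed [N] the truncation order goes to infinity first, which leaves only the tail beyond [J];
    then [N] goes to infinity at fixed [J], and finally [J] does. *)
Lemma ML_ge0 al X : 0 < al < 1 -> 0 < X -> 0 <= ML al al (- X).
Proof.
move=> al01 X0; have /andP[al0 al1] := al01.
have al10 : 0 < al + 1 by rewrite addr_gt0.
have [N1 [K [N1_gt0 K0 hK _]]] := gauss_series_dominated al0 al0 (ltW X0).
have [N2 [K' [N2_gt0 K'0 hK' _]]] := gauss_series_dominated al0 al10 (ltW X0).
pose S N J := \sum_(j < J) (- X) ^+ j * gauss (j%:R * al + al) N.
have SN N J : (0 < N)%N ->
    - (N%:R * (X ^+ J * gauss (J%:R * al + (al + 1)) N)) <= S N J.+1.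
  move=> N0; have NR : 0 < N%:R :> R by rewrite ltr0n.
  have Nal : 0 < N%:R `^ al :> R by rewrite powR_gt0.
  have c0 : 0 < X / N%:R `^ al by rewrite divr_gt0.
  have := rbin_alternating J N al01 c0.
  rewrite -(ler_pM2l (powR_gt0 (1 - al) NR)) mulrN mulr_sumr.
  have e j (w : R) : N%:R `^ (1 - al) * ((w / N%:R `^ al) ^+ j * rbin (j%:R * al + al) N) =
     w ^+ j * gauss (j%:R * al + al) N.
    rewrite /gauss exprMn exprVn -(@powR_mulrn _ (N%:R `^ al)) ?powR_ge0// -powRrM -powRN.
    rewrite [RHS]mulrA [in RHS](_ : 1 - (j%:R * al + al) = 1 - al + - (al * j%:R)); last by ring.
    by rewrite [in RHS]powRD ?(gt_eqF NR) ?implybT//; ring.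
  rewrite /S => h; apply: le_trans (le_trans h _); last first.
    by apply: ler_sum => j _; rewrite -mulNr e.
  rewrite lerN2 le_eqVlt; apply/orP; left; apply/eqP.
  rewrite /gauss exprMn exprVn -(@powR_mulrn _ (N%:R `^ al)) ?powR_ge0// -powRrM -powRN.
  rewrite (@powRD _ _ 1 (- al)) ?(gt_eqF NR) ?implybT//.
  rewrite [in RHS](_ : 1 - (J%:R * al + (al + 1)) = - al + - (al * J%:R)); last by ring.
  rewrite [in RHS]powRD ?(gt_eqF NR) ?implybT// powRr1 ?(ltW NR)//.
  by ring.
have SS N J : S N J.+1 = S N J + (- X) ^+ J * gauss (J%:R * al + al) N.
  by rewrite /S big_ord_recr.
have tail N J J' : (N1 <= N)%N -> (J <= J')%N ->
    S N J' - K * 2 * (2^-1 ^+ J - 2^-1 ^+ J') <= S N J.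
  move=> NN /subnKC <-; elim: (J' - J)%N => [|k IH].
    by rewrite addn0 subrr mulr0 subr0.
  rewrite addnS SS; apply: le_trans IH.
  have : (- X) ^+ (J + k) * gauss ((J + k)%:R * al + al) N <=
      K * 2^-1 ^+ (J + k).
    rewrite (le_trans (ler_norm _))// normrM normrX normrN (gtr0_norm X0).
    by rewrite ger0_norm ?hK// gauss_ge0// ab_gt0.
  by rewrite [2^-1 ^+ (J + k).+1]exprS; lra.
have Slow N J : (N1 <= N)%N -> (N2 <= N)%N -> - (K * 2 * 2^-1 ^+ J) <= S N J.
  move=> NN1 NN2; rewrite -subr_ge0 opprK.
  apply: (@ge0_geometric (N%:R * K') _ J) => J' JJ'.
  have N0 : (0 < N)%N := leq_trans N1_gt0 NN1.
  have h1 := tail N J J'.+1 NN1 (leqW JJ').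
  have h2 := SN N J' N0.
  have h3 := ler_wpM2l (ler0n R N) (hK' N J' NN2).
  have h4 : 0 <= K * 2 * 2^-1 ^+ J'.+1 by rewrite !mulr_ge0 ?exprn_ge0 ?invr_ge0.
  by move: h1 h2 h3 h4; rewrite mulrA; lra.
pose s := series (fun k => (- X) ^+ k / Gam (k%:R * al + al)).
have slow J : - (K * 2 * 2^-1 ^+ J) <= s J.
  have cS : S N J @[N --> \oo] --> s J.
    rewrite /s seriesEord /S; apply: cvg_big => [|j _]; first exact: add_continuous.
    by apply: cvgMr; exact/gauss_cvg/ab_gt0.
  rewrite -(cvg_lim _ cS)//; apply: limr_ge; first by apply/cvg_ex; exists (s J).
  exists (N1 + N2)%N => // N /= NN; apply: Slow.
    exact: leq_trans (leq_addr _ _) NN.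
  exact: leq_trans (leq_addl _ _) NN.
have cs : s J + K * 2 * 2^-1 ^+ J @[J --> \oo] --> ML al al (- X) + 0.
  apply: cvgD; first exact: ML_cvg.
  by apply: cvg_geometric; rewrite ger0_norm ?invr_ge0// invf_lt1// ltr1n.
rewrite addr0 in cs; rewrite -(cvg_lim _ cs)//; apply: limr_ge.
  by apply/cvg_ex; exists (ML al al (- X)).
by exists 0%N => // J _ /=; rewrite -(opprK (K * _ * _)) subr_ge0.
Qed.

End Mittag_Leffler.

(** * The kernel of the source term and its integral *)

Section Mittag_Leffler_kernel.
Context {R : realType}.
Notation mu := (@lebesgue_measure R).
Local Notation Gam := (@Gamma R).
Local Notation ML := (@mittag_leffler R).

Definition ML_kernel (al L t s : R) : R :=
  (t - s) `^ (al - 1) * ML al al (- (L * (t - s) `^ al)).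

Lemma ML_kernel_ge0 (al L t s : R) : 0 < al < 1 -> 0 < L -> s < t ->
  0 <= ML_kernel al L t s.
Proof.
move=> al01 L0 st; rewrite mulr_ge0 ?powR_ge0// ML_ge0//.
by rewrite mulr_gt0// powR_gt0// subr_gt0.
Qed.

(** The series is integrated term by term. The functional equation of Gamma raises the second
    parameter from [al] to [al + 1], and [E_{al,al+1}] is the series of [E_{al,1}] without its first
    term, shifted by one. *)
Lemma ML_kernel_integral (al L t : R) : 0 < al < 1 -> 0 < L -> 0 < t ->
  mu.-integrable `]0, t[ (EFin \o ML_kernel al L t) /\
  (\int[mu]_(s in `]0%R, t[) (ML_kernel al L t s)%:E =
     ((1 - ML al 1 (- (L * t `^ al))) / L)%:E)%E.
Proof.
move=> al01 L0 t0; have /andP[al0 al1] := al01.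
have mD : measurable (`]0, t[ : set (measurableTypeR R)) by exact: measurable_itv.
pose h j (s : R) : R := (- L) ^+ j / Gam (j%:R * al + al) *
  (t - s) `^ (j%:R * al + al - 1).
pose f_ n (s : measurableTypeR R) : \bar R := (\sum_(j < n) (h j s)%:E)%E.
have aj0 j : 0 < j%:R * al + al by rewrite ltr_wpDl// mulr_ge0// ltW.
have ih j : mu.-integrable `]0, t[ (EFin \o h j).
  have [i1 _] := integral_powR_subr t0 (aj0 j).
  have := integrableZl mD ((- L) ^+ j / Gam (j%:R * al + al)) i1.
  by apply: (eq_integrable mD).
have int_h j : (\int[mu]_(s in `]0%R, t[) (h j s)%:E =
    ((- L) ^+ j * t `^ (j%:R * al + al) / Gam (j%:R * al + al + 1))%:E)%E.
  have [i1 e1] := integral_powR_subr t0 (aj0 j).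
  rewrite /h; under eq_integral do rewrite EFinM.
  rewrite (integralZl mD i1) e1 -EFinM; congr EFin.
  rewrite GammaS//; field.
  by rewrite !gt_eqF// Gamma_gt0.
have yE (s : R) j : 0 < t - s ->
    h j s = (t - s) `^ (al - 1) *
      ((- (L * (t - s) `^ al)) ^+ j / Gam (j%:R * al + al)).
  move=> ts; rewrite /h -mulNr exprMn -(@powR_mulrn _ ((t - s) `^ al)) ?powR_ge0//.
  rewrite -powRrM.
  rewrite (_ : j%:R * al + al - 1 = (al - 1) + al * j%:R); last by ring.
  by rewrite powRD ?(gt_eqF ts) ?implybT//; ring.
have Lt0 : 0 <= L * t `^ al by rewrite mulr_ge0 ?powR_ge0// ltW.
have [N0 [K [_ K0 _ hK]]] := gauss_series_dominated al0 al0 Lt0.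
(* Since [(t - s)^al <= t^al], the geometric majorant at [X = L * t^al] is uniform in [s]; its sum
   is at most [2 * K]. *)
pose g (s : measurableTypeR R) : \bar R := (((K * 2)%:E * ((t - s) `^ (al - 1))%:E))%E.
have ig : mu.-integrable `]0, t[ g.
  by apply: integrableZl => //; have [] := integral_powR_subr t0 al0.
have mf_ n : measurable_fun (`]0, t[ : set (measurableTypeR R)) (f_ n).
  apply: emeasurable_sum => j; by have /integrableP[] := ih j.
have f_f s : `]0, t[%classic s -> f_ ^~ s @ \oo --> (ML_kernel al L t s)%:E.
  rewrite /= in_itv/= => /andP[s0 st].
  have ts : 0 < t - s by rewrite subr_gt0.
  have -> : f_ ^~ s = (fun n => ((t - s) `^ (al - 1) *
      series (fun k => (- (L * (t - s) `^ al)) ^+ k / Gam (k%:R * al + al)) n)%:E).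
    apply/funext => n; rewrite /f_ sumEFin seriesEord/= mulr_sumr; congr EFin.
    by apply: eq_bigr => j _; rewrite yE.
  apply: cvg_EFin; first exact: nearW.
  by apply: cvgMr; exact: ML_cvg.
have mf : measurable_fun (`]0, t[ : set (measurableTypeR R)) (EFin \o ML_kernel al L t).
  by apply: (emeasurable_fun_cvg f_).
have absfg s n : `]0, t[%classic s -> (`|f_ n s| <= g s)%E.
  rewrite /= in_itv/= => /andP[s0 st].
  have ts : 0 < t - s by rewrite subr_gt0.
  rewrite /f_ sumEFin /g -EFinM lee_fin (le_trans (ler_norm_sum _ _ _))//.
  apply: (@le_trans _ _ (\sum_(j < n) (t - s) `^ (al - 1) * (K * 2^-1 ^+ j))).
    apply: ler_sum => j _; rewrite yE// normrM ger0_norm ?powR_ge0//.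
    apply: ler_wpM2l; first exact: powR_ge0.
    apply: le_trans (hK j); rewrite normrM normfV normrX normrN.
    rewrite [`|Gam _|]gtr0_norm ?Gamma_gt0//.
    rewrite ler_wpM2r ?invr_ge0 ?(ltW (Gamma_gt0 _))//.
    rewrite normrM (gtr0_norm L0) ger0_norm ?powR_ge0//.
    rewrite lerXn2r ?nnegrE ?mulr_ge0 ?powR_ge0 ?(ltW L0)//.
    rewrite ler_pM2l// ge0_ler_powR ?nnegrE ?(ltW al0) ?(ltW ts) ?(ltW t0)//.
    by rewrite gerBl ltW.
  rewrite -mulr_sumr mulrC ler_wpM2r ?powR_ge0// -mulr_sumr ler_wpM2l//.
  have := geometric_seriesE (1 : R) (_ : 2^-1 != 1 :> R).
  rewrite lt_eqF ?invf_lt1 ?ltr1n// => /(_ isT)/funeqP/(_ n).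
  rewrite seriesEord/= => e; under eq_bigr do rewrite -[2^-1 ^+ _]mul1r.
  rewrite e mul1r.
  have : 0 <= (2^-1 : R) ^+ n by rewrite exprn_ge0// invr_ge0.
  have -> : 1 - 2^-1 = 2^-1 :> R by rewrite [X in X - _]splitr mul1r addrK.
  by rewrite invrK; lra.
have [i1 _ cv] := @dominated_convergence _ (measurableTypeR R) R mu _ mD f_
  (EFin \o ML_kernel al L t) g mf_ mf
  (@aeW _ _ _ mu _ (fun s => f_f s)) ig (@aeW _ _ _ mu _ absfg).
split => //.
apply: (cvg_unique _ cv) => //.
have -> : [sequence (\int[mu]_(x in `]0%R, t[) f_ n x)%E]_n =
  (fun n => ((1 - series (fun k => (- (L * t `^ al)) ^+ k / Gam (k%:R * al + 1)) n.+1) / L)%:E).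
  apply/funext => n /=; rewrite /f_ (integral_sum mD (fun j : 'I_n => ih j)).
  under eq_bigr do rewrite int_h.
  rewrite sumEFin; congr EFin.
  rewrite seriesEord/= big_ord_recl/= expr0 mul0r add0r Gamma1 divr1 opprD addNKr.
  rewrite -sumrN mulr_suml; apply: eq_bigr => j _.
  rewrite /bump/= add1n exprS -[j.+1%:R]natr1 [(_ + 1) * al]mulrDl mul1r.
  rewrite -(mulNr L) exprMn -(@powR_mulrn _ (t `^ al)) ?powR_ge0// -powRrM.
  rewrite powRD ?(gt_eqF t0) ?implybT// [al * _]mulrC.
  by field; rewrite !gt_eqF// Gamma_gt0// addr_gt0.
apply: cvg_EFin; first exact: nearW.
apply: cvgMl; apply: cvgB; first exact: cvg_cst.
have := @ML_cvg R al 1 (- (L * t `^ al)) al0 ltr01.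
by rewrite -(cvg_shiftn 1); under eq_fun do rewrite addn1.
Qed.
End Mittag_Leffler_kernel.

(** * The Hilbert space L^2 *)

Section L2_complete.
Context {d : measure_display} {T : measurableType d} {R : realType}.
Variable mu : {measure set T -> \bar R}.
Implicit Types f : T -> R.

Lemma sqr_integral_Lfun2 f : measurable_fun setT f ->
  (\int[mu]_x (f x ^+ 2)%:E < +oo)%E -> f \in Lfun mu 2%:E.
Proof.
move=> mf foo; rewrite inE; apply/andP; split; rewrite inE//=.
rewrite /finite_norm unlock /Lnorm poweR_lty//.
rewrite [ltLHS](_ : _ = (\int[mu]_x (f x ^+ 2)%:E)%E)//.
by apply: eq_integral => x _ /=; rewrite powR_mulrn// -normrX ger0_norm// sqr_ge0.
Qed.

Lemma measurable_sqr f : measurable_fun setT f ->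
  measurable_fun setT (fun x => (f x ^+ 2)%:E).
Proof. by move=> mf; apply/measurable_EFinP; exact: measurable_funX. Qed.

(* Weighting the squared increments by [4 ^+ k] makes their sum integrable
   while still dominating the increments by [2 ^- k]. *)
Lemma L2_fast_cauchy_ae (v : (T -> R)^nat) :
  (forall k, measurable_fun setT (v k)) ->
  (forall k, \int[mu]_x ((v k.+1 x - v k x) ^+ 2)%:E <= ((16 ^- k))%:E)%E ->
  exists2 A : set T, measurable A /\ mu (~` A) = 0 &
    forall x, A x -> cvgn (v ^~ x).
Proof.
move=> mv hv.
pose h k x : \bar R := (4 ^+ k * (v k.+1 x - v k x) ^+ 2)%:E.
have mdv k : measurable_fun setT (fun x => v k.+1 x - v k x).
  exact: measurable_funB.
have mh k : measurable_fun setT (h k).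
  apply/measurable_EFinP; apply: measurable_funM => //.
  exact: measurable_funX.
have h0 k x : (0 <= h k x)%E by rewrite lee_fin mulr_ge0// sqr_ge0.
pose H x := (\sum_(0 <= k <oo) h k x)%E.
have mH : measurable_fun setT H.
  by apply: ge0_emeasurable_sum => // k x _ _; exact: h0.
have H0 x : (0 <= H x)%E by apply: nneseries_ge0 => k _ _; exact: h0.
have intH : (\int[mu]_x H x < +oo)%E.
  rewrite integral_nneseries//.
  apply: (@le_lt_trans _ _ (\sum_(0 <= k <oo) ((geometric 1 4^-1 k : R)%:E))%E).
    apply: lee_nneseries => [k *|k *]; first by apply: integral_ge0 => x _; exact: h0.
    rewrite /h; under eq_integral do rewrite EFinM.
    rewrite ge0_integralZl//; last 2 first.
      exact: measurable_sqr.
      by move=> x _; rewrite lee_fin sqr_ge0.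
    apply: (@le_trans _ _ ((4 ^+ k)%:E * (16 ^- k)%:E)%E).
      by rewrite lee_pmul// ?lee_fin ?exprn_ge0// integral_ge0// => x _; rewrite lee_fin sqr_ge0.
    rewrite -EFinM lee_fin /= mul1r -exprVn -exprMn.
    by rewrite (_ : 4 * 16^-1 = 4^-1 :> R)//; field.
  have cg : series (geometric 1 (4^-1 : R)) @ \oo --> (1 * (1 - 4^-1)^-1 : R).
    by apply: cvg_geometric_series; rewrite ger0_norm// invf_lt1// ltr1n.
  rewrite (_ : (\sum_(0 <= k <oo) _)%E = (1 * (1 - (4 : R)^-1)^-1)%:E) ?ltry//.
  apply/cvg_lim => //.
  have -> : (fun n => (\sum_(0 <= k < n) (geometric 1 (4^-1 : R) k)%:E)%E) =
      EFin \o series (geometric 1 (4^-1 : R)).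
    by apply/funext => n /=; rewrite sumEFin.
  by apply: cvg_EFin => //; exact: nearW.
have iH : mu.-integrable setT H.
  apply/integrableP; split => //.
  by under eq_integral do rewrite gee0_abs//.
have [N [mN muN subN]] := integrable_ae measurableT iH.
exists (~` N); first by rewrite setCK; split => //; exact: measurableC.
move=> x Nx; have Hx : H x \is a fin_num.
  by apply: contrapT => nf; apply: Nx; apply: subN => /= h1; apply: nf; exact: h1.
have bound k : `|v k.+1 x - v k x| <= (1 + fine (H x)) * 2^-1 ^+ k.
  have hk : 4 ^+ k * (v k.+1 x - v k x) ^+ 2 <= fine (H x).
    rewrite -lee_fin fineK// /H.
    apply: le_trans (nneseries_lim_ge k.+1 _) => //.
    by rewrite big_nat_recr//= leeDr// sume_ge0.
  have -> : (1 + fine (H x)) * 2^-1 ^+ k = (1 + fine (H x)) / 2 ^+ k by rewrite exprVn.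
  rewrite ler_pdivlMr ?exprn_gt0//.
  have : (2 ^+ k * `|v k.+1 x - v k x|) ^+ 2 = 4 ^+ k * (v k.+1 x - v k x) ^+ 2 :> R.
    rewrite exprMn -exprM mulnC exprM real_normK ?num_real//.
    by rewrite (_ : 2 ^+ 2 = 4 :> R)//; ring.
  rewrite [leLHS]mulrC; set y := _ * `|_| => e; rewrite -e in hk.
  by have := sqr_ge0 (y - 1); have := sqr_ge0 y; move: hk; nra.
have cd : cvgn (series (fun k => v k.+1 x - v k x)).
{ apply: normed_cvg; apply: (@series_le_cvg _ _ (fun k => (1 + fine (H x)) * 2^-1 ^+ k)).
  - by move=> n; exact: normr_ge0.
  - by move=> n; rewrite mulr_ge0 ?exprn_ge0 ?invr_ge0// addr_ge0// fine_ge0.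
  - exact: bound.
  - by apply: is_cvg_geometric_series; rewrite ger0_norm// invf_lt1// ltr1n. }
have -> : v ^~ x = (fun n => v 0%N x + series (fun k => v k.+1 x - v k x) n).
  apply/funext => n; rewrite /series/= telescope_sumr//.
  by rewrite addrC subrK.
by apply: is_cvgD => //; exact: is_cvg_cst.
Qed.

(** Completeness is what lets orthonormal series with square-summable coefficients have a limit. *)
Lemma L2_complete (v : (T -> R)^nat) :
  (forall k, measurable_fun setT (v k)) ->
  (forall k, v k \in Lfun mu 2%:E) ->
  (forall e : R, 0 < e -> exists N, forall m n, (N <= m)%N -> (N <= n)%N ->
    (\int[mu]_x ((v m x - v n x) ^+ 2)%:E <= e%:E)%E) ->
  exists2 w : T -> R, w \in Lfun mu 2%:E &
    forall e : R, 0 < e -> exists N, forall n, (N <= n)%N ->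
    (\int[mu]_x ((v n x - w x) ^+ 2)%:E <= e%:E)%E.
Proof.
move=> mv Lv cau.
have e0 k : 0 < 16 ^- k :> R by rewrite invr_gt0 exprn_gt0.
have [N hN] : {N : nat -> nat & forall k m n, (N k <= m)%N -> (N k <= n)%N ->
    (\int[mu]_x ((v m x - v n x) ^+ 2)%:E <= (16 ^- k)%:E)%E}.
  apply: (@choice _ _ (fun k N => forall m n, (N <= m)%N -> (N <= n)%N ->
    (\int[mu]_x ((v m x - v n x) ^+ 2)%:E <= (16 ^- k)%:E)%E)) => k.
  exact: cau.
(* A nondecreasing choice of indices, so that [s k] and [s k.+1] both lie beyond [N k]. *)
pose s k := (\sum_(j < k.+1) N j)%N.
have Ns k : (N k <= s k)%N by rewrite /s big_ord_recr/= leq_addl.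
have Nss k : (N k <= s k.+1)%N.
  by rewrite (leq_trans (Ns k))// /s [leqRHS]big_ord_recr/= leq_addr.
have [A [mA muA] cA] := @L2_fast_cauchy_ae (fun k => v (s k)) (fun k => mv _)
  (fun k => hN k _ _ (Nss k) (Ns k)).
(* Cutting off the null set makes the subsequence converge everywhere, hence the limit
   measurable. *)
pose g k x := v (s k) x * \1_A x.
have mg k : measurable_fun setT (g k).
  by apply: measurable_funM => //; exact: measurable_indic.
have cg x : cvgn (g ^~ x).
  have [Ax|Ax] := pselect (A x).
    rewrite /g indicE mem_set//; under eq_fun do rewrite mulr1.
    exact: cA.
  rewrite /g indicE memNset//; under eq_fun do rewrite mulr0.
  exact: is_cvg_cst.
pose w x := limn (g ^~ x).
have gw x : g ^~ x @ \oo --> w x by exact: cg.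
have mw : measurable_fun setT w.
  by apply: (@measurable_fun_cvg _ _ _ _ g) => // x _; exact: gw.
(* Fatou's lemma along the subsequence, with [n] fixed. *)
have key k n : (N k <= n)%N -> (\int[mu]_x ((v n x - w x) ^+ 2)%:E <= (16 ^- k)%:E)%E.
  move=> kn.
  pose f j x : \bar R := ((v n x * \1_A x - g (k + j)%N x) ^+ 2)%:E.
  have mvA : measurable_fun setT (fun x => v n x * \1_A x).
    by apply: measurable_funM => //; exact: measurable_indic.
  have mf j : measurable_fun setT (f j).
    by apply: measurable_sqr; exact: measurable_funB.
  have aeA (a b : T -> R) : {ae mu, forall x, setT x ->
      ((a x - b x) ^+ 2)%:E = ((a x * \1_A x - b x * \1_A x) ^+ 2)%:E}.
    exists (~` A); split => //; first exact: measurableC.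
    move=> x /= h Ax; apply: h => _.
    by rewrite indicE mem_set// !mulr1.
  have wA x : w x * \1_A x = w x.
    have [Ax|Ax] := pselect (A x); first by rewrite indicE mem_set// mulr1.
    rewrite indicE memNset// mulr0 /w/g indicE memNset//.
    by under eq_fun do rewrite mulr0; rewrite lim_cst.
  have m1 : measurable_fun setT (fun x => ((v n x - w x) ^+ 2)%:E).
    by apply: measurable_sqr; exact: measurable_funB.
  have m2 : measurable_fun setT (fun x => ((v n x * \1_A x - w x) ^+ 2)%:E).
    by apply: measurable_sqr; exact: measurable_funB.
  have -> : (\int[mu]_x ((v n x - w x) ^+ 2)%:E =
      \int[mu]_x ((v n x * \1_A x - w x) ^+ 2)%:E)%E.
    apply: ge0_ae_eq_integral => // [x _|x _|]; rewrite ?lee_fin ?sqr_ge0//.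
    have := aeA (v n) w; apply: filterS => x /= h _.
    by rewrite h// wA.
  have fl x : f ^~ x @ \oo --> ((v n x * \1_A x - w x) ^+ 2)%:E.
    apply: cvg_EFin; first exact: nearW.
    have c1 : v n x * \1_A x - g (k + j)%N x @[j --> \oo] --> v n x * \1_A x - w x.
      apply: cvgB; first exact: cvg_cst.
      have := gw x; rewrite -(cvg_shiftn k).
      by under eq_fun do rewrite addnC.
    exact: (cvgM c1 c1).
  rewrite (eq_integral (fun x => limn_einf (f ^~ x))); last first.
    by move=> x _; have [-> _] := cvg_limn_einf_sup (fl x).
  apply: (le_trans (fatou mu measurableT mf _)).
    by move=> j x _; rewrite lee_fin sqr_ge0.
  have h j : (\int[mu]_x f j x <= (16 ^- k)%:E)%E.
    have m3 : measurable_fun setT (fun x => ((v n x - v (s (k + j)%N) x) ^+ 2)%:E).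
      by apply: measurable_sqr; exact: measurable_funB.
    have <- : (\int[mu]_x ((v n x - v (s (k + j)%N) x) ^+ 2)%:E =
        \int[mu]_x f j x)%E.
      apply: ge0_ae_eq_integral => // [x _|x _|]; rewrite ?lee_fin ?sqr_ge0//.
      exact: aeA.
    apply: hN => //; rewrite (leq_trans (Ns k))// /s.
    by rewrite -addSn big_split_ord/= leq_addr.
  rewrite limn_einf_lim; apply: lime_le; first exact: is_cvg_einfs.
  apply: nearW => j; apply: le_trans (h j).
  by apply: ereal_inf_lbound; exists j => /=.
exists w.
  have Lvw : (fun x => v (N 0%N) x - w x) \in Lfun mu 2%:E.
    apply: sqr_integral_Lfun2; first exact: measurable_funB.
    by rewrite (le_lt_trans (key 0%N _ (leqnn _)))// ltry.
  have h := rpredB (Lv (N 0%N)) Lvw.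
  rewrite (_ : w = v (N 0%N) - (fun x => v (N 0%N) x - w x)).
    exact: (h (lee1n 2)).
  by apply/funext => x; rewrite /= [RHS]subKr.
move=> e ep.
have [k hk] : exists k, 16 ^- k <= e.
  have : geometric 1 (16^-1 : R) @ \oo --> 0.
    by apply: cvg_geometric; rewrite ger0_norm// invf_lt1// ltr1n.
  move=> /cvgrPdist_le/(_ _ ep)[k _ /(_ k (leqnn _))] /=.
  rewrite sub0r normrN mul1r exprVn ger0_norm; last by rewrite ltW.
  by exists k.
by exists (N k) => n kn; rewrite (le_trans (key k n kn))// lee_fin.
Qed.
End L2_complete.

(** * Inner product, orthonormal expansions and the Riesz-Fischer theorem *)

Section L2_Hilbert.
Context {R : realType} {d : nat} {Omega : set 'rV[R]_d}.
Local Notation mu := (lebesgue_measure_on Omega).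
Implicit Types (u v w : L2 Omega) (a b : R).

Let LP u : (u : _ -> R) \in Lfun mu 2%:E.
Proof. exact: LfunP. Qed.

Lemma inner_integrable u v : mu.-integrable setT (EFin \o (fun x => u x * v x)).
Proof. exact/Lfun1_integrable/(Lfun2_mul_Lfun1 (LP u) (LP v)). Qed.

Lemma innerC u v : inner u v = inner v u.
Proof. by apply: eq_Rintegral => x _; rewrite mulrC. Qed.

Lemma innerDl u v w : inner (u + v) w = inner u w + inner v w.
Proof.
rewrite /inner -(RintegralD measurableT (inner_integrable u w)
  (inner_integrable v w)).
by apply: eq_Rintegral => x _; rewrite mulrDl.
Qed.

Lemma innerZl a u w : inner (a *: u) w = a * inner u w.
Proof.
rewrite /inner -(RintegralZl _ measurableT (inner_integrable u w)).
by apply: eq_Rintegral => x _; rewrite mulrA.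
Qed.

Lemma innerNl u w : inner (- u) w = - inner u w.
Proof. by rewrite -scaleN1r innerZl mulN1r. Qed.

Lemma innerBl u v w : inner (u - v) w = inner u w - inner v w.
Proof. by rewrite innerDl innerNl. Qed.

Lemma inner0l w : inner 0 w = 0.
Proof. by rewrite -(scale0r (0 : L2 Omega)) innerZl mul0r. Qed.

Lemma innerBr u v w : inner w (u - v) = inner w u - inner w v.
Proof. by rewrite !(innerC w) innerBl. Qed.

Lemma innerZr a u w : inner w (a *: u) = a * inner w u.
Proof. by rewrite !(innerC w) innerZl. Qed.

Lemma inner_suml N (u : 'I_N -> L2 Omega) w :
  inner (\sum_(n < N) u n) w = \sum_(n < N) inner (u n) w.
Proof.
elim: N u => [|N IH] u; first by rewrite !big_ord0 inner0l.
by rewrite !big_ord_recr/= innerDl IH.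
Qed.

Lemma norm2_ge0 u : 0 <= norm2 u.
Proof. by rewrite /norm2 fine_ge0// Lnorm_ge0. Qed.

Lemma integral_sqr_norm2 u : (\int[mu]_x (u x ^+ 2)%:E = (norm2 u ^+ 2)%:E)%E.
Proof.
have /esym e := finite_norm_fine u.
transitivity (('N[mu]_2%:E[EFin \o u]) `^ 2)%E.
  rewrite poweR_Lnorm ?pnatr_eq0//; apply: eq_integral => x _ /=.
  by rewrite powR_mulrn// -normrX ger0_norm// sqr_ge0.
by rewrite e poweR_EFin powR_mulrn// norm2_ge0.
Qed.

Lemma inner_norm2 u : inner u u = norm2 u ^+ 2.
Proof.
rewrite /inner /Rintegral -[RHS]/(fine (norm2 u ^+ 2)%:E) -integral_sqr_norm2.
by congr fine; apply: eq_integral => x _; rewrite expr2.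
Qed.

Lemma norm2D u v : norm2 (u + v) <= norm2 u + norm2 v.
Proof. exact: ler_LnormD. Qed.

Lemma norm2_sqrB u v : norm2 (u - v) ^+ 2 = norm2 u ^+ 2 - 2 * inner u v + norm2 v ^+ 2.
Proof. by rewrite -!inner_norm2 innerBl !innerBr (innerC v u); ring. Qed.

Lemma norm2N u : norm2 (- u) = norm2 u.
Proof.
apply/eqP; rewrite -(eqrXn2 (ltn0Sn 1)) ?norm2_ge0// -!inner_norm2.
by rewrite innerNl (innerC u) innerNl opprK.
Qed.

Lemma norm2_0 : norm2 (0 : L2 Omega) = 0.
Proof. by apply/eqP; rewrite -sqrf_eq0 -inner_norm2 inner0l. Qed.

Lemma norm2BC u v : norm2 (u - v) = norm2 (v - u).
Proof. by rewrite -norm2N opprB. Qed.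

Lemma norm2_dist u v : `|norm2 u - norm2 v| <= norm2 (u - v).
Proof.
have h (f g : L2 Omega) : norm2 f - norm2 g <= norm2 (f - g).
  by rewrite lerBlDr; have := norm2D (f - g) g; rewrite subrK.
by rewrite ler_norml h lerNl opprB norm2BC h.
Qed.

Lemma inner_cauchy_schwarz u v : `|inner u v| <= norm2 u * norm2 v.
Proof.
have q t : 0 <= norm2 u ^+ 2 - 2 * (t * inner u v) + t ^+ 2 * norm2 v ^+ 2.
  have := sqr_ge0 (norm2 (u - t *: v)).
  rewrite norm2_sqrB innerZr -(inner_norm2 (t *: v)) innerZl innerZr inner_norm2.
  by rewrite [t * (t * _)]mulrA -expr2.
rewrite -ler_sqr ?nnegrE ?mulr_ge0 ?norm2_ge0// real_normK ?num_real// exprMn.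
have [v0|v0] := eqVneq (norm2 v) 0.
  (* A function of norm 0 need not be 0. The quadratic is affine in this case, and at this point it
     would equal -1 unless [inner u v = 0]. *)
  have := q ((norm2 u ^+ 2 + 1) / inner u v / 2).
  rewrite v0 expr0n/= mulr0 addr0 mulr0.
  have [->|i0] := eqVneq (inner u v) 0; first by rewrite expr0n.
  rewrite (_ : 2 * _ = norm2 u ^+ 2 + 1); last by field.
  by rewrite opprD addNKr oppr_ge0 ler10.
have v2 : 0 < norm2 v ^+ 2 by rewrite exprn_gt0// lt_neqAle eq_sym v0 norm2_ge0.
have := q (inner u v / norm2 v ^+ 2).
rewrite -(pmulr_rge0 _ v2).
rewrite [X in 0 <= X](_ : _ = norm2 u ^+ 2 * norm2 v ^+ 2 - inner u v ^+ 2).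
  by rewrite subr_ge0.
by field.
Qed.

Lemma ae_eq_inner u v w : {ae mu, forall x, u x = v x} -> inner u w = inner v w.
Proof.
move=> uv; congr fine; apply: ae_eq_integral.
- exact: measurableT.
- by have /integrableP[] := inner_integrable u w.
- by have /integrableP[] := inner_integrable v w.
- by apply: filterS uv => x /= -> _.
Qed.

Let cvg_dist_le (a_ e_ : nat -> R) (l : R) : (forall n, `|a_ n - l| <= e_ n) ->
  e_ @ \oo --> 0 -> a_ @ \oo --> l.
Proof.
move=> ale e0; apply/subr_cvg0.
apply: (@squeeze_cvgr _ _ _ _ (fun n => - e_ n) e_) => //.
  by apply: nearW => n; rewrite -ler_norml.
by rewrite -oppr0; exact: cvgN.
Qed.

Lemma L2_cvg_inner (u_ : nat -> L2 Omega) v w : L2_cvg u_ v ->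
  inner (u_ n) w @[n --> \oo] --> inner v w.
Proof.
move=> uv; apply: (@cvg_dist_le _ (fun n => norm2 (u_ n - v) * norm2 w)).
  by move=> n; rewrite -innerBl inner_cauchy_schwarz.
by rewrite -(mul0r (norm2 w)); exact: cvgMl.
Qed.

Lemma L2_cvg_norm2 (u_ : nat -> L2 Omega) v : L2_cvg u_ v ->
  norm2 (u_ n) @[n --> \oo] --> norm2 v.
Proof.
by move=> uv; apply: (@cvg_dist_le _ (fun n => norm2 (u_ n - v))) => // n;
  exact: norm2_dist.
Qed.

Section orthonormal.
Variable phi : nat -> L2 Omega.
Hypothesis phi_basis : orthonormal_basis phi.
Implicit Types c : nat -> R.

Let ON m n : inner (phi m) (phi n) = (m == n)%:R.
Proof. by case: phi_basis. Qed.

Definition psum c N : L2 Omega := \sum_(n < N) c n *: phi n.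

Lemma inner_psuml c N w : inner (psum c N) w = \sum_(n < N) c n * inner (phi n) w.
Proof. by rewrite inner_suml; apply: eq_bigr => n _; rewrite innerZl. Qed.

Lemma inner_psum c N m : (m < N)%N -> inner (psum c N) (phi m) = c m.
Proof.
move=> mN; rewrite inner_psuml (bigD1 (Ordinal mN))//= ON eqxx mulr1 big1 ?addr0//.
move=> n /eqP nm; rewrite ON (_ : (n : nat) == m = false) ?mulr0//.
by apply/eqP => e; apply: nm; apply: val_inj.
Qed.

Lemma inner_psum_psum c M N : (M <= N)%N ->
  inner (psum c M) (psum c N) = \sum_(n < M) c n ^+ 2.
Proof.
move=> MN; rewrite inner_psuml; apply: eq_bigr => n _.
by rewrite innerC inner_psum ?expr2// (leq_trans (ltn_ord n)).
Qed.

Lemma norm2_psum c N : norm2 (psum c N) ^+ 2 = \sum_(n < N) c n ^+ 2.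
Proof. by rewrite -inner_norm2 inner_psum_psum. Qed.

Lemma norm2_psumB c M N : (M <= N)%N -> norm2 (psum c M - psum c N) ^+ 2 =
  \sum_(n < N) c n ^+ 2 - \sum_(n < M) c n ^+ 2.
Proof.
by move=> MN; rewrite norm2_sqrB inner_psum_psum// !norm2_psum; ring.
Qed.

Lemma psum_cvg_coef c w m : L2_cvg (psum c) w -> inner w (phi m) = c m.
Proof.
move=> cw; have h := L2_cvg_inner (w := phi m) cw.
apply: (cvg_unique _ h) => //; apply: cvg_near_cst.
by exists m.+1 => // n /= mn; rewrite inner_psum.
Qed.

Lemma psum_cvg_sqr c w : L2_cvg (psum c) w ->
  \sum_(n < N) c n ^+ 2 @[N --> \oo] --> norm2 w ^+ 2.
Proof.
move=> /L2_cvg_norm2 h; rewrite expr2.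
have -> : (fun N => \sum_(n < N) c n ^+ 2) =
    (fun N => norm2 (psum c N) * norm2 (psum c N)).
  by apply/funext => N; rewrite -expr2 norm2_psum.
exact: cvgM.
Qed.

Lemma parseval w :
  \sum_(n < N) inner w (phi n) ^+ 2 @[N --> \oo] --> norm2 w ^+ 2.
Proof. by apply: (@psum_cvg_sqr (fun n => inner w (phi n))); case: phi_basis => _; exact. Qed.

Lemma bessel w N : \sum_(n < N) inner w (phi n) ^+ 2 <= norm2 w ^+ 2.
Proof.
rewrite -(cvg_lim _ (@parseval w))//; apply: limr_ge.
  by apply/cvg_ex; exists (norm2 w ^+ 2); exact: parseval.
exists N => // M /= NM; rewrite -(subnKC NM) big_split_ord/= lerDl.
by apply: sumr_ge0 => n _; exact: sqr_ge0.
Qed.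

Lemma norm2_le w M : 0 <= M ->
  (forall N, \sum_(n < N) inner w (phi n) ^+ 2 <= M ^+ 2) -> norm2 w <= M.
Proof.
move=> M0 h; rewrite -ler_sqr ?nnegrE ?norm2_ge0//.
rewrite -(cvg_lim _ (@parseval w))//; apply: limr_le.
  by apply/cvg_ex; exists (norm2 w ^+ 2); exact: parseval.
exact: nearW.
Qed.

Lemma riesz_fischer c M : (forall N, \sum_(n < N) c n ^+ 2 <= M) ->
  exists w, L2_cvg (psum c) w.
Proof.
move=> cM; pose S N : R := \sum_(n < N) c n ^+ 2.
have ndS : nondecreasing_seq S.
  move=> m n mn; rewrite /S -(subnKC mn) big_split_ord/= lerDl.
  by apply: sumr_ge0 => i _; exact: sqr_ge0.
have cS : cvgn S.
  by apply: nondecreasing_is_cvgn => //; exists M => _ [n _ <-]; exact: cM.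
have Slim n : S n <= limn S by apply: nondecreasing_cvgn_le.
have mP N : measurable_fun setT (psum c N) by [].
have cau (e : R) : 0 < e -> exists N, forall m n, (N <= m)%N -> (N <= n)%N ->
    (\int[mu]_x ((psum c m x - psum c n x) ^+ 2)%:E <= e%:E)%E.
  move=> e0; have /cvgrPdist_le/(_ _ e0)[N _ hN] := cS.
  exists N => m n Nm Nn.
  rewrite (integral_sqr_norm2 (psum c m - psum c n)) lee_fin.
  wlog mn : m n Nm Nn / (m <= n)%N.
    by move=> H; have [/H|/ltnW/H] := leqP m n; rewrite ?(norm2BC (psum c m)); exact.
  rewrite norm2_psumB// -/(S n) -/(S m).
  have := hN m Nm; rewrite ger0_norm ?subr_ge0//.
  by have := Slim n; lra.
have [w Lw hw] := L2_complete mP (fun k => LP (psum c k)) cau.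
exists (Lfun_Sub (lee1n 2) Lw); apply/cvgrPdist_le => e e0.
have [N hN] := hw (e ^+ 2) (exprn_gt0 2 e0).
exists N => // n /= Nn; rewrite sub0r normrN ger0_norm ?norm2_ge0//.
rewrite -ler_sqr ?nnegrE ?norm2_ge0 ?(ltW e0)// -lee_fin -integral_sqr_norm2.
exact: hN.
Qed.

Lemma L2_sum_cvg c M : (forall N, \sum_(n < N) c n ^+ 2 <= M) ->
  L2_cvg (psum c) (L2_sum phi c).
Proof. by move=> /riesz_fischer; exact: (@xgetPex _ (0 : L2 Omega)). Qed.

Lemma L2_sum_cvg_neq0 c : norm2 (L2_sum phi c) != 0 ->
  L2_cvg (psum c) (L2_sum phi c).
Proof.
rewrite /L2_sum; case: xgetP => [w -> //|_].
by rewrite norm2_0 eqxx.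
Qed.
End orthonormal.
End L2_Hilbert.

(** * The source term *)

Section integral_ae.
Context {d : measure_display} {T : measurableType d} {R : realType}.
Variable mu : {measure set T -> \bar R}.
Implicit Types (f g : T -> \bar R) (D : set T).

Let ae_le_integralT f g : (forall x, 0 <= f x)%E -> (forall x, 0 <= g x)%E ->
  {ae mu, forall x, (f x <= g x)%E} -> (\int[mu]_x f x <= \int[mu]_x g x)%E.
Proof.
move=> f0 g0 [N [mN muN fgN]].
rewrite !ge0_integralTE//; apply: ge_ereal_sup => _ [h hf <-].
(* Set to 0 on the null set, a simple function below [f] lies below [g] and keeps its integral. *)
pose h' := proj_nnsfun h (measurableC mN).
have h'E x : h' x = h x * \1_(~` N) x by [].
apply: (@le_trans _ _ (sintegral mu h')); last first.
  apply: ereal_sup_ubound; exists h' => // x; rewrite h'E.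
  have [Nx|Nx] := pselect (N x).
    by rewrite indicE memNset ?mulr0//; exact.
  rewrite indicE mem_set// mulr1 (le_trans (hf x))//.
  by apply: contrapT => fg; apply: Nx; exact: fgN.
rewrite -!integralT_nnsfun le_eqVlt; apply/orP; left; apply/eqP.
apply: ge0_ae_eq_integral => //.
- exact/measurable_EFinP.
- exact/measurable_EFinP.
- by move=> x _; rewrite lee_fin.
- by move=> x _; rewrite lee_fin.
- exists N; split => // x /= hx; apply: contrapT => Nx; apply: hx => _.
  by rewrite /mindic indicE mem_set// mulr1.
Qed.

(* No measurability is assumed because an element of [Linfty] is a limit of
   simple functions only off a null set. *)
Lemma ae_eq_integral_nomeas D f g : {ae mu, forall x, D x -> f x = g x} ->
  (\int[mu]_(x in D) f x = \int[mu]_(x in D) g x)%E.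
Proof.
move=> fg; rewrite integral_mkcond [RHS]integral_mkcond integralE [RHS]integralE.
have fgD : {ae mu, forall x, (f \_ D) x = (g \_ D) x}.
  apply: filterS fg => x; rewrite !patchE.
  by case: ifPn => // /set_mem Dx; exact.
congr (_ - _)%E; apply/eqP; rewrite eq_le; apply/andP; split;
  apply: ae_le_integralT => //; apply: filterS fgD => x.
- by rewrite !funeposE => ->.
- by rewrite !funeposE => ->.
- by rewrite !funenegE => ->.
- by rewrite !funenegE => ->.
Qed.
End integral_ae.

Section Psi.
Context {R : realType} {d : nat} {Omega : set 'rV[R]_d}.
Local Notation leb := (@lebesgue_measure R).
Let aeF : Filter (almost_everywhere leb) := ae_filter_ringOfSetsType leb.
Implicit Types (f : R -> L2 Omega) (w : L2 Omega).

Lemma Linfty_norm_ae tau f (m : R) : (Linfty_norm tau f <= m%:E)%E ->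
  {ae leb, forall t, `]0, tau[%classic t -> norm2 (f t) <= m}.
Proof.
move=> /ess_supP[N [mN N0 hN]].
exists (N `&` `]0, tau[%classic); split.
- by apply: measurableI => //; exact: measurable_itv.
- exact: N0.
- move=> t /= ht; split.
    apply: hN => /= h; apply: ht => _.
    by rewrite -lee_fin.
  by apply: contrapT => h; apply: ht => ?.
Qed.

(** The approximating simple functions, cut off outside []0, tau[] and on the exceptional null set,
    converge everywhere, so their limit is a measurable substitute for the inner product. *)
Lemma strongly_measurable_inner tau f w : strongly_measurable tau f ->
  exists2 a : measurableTypeR R -> R, measurable_fun setT a &
    {ae leb, forall t, `]0, tau[%classic t -> inner (f t) w = a t}.
Proof.
move=> [s [ss [N [mN N0 sN]]]].
pose D : set (measurableTypeR R) := `]0, tau[%classic `\` N.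
have mD : measurable D by apply: measurableD => //; exact: measurable_itv.
pose h k (t : measurableTypeR R) : R := inner (s k t) w * \1_D t.
have mh k : measurable_fun setT (h k).
  apply: measurable_funM; last exact: measurable_indic.
  have [M [A [v [mA ->]]]] := ss k.
  have -> : (fun t : measurableTypeR R => inner (\sum_(i < M) \1_(A i) t *: v i) w) =
      (fun t => \sum_(i < M) \1_(A i) t * inner (v i) w).
    by apply/funext => t; rewrite inner_suml; apply: eq_bigr => i _; rewrite innerZl.
  apply: measurable_sum => i.
  by apply: measurable_funM => //; exact: measurable_indic.
have hD t : D t -> h ^~ t @ \oo --> inner (f t) w.
  move=> Dt; rewrite /h indicE mem_set//; under eq_fun do rewrite mulr1.
  apply: L2_cvg_inner; case: Dt => Dt Nt.
  by apply: contrapT => nc; apply: Nt; apply: sN => /= hh; apply: nc; exact: hh.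
have hc t : cvgn (h ^~ t).
  have [Dt|Dt] := pselect (D t).
    by apply/cvg_ex; exists (inner (f t) w); exact: hD.
  rewrite /h indicE memNset//; under eq_fun do rewrite mulr0.
  exact: is_cvg_cst.
exists (fun t => limn (h ^~ t)).
  by apply: (@measurable_fun_cvg _ _ _ _ h) => // t _; exact: hc.
exists N; split => // t /= ht; apply: contrapT => Nt; apply: ht => Dt.
by apply/esym/cvg_lim => //; exact: hD.
Qed.

Lemma Linfty_bounded tau f : Linfty tau f ->
  exists2 m : R, 0 <= m & {ae leb, forall t, `]0, tau[%classic t -> norm2 (f t) <= m}.
Proof.
move=> [_ foo].
have [m hm] : exists m : R, (Linfty_norm tau f <= m%:E)%E.
  move: foo; case: (Linfty_norm tau f) => [r _|//|_]; first by exists r.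
  by exists 0; rewrite leNye.
exists (Num.max m 0); first by rewrite le_max lexx orbT.
have := Linfty_norm_ae hm; apply: (@filterS _ _ aeF) => t h /h /le_trans; apply.
by rewrite le_max lexx.
Qed.

Section bound.
Variables (lam : nat -> R) (phi : nat -> L2 Omega) (al tau : R) (n : nat).
Hypothesis al01 : 0 < al < 1.
Hypothesis tau0 : 0 < tau.
Hypothesis lam0 : 0 < lam n.
Hypothesis phi1 : norm2 (phi n) = 1.
Hypothesis E0 : 0 <= E_tau lam al tau n.

Let K := ML_kernel al (lam n ^+ 2) tau.
Let D : set (measurableTypeR R) := `]0, tau[%classic.
Let mD : measurable D.
Proof. exact: measurable_itv. Qed.

Let intK : leb.-integrable D (EFin \o K).
Proof. by have [] := ML_kernel_integral al01 (exprn_gt0 2 lam0) tau0. Qed.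

Let K0 t : D t -> 0 <= K t.
Proof.
rewrite /D/= in_itv/= => /andP[_ tt].
by apply: ML_kernel_ge0 => //; exact: exprn_gt0.
Qed.

Let PsiE f : Linfty tau f -> exists a : measurableTypeR R -> R,
  [/\ measurable_fun setT a,
    {ae leb, forall t, D t -> inner (f t) (phi n) = a t},
    leb.-integrable D (EFin \o (fun t => K t * a t)) &
    Psi lam phi al f n tau = \int[leb]_(t in D) (K t * a t)].
Proof.
move=> Lf; have [a ma fa] := strongly_measurable_inner (phi n) Lf.1.
have [m m0 fm] := Linfty_bounded Lf.
have mK : measurable_fun D (EFin \o K) by case/integrableP : intK.
have mKa : measurable_fun D (EFin \o (fun t => K t * a t)).
  apply/measurable_EFinP; apply: measurable_funM; first exact/measurable_EFinP.
  exact: measurable_funS ma.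
have am : {ae leb, forall t, D t -> `|a t| <= m}.
  move: fa fm; apply: (@filterS2 _ _ aeF) => t h1 h2 Dt.
  rewrite -(h1 Dt) (le_trans (inner_cauchy_schwarz _ _))// phi1 mulr1.
  exact: h2.
exists a; split => //.
- apply/integrableP; split => //.
  have := integrableZl mD m intK => /integrableP[mmK]; apply: le_lt_trans.
  apply: ae_ge0_le_integral => //.
  + exact: measurableT_comp.
  + exact: measurableT_comp.
  + apply: filterS am => t h Dt /=.
    by rewrite lee_fin !normrM mulrC ler_wpM2r// (ger0_norm m0); exact: h.
(* The integrand of [Psi] need not be measurable itself, only equal almost everywhere to one that
   is. *)
- congr fine; apply: ae_eq_integral_nomeas.
  by apply: (@filterS _ _ aeF) fa => t h Dt; rewrite h.
Qed.

(** As [E_n >= 0], the kernel has mass at most [lam n ^- 2]; the square of this bound is a term of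
    [theta]. *)
Lemma Psi_dist f g (m : R) : Linfty tau f -> Linfty tau g ->
  (Linfty_norm tau (fun t => f t - g t)%R <= m%:E)%E -> 0 <= m ->
  `|Psi lam phi al f n tau - Psi lam phi al g n tau| <= m / lam n ^+ 2.
Proof.
move=> Lf Lg /Linfty_norm_ae fgm m0.
have [a [ma fa iKa ->]] := PsiE Lf.
have [b [mb gb iKb ->]] := PsiE Lg.
rewrite -RintegralB// -lee_fin.
have iB : leb.-integrable D (EFin \o (fun t => K t * a t - K t * b t)).
  exact: (eq_integrable mD _ _ (fun _ _ => erefl) (integrableB mD iKa iKb)).
rewrite (EFin_normr_Rintegral mD iB).
apply: (le_trans (le_abse_integral _ mD _)); first by case/integrableP : iB.
have mKm := integrableZl mD m intK.
apply: (@le_trans _ _ (\int[leb]_(t in D) (m%:E * (K t)%:E))%E).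
  { apply: ae_ge0_le_integral => //.
  - by apply: measurableT_comp => //; case/integrableP : iB.
  - by move=> t Dt; rewrite -EFinM lee_fin mulr_ge0// K0.
  - by case/integrableP : mKm.
  - move: fgm fa gb; apply: (@filterS3 _ _ aeF) => t h1 h2 h3 Dt.
    rewrite -EFinM lee_fin -mulrBr normrM (ger0_norm (K0 Dt)) mulrC.
    apply: ler_wpM2r; first exact: K0.
    rewrite -(h2 Dt) -(h3 Dt) -innerBl (le_trans (inner_cauchy_schwarz _ _))//.
    by rewrite phi1 mulr1; exact: h1. }
rewrite (integralZl mD intK).
have [_ ->] := ML_kernel_integral al01 (exprn_gt0 2 lam0) tau0.
rewrite -EFinM lee_fin; apply: ler_wpM2l => //.
rewrite -[leRHS]mul1r ler_wpM2r ?invr_ge0 ?exprn_ge0 ?(ltW lam0)//.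
by rewrite gerBl; exact: E0.
Qed.
End bound.
End Psi.

(** * Tikhonov regularization with diagonal multipliers *)

Section scalar_bounds.
Context {R : realType}.
Implicit Types (a b c p r x : R) (q : nat).

Lemma powR_expR_ln x r : 0 < x -> x `^ r = expR (r * ln x).
Proof. by move=> x0; rewrite /powR gt_eqF. Qed.

Lemma young_powR r a b : 0 <= r <= 1 -> 0 < a -> 0 < b ->
  a `^ r * b `^ (1 - r) <= r * a + (1 - r) * b.
Proof.
move=> r01 a0 b0.
have -> : a `^ r * b `^ (1 - r) = b * (a / b) `^ r.
  rewrite !powR_expR_ln ?divr_gt0// ln_div// -{2}(lnK b0) -!expRD.
  by congr expR; ring.
have := powR_le_tangent r01 (divr_gt0 a0 b0).
rewrite -(ler_pM2l b0) => /le_trans; apply.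
by rewrite le_eqVlt; apply/orP; left; apply/eqP; field; rewrite gt_eqF.
Qed.

(** Young's inequality for the two squares; with the weights [2 / (p + 2)] and [p / (p + 2)] the
    powers of [x] cancel. Used for each coefficient, it takes the place of Hölder's inequality for
    sums. *)
Lemma interpolation_weight p x a b : 0 < p -> 0 < x -> 0 < a -> 0 < b ->
  1 <= (a `^ (2 / (p + 2)) * b `^ (p / (p + 2))) ^+ 2 *
    (2 / (p + 2) * (x `^ p / a) ^+ 2 + p / (p + 2) * (x ^- 2 / b) ^+ 2).
Proof.
move=> p0 x0 a0 b0; have p20 : 0 < p + 2 by rewrite addr_gt0.
have xp0 : 0 < x `^ p by rewrite powR_gt0.
have u0 : 0 < (x `^ p / a) ^+ 2 by rewrite exprn_gt0// divr_gt0.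
have v0 : 0 < (x ^- 2 / b) ^+ 2 by rewrite exprn_gt0// divr_gt0// invr_gt0 exprn_gt0.
have r01 : 0 <= 2 / (p + 2) <= 1.
  by rewrite divr_ge0 ?(ltW p20)//= ler_pdivrMr// mul1r lerDr ltW.
have K0 : 0 < (a `^ (2 / (p + 2)) * b `^ (p / (p + 2))) ^+ 2.
  by rewrite exprn_gt0// mulr_gt0// powR_gt0.
have rE : 1 - 2 / (p + 2) = p / (p + 2) by field; rewrite gt_eqF.
have := young_powR r01 u0 v0; rewrite rE => young.
apply: le_trans (ler_wpM2l (ltW K0) young).
rewrite le_eqVlt; apply/orP; left; apply/eqP.
rewrite ![_ `^ (2 / _)]powR_expR_ln// ![_ `^ (p / _)]powR_expR_ln//.
rewrite !lnXn ?divr_gt0// ?invr_gt0 ?exprn_gt0//.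
rewrite !ln_div ?posrE ?invr_gt0 ?exprn_gt0// lnV ?posrE ?exprn_gt0// lnXn// ln_powR.
rewrite -expRD -expRM_natl -!expRD -[LHS]expR0; congr expR; rewrite !mulr2n.
by field; rewrite gt_eqF.
Qed.

(* With s = x / x0 for the minimiser x0 of the left-hand denominator, this is
   s^-2 + (2/q) s^q >= 1 + 2/q, which follows from Bernoulli's inequality. *)
Lemma tikhonov_filter_le q c b x : (0 < q)%N -> 0 < c -> 0 < b -> 0 < x ->
  (c / x ^+ 2 + b * x ^+ q)^-1 <=
  (2 * c / q%:R) `^ (2 / (q%:R + 2)) * (q%:R / (c * (1 + q%:R))) *
  b `^ (- (2 / (q%:R + 2))).
Proof.
move=> q0 c0 b0 x0; set Q : R := q%:R.
have Q0 : 0 < Q by rewrite ltr0n.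
pose y := (2 * c / (Q * b)) `^ (Q + 2)^-1.
have cb0 : 0 < 2 * c / (Q * b) by rewrite divr_gt0// mulr_gt0.
have y0 : 0 < y by rewrite powR_gt0.
have yq : b * y ^+ q * y ^+ 2 = 2 * c / Q.
  rewrite -mulrA -exprD -powR_mulrn ?(ltW y0)// /y -powRrM natrD -/Q mulVf ?gt_eqF ?addr_gt0//.
  by rewrite powRr1 ?(ltW cb0)//; field; rewrite !gt_eqF.
have y2 : y ^+ 2 = (2 * c / Q) `^ (2 / (Q + 2)) * b `^ (- (2 / (Q + 2))).
  rewrite -powR_mulrn ?(ltW y0)// /y -powRrM mulrC.
  rewrite [_^-1 * _]mulrC !powR_expR_ln ?divr_gt0 ?mulr_gt0// -expRD; congr expR.
  rewrite !ln_div ?posrE ?mulr_gt0// (lnM (x := Q))//.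
  by ring.
rewrite mulrAC -y2.
have {}yq : y ^+ q = 2 * c / Q / y ^+ 2 / b.
  by rewrite -yq; field; rewrite !gt_eqF.
pose s := x / y; have s0 : 0 < s by rewrite divr_gt0.
have xE : x = s * y by rewrite /s divfK// gt_eqF.
have bern m : 1 + m%:R * (s - 1) <= s ^+ m.
  elim: m => [|m IH]; first by rewrite mul0r addr0.
  rewrite exprS -(ler_pM2l s0) in IH *; apply: le_trans IH.
  rewrite -subr_ge0 -natr1 [leRHS](_ : _ = m%:R * (s - 1) ^+ 2); last by ring.
  by rewrite mulr_ge0// sqr_ge0.
(* The minimum is [1 + 2 / Q]; the weaker [1 + 1 / Q] is the one that yields the factor
   [q / (c4 * (1 + q))] of [C5]. *)
have key : 1 + 1 / Q <= s ^- 2 + 2 / Q * s ^+ q.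
  apply: (@le_trans _ _ (s ^- 2 + 2 / Q * (1 + Q * (s - 1)))); last first.
    by rewrite lerD2l ler_wpM2l ?bern// divr_ge0// ltW.
  rewrite -subr_ge0.
  have -> : s ^- 2 + 2 / Q * (1 + Q * (s - 1)) - (1 + 1 / Q) =
      Q^-1 + (s - 1) ^+ 2 * (2 * s + 1) / s ^+ 2.
    by field; rewrite !gt_eqF.
  apply: addr_ge0; first by rewrite invr_ge0 ltW.
  apply: divr_ge0; last exact: sqr_ge0.
  by rewrite mulr_ge0 ?sqr_ge0// addr_ge0// mulr_ge0// ltW.
have -> : c / x ^+ 2 + b * x ^+ q = c / y ^+ 2 * (s ^- 2 + 2 / Q * s ^+ q).
  by rewrite xE !exprMn yq; field; rewrite !gt_eqF.
have -> : y ^+ 2 * (Q / (c * (1 + Q))) = (c / y ^+ 2 * (1 + 1 / Q))^-1.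
  by field; rewrite !gt_eqF// addr_gt0.
have cy : 0 < c / y ^+ 2 by rewrite divr_gt0// exprn_gt0.
have k0 : 0 < 1 + 1 / Q by rewrite addr_gt0// divr_gt0.
rewrite lef_pV2 ?posrE ?(mulr_gt0 cy k0) ?(mulr_gt0 cy (lt_le_trans k0 key))//.
by rewrite ler_pM2l.
Qed.
End scalar_bounds.

(** * Comparison of norms through coefficients *)

Section multipliers.
Context {R : realType} {d : nat} {Omega : set 'rV[R]_d}.
Variable phi : nat -> L2 Omega.
Hypothesis phi_basis : orthonormal_basis phi.
Implicit Types u v : L2 Omega.

Lemma norm2_le_coef u v (M : R) : 0 <= M ->
  (forall n, `|inner u (phi n)| <= M * `|inner v (phi n)|) ->
  norm2 u <= M * norm2 v.
Proof.
move=> M0 uv; apply: (norm2_le phi_basis); first by rewrite mulr_ge0 ?norm2_ge0.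
move=> N; rewrite exprMn.
apply: le_trans (ler_wpM2l (sqr_ge0 M) (bessel phi_basis v N)).
rewrite mulr_sumr; apply: ler_sum => n _.
by rewrite -exprMn -real_normK ?num_real// -[leRHS]real_normK ?num_real//
  ler_sqr ?nnegrE// normrM (ger0_norm M0).
Qed.

Lemma eq_norm2_coef u v :
  (forall n, `|inner u (phi n)| = `|inner v (phi n)|) -> norm2 u = norm2 v.
Proof.
move=> uv; apply/eqP; rewrite eq_le -[norm2 v in X in X && _]mul1r.
by rewrite -[norm2 u in X in _ && X]mul1r !norm2_le_coef// => n; rewrite uv mul1r.
Qed.

(** The gap [e] at index [k] is present in every partial sum that contains this index, so it
    survives the limit. *)
Lemma norm2_lt_coef u v k :
  (forall n, `|inner u (phi n)| <= `|inner v (phi n)|) ->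
  `|inner u (phi k)| < `|inner v (phi k)| -> norm2 u < norm2 v.
Proof.
move=> uv uvk; pose e := inner v (phi k) ^+ 2 - inner u (phi k) ^+ 2.
have sq n : inner u (phi n) ^+ 2 <= inner v (phi n) ^+ 2.
  by rewrite -real_normK ?num_real// -[leRHS]real_normK ?num_real// ler_sqr ?nnegrE.
have e0 : 0 < e.
  by rewrite subr_gt0 -real_normK ?num_real// -[ltRHS]real_normK ?num_real// ltr_sqr ?nnegrE.
have sum_ge N : \sum_(n < N) inner u (phi n) ^+ 2 <= norm2 v ^+ 2 - e.
  pose N' := maxn N k.+1.
  have h : \sum_(n < N') inner u (phi n) ^+ 2 <= norm2 v ^+ 2 - e.
    rewrite lerBrDr; apply: le_trans (bessel phi_basis v N').
    have kN : (k < N')%N by rewrite leq_max leqnn orbT.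
    rewrite (bigD1 (Ordinal kN))//= [leRHS](bigD1 (Ordinal kN))//= addrAC.
    by rewrite addrC /e addrC subrKC lerD2l; apply: ler_sum => n _.
  apply: le_trans h; rewrite -(subnKC (leq_maxl N k.+1) : _ = N') big_split_ord/= lerDl.
  by apply: sumr_ge0 => n _; exact: sqr_ge0.
have r0 : 0 <= norm2 v ^+ 2 - e by have := sum_ge 0%N; rewrite big_ord0.
rewrite -ltr_sqr ?nnegrE ?norm2_ge0//.
have := norm2_le phi_basis (w := u) (sqrtr_ge0 (norm2 v ^+ 2 - e)).
rewrite sqr_sqrtr// => /(_ sum_ge).
rewrite -ler_sqr ?nnegrE ?norm2_ge0 ?sqrtr_ge0// sqr_sqrtr// => /le_lt_trans; apply.
by rewrite gtrBl.
Qed.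

(** Domination by the coefficients of some [v] makes the series converge, so that [L2_sum] is its
    sum and not the default value. *)
Lemma inner_L2_sum (c : nat -> R) v (M : R) n : 0 <= M ->
  (forall k, `|c k| <= M * `|inner v (phi k)|) ->
  inner (L2_sum phi c) (phi n) = c n.
Proof.
move=> M0 cv; apply: (psum_cvg_coef phi_basis (c := c)).
apply: (L2_sum_cvg phi_basis (M := M ^+ 2 * norm2 v ^+ 2)) => N.
apply: le_trans (ler_wpM2l (sqr_ge0 M) (bessel phi_basis v N)).
rewrite mulr_sumr; apply: ler_sum => i _.
by rewrite -exprMn -real_normK ?num_real// -[leRHS]real_normK ?num_real//
  ler_sqr ?nnegrE// normrM (ger0_norm M0).
Qed.

Lemma norm2_interpolation (lam : nat -> R) v (p a b : R) :
  (forall n, 0 < lam n) -> 0 < p -> 0 < a -> 0 < b ->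
  (forall N, \sum_(n < N) (lam n `^ p * inner v (phi n)) ^+ 2 <= a ^+ 2) ->
  (forall N, \sum_(n < N) (lam n ^- 2 * inner v (phi n)) ^+ 2 <= b ^+ 2) ->
  norm2 v <= a `^ (2 / (p + 2)) * b `^ (p / (p + 2)).
Proof.
move=> lam0 p0 a0 b0 va vb; have p20 : 0 < p + 2 by rewrite addr_gt0.
apply: (norm2_le phi_basis); first by rewrite mulr_ge0 ?powR_ge0.
move=> N; set K := (X in _ <= X ^+ 2).
apply: (@le_trans _ _ (\sum_(n < N) K ^+ 2 *
    (2 / (p + 2) * (lam n `^ p / a) ^+ 2 + p / (p + 2) * (lam n ^- 2 / b) ^+ 2) *
    inner v (phi n) ^+ 2)).
  apply: ler_sum => n _; rewrite -[leLHS]mul1r ler_wpM2r ?sqr_ge0//.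
  exact: interpolation_weight.
have -> : \sum_(n < N) K ^+ 2 * (2 / (p + 2) * (lam n `^ p / a) ^+ 2 +
      p / (p + 2) * (lam n ^- 2 / b) ^+ 2) * inner v (phi n) ^+ 2 =
    K ^+ 2 * (2 / (p + 2) * (\sum_(n < N) (lam n `^ p * inner v (phi n)) ^+ 2 / a ^+ 2)
     + p / (p + 2) * (\sum_(n < N) (lam n ^- 2 * inner v (phi n)) ^+ 2 / b ^+ 2)).
  rewrite !mulr_sumr -big_split mulr_sumr; apply: eq_bigr => n _ /=.
  by rewrite !exprMn !exprVn; ring.
rewrite -[leRHS]mulr1 ler_wpM2l ?sqr_ge0//.
rewrite -!mulr_suml.
have pE : 2 / (p + 2) * 1 + p / (p + 2) * 1 = 1 :> R by field; rewrite gt_eqF.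
rewrite -[leRHS]pE; apply: lerD; apply: ler_wpM2l; rewrite ?divr_ge0 ?(ltW p0) ?(ltW p20)//.
- by rewrite ler_pdivrMr ?exprn_gt0// mul1r.
- by rewrite ler_pdivrMr ?exprn_gt0// mul1r.
Qed.
End multipliers.

(** * The discrepancy principle and the error split for abstract multipliers *)

Section tikhonov.
Context {R : realType} {d : nat} {Omega : set 'rV[R]_d}.
Variables (phi : nat -> L2 Omega) (lam E : nat -> R) (q : nat) (c4 c10 eps : R).
Variables g v : L2 Omega.
Hypothesis phi_basis : orthonormal_basis phi.
Hypothesis lam0_gt0 : 0 < lam 0%N.
Hypothesis lam0_le : forall n, lam 0%N <= lam n.
Hypothesis c4_gt0 : 0 < c4.
Hypothesis E_bounds : forall n, c4 / lam n ^+ 2 <= E n <= c10 / lam n ^+ 2.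
Hypothesis eps_ge0 : 0 <= eps.
Hypothesis noise : forall N,
  \sum_(n < N) (E n * inner g (phi n) - inner v (phi n)) ^+ 2 <= eps ^+ 2.

Implicit Types (a b t : R) (n k : nat).

Local Notation gc n := (inner g (phi n)).
Local Notation vc n := (inner v (phi n)).

Definition tikhonov (b : R) : L2 Omega :=
  L2_sum phi (fun n => vc n / (E n + b * lam n ^+ q)).

Definition tikhonov_discrepancy (b : R) : R :=
  norm2 (L2_sum phi (fun n => E n * inner (tikhonov b) (phi n)) - v).

Let wt b n := b * lam n ^+ q / (E n + b * lam n ^+ q).
Let lam_gt0 n : 0 < lam n.
Proof. exact: lt_le_trans lam0_gt0 (lam0_le n). Qed.

Let lamq_gt0 n : 0 < lam n ^+ q.
Proof. exact: exprn_gt0. Qed.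

Let E_gt0 n : 0 < E n.
Proof.
have /andP[+ _] := E_bounds n; apply: lt_le_trans.
by rewrite divr_gt0// exprn_gt0.
Qed.

Let c10_gt0 : 0 < c10.
Proof.
have /andP[_] := E_bounds 0%N; move/(lt_le_trans (E_gt0 0%N)).
by rewrite pmulr_lgt0// invr_gt0 exprn_gt0.
Qed.

Let Emax := c10 / lam 0%N ^+ 2.

Let E_le n : E n <= Emax.
Proof.
have /andP[_] := E_bounds n; move/le_trans; apply.
rewrite ler_wpM2l ?(ltW c10_gt0)// lef_pV2 ?posrE ?exprn_gt0//.
by rewrite ler_pXn2r ?nnegrE ?(ltW (lam_gt0 _)).
Qed.

Let Emax_ge0 : 0 <= Emax.
Proof. by rewrite (le_trans _ (E_le 0%N))// ltW. Qed.

Let E_coef_le w n : `|E n * w| <= Emax * `|w|.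
Proof. by rewrite normrM ler_wpM2r// ger0_norm// ltW. Qed.

Lemma inner_E_series w n :
  inner (L2_sum phi (fun n => E n * inner w (phi n))) (phi n) = E n * inner w (phi n).
Proof. by rewrite (inner_L2_sum phi_basis (v := w) (M := Emax)). Qed.

Let den_gt0 b n : 0 < b -> 0 < E n + b * lam n ^+ q.
Proof. by move=> b0; rewrite addr_gt0// mulr_gt0. Qed.

Let wt_ge0 b n : 0 < b -> 0 <= wt b n.
Proof. by move=> b0; rewrite divr_ge0 ?ltW ?mulr_gt0 ?den_gt0. Qed.

Let wtE b n : 0 < b -> wt b n = 1 - E n / (E n + b * lam n ^+ q).
Proof. by move=> b0; rewrite /wt; field; rewrite gt_eqF ?den_gt0. Qed.

Let wt_le1 b n : 0 < b -> wt b n <= 1.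
Proof. by move=> b0; rewrite wtE// gerBl divr_ge0 ?ltW ?den_gt0. Qed.

Let ler_bl b n : 0 < b -> b * lam 0%N ^+ q <= b * lam n ^+ q.
Proof.
move=> b0; rewrite ler_wpM2l ?(ltW b0)// lerXn2r ?nnegrE ?(ltW (lam_gt0 _))//.
Qed.

(* Opaque, so that unification never unfolds it. *)
Let resid_sig : {r : R -> L2 Omega |
  forall b n, 0 < b -> inner (r b) (phi n) = wt b n * vc n}.
Proof.
exists (fun b => L2_sum phi (fun n => wt b n * vc n)) => b n b0.
apply: (inner_L2_sum phi_basis (v := v) (M := 1)) => // k.
by rewrite normrM ger0_norm ?wt_ge0// ler_wpM2r// wt_le1.
Qed.

Let resid := sval resid_sig.

Let inner_resid b n : 0 < b -> inner (resid b) (phi n) = wt b n * vc n.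
Proof. exact: (svalP resid_sig). Qed.

Let inner_tikhonov b n : 0 < b ->
  inner (tikhonov b) (phi n) = vc n / (E n + b * lam n ^+ q).
Proof.
move=> b0; apply: (inner_L2_sum phi_basis (v := v) (M := (b * lam 0%N ^+ q)^-1)).
  by rewrite invr_ge0 mulr_ge0 ?ltW.
move=> k; rewrite normrM mulrC ler_wpM2r// ger0_norm ?invr_ge0 ?(ltW (den_gt0 k b0))//.
rewrite lef_pV2 ?posrE ?den_gt0 ?mulr_gt0//.
by rewrite (le_trans (ler_bl k b0))// lerDr ltW.
Qed.

Let discrepancyE b : 0 < b -> tikhonov_discrepancy b = norm2 (resid b).
Proof.
move=> b0; apply: (eq_norm2_coef phi_basis) => n.
rewrite innerBl inner_resid// inner_E_series inner_tikhonov// /wt -normrN.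
by congr `|_|; field; rewrite gt_eqF ?den_gt0.
Qed.

(** It yields the continuity in the parameter needed for the intermediate value theorem. *)
Let resid_lip a b : 0 < a -> 0 < b ->
  `|norm2 (resid a) - norm2 (resid b)| <= `|b - a| / a * norm2 v.
Proof.
move=> a0 b0; apply: le_trans (norm2_dist _ _) _.
apply: (norm2_le_coef phi_basis); first by rewrite divr_ge0// ltW.
move=> n; rewrite innerBl !inner_resid// -mulrBl normrM ler_wpM2r//.
have -> : wt a n - wt b n = (a - b) / a * (a * lam n ^+ q / (E n + a * lam n ^+ q))
    * (E n / (E n + b * lam n ^+ q)).
  by rewrite /wt; field; rewrite !gt_eqF ?den_gt0.
rewrite -/(wt a n) -mulrA normrM normrM distrC normfV (gtr0_norm a0).
rewrite -[leRHS]mulr1 ler_wpM2l ?divr_ge0 ?(ltW a0)//.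
have e0 : 0 <= E n / (E n + b * lam n ^+ q) by rewrite divr_ge0 ?ltW ?den_gt0.
rewrite (ger0_norm (mulr_ge0 (wt_ge0 n a0) e0)) mulr_ile1 ?wt_ge0 ?wt_le1//.
by rewrite ler_pdivrMr ?den_gt0// mul1r lerDl ltW ?mulr_gt0.
Qed.

Let resid_lt a b : norm2 v != 0 -> 0 < a -> a < b ->
  norm2 (resid a) < norm2 (resid b).
Proof.
move=> v0 a0 ab; have b0 := lt_trans a0 ab.
have wtab n : wt a n < wt b n.
  rewrite !wtE// ltrD2l ltrN2 ltr_pM2l// ltf_pV2 ?posrE ?den_gt0//.
  by rewrite ltrD2l ltr_pM2r.
have [k vk] : exists k, vc k != 0.
  apply: contrapT => nv; move/negP : v0; apply; rewrite eq_le norm2_ge0 andbT.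
  apply: (norm2_le phi_basis) => // N; rewrite big1 ?expr0n// => n _.
  have [->|vn] := eqVneq (vc n) 0; first by rewrite expr0n.
  by exfalso; apply: nv; exists n.
apply: (norm2_lt_coef phi_basis (k := k)) => [n|]; rewrite !inner_resid//
  [`|wt a _ * _|]normrM [`|wt b _ * _|]normrM (ger0_norm (wt_ge0 _ a0)) (ger0_norm (wt_ge0 _ b0)).
- by rewrite ler_wpM2r// ltW.
- by rewrite ltr_pM2r ?normr_gt0.
Qed.

Let noise_coef n : inner (L2_sum phi (fun n => E n * gc n) - v) (phi n) =
  E n * gc n - vc n.
Proof. by rewrite innerBl inner_E_series. Qed.

Let noise_norm2 : norm2 (L2_sum phi (fun n => E n * gc n) - v) <= eps.
Proof.
apply: (norm2_le phi_basis) => // N; apply: le_trans (noise N).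
by apply: ler_sum => n _; rewrite noise_coef.
Qed.

(** The residual that exact data would leave; as the weights are at most 1, its norm differs by at
    most [eps] from that of the actual residual. *)
Let smooth_sig : {r : R -> L2 Omega |
  forall b n, 0 < b -> inner (r b) (phi n) = wt b n * E n * gc n}.
Proof.
exists (fun b => L2_sum phi (fun n => wt b n * E n * gc n)) => b n b0.
apply: (inner_L2_sum phi_basis (v := g) (M := Emax)) => // k.
rewrite -mulrA normrM ger0_norm ?wt_ge0//.
by rewrite -[leRHS]mul1r ler_pM ?wt_ge0 ?wt_le1 ?E_coef_le.
Qed.

Let smooth := sval smooth_sig.

Let inner_smooth b n : 0 < b -> inner (smooth b) (phi n) = wt b n * E n * gc n.
Proof. exact: (svalP smooth_sig). Qed.

Let smooth_resid b : 0 < b -> `|norm2 (smooth b) - norm2 (resid b)| <= eps.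
Proof.
move=> b0; apply: le_trans (norm2_dist _ _) _; apply: le_trans noise_norm2.
rewrite -[leRHS]mul1r; apply: (norm2_le_coef phi_basis) => // n.
rewrite noise_coef innerBl inner_smooth// inner_resid//.
by rewrite -mulrA -mulrBr normrM ler_wpM2r// ger0_norm ?wt_ge0 ?wt_le1.
Qed.

(** The products [w_n E_n] tend to 0 with [b], uniformly in [n]: for [lam n <= L] because
    [b * lam n ^+ q <= e], beyond [L] because [E n <= c10 / lam n ^+ 2 <= e]. The [+ 1] in [e]
    covers [norm2 g = 0]. *)
Let resid_small t : eps < t -> exists2 b, 0 < b & norm2 (resid b) <= t.
Proof.
move=> et; pose e := (t - eps) / (norm2 g + 1).
have g1 : 0 < norm2 g + 1 by rewrite ltr_wpDl ?norm2_ge0.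
have e0 : 0 < e by rewrite divr_gt0 ?subr_gt0.
pose L := Num.max 1 (c10 / e).
have L0 : 0 < L by rewrite lt_max ltr01.
have Lq0 : 0 < L ^+ q by rewrite exprn_gt0.
exists (e / L ^+ q); first by rewrite divr_gt0.
have b0 : 0 < e / L ^+ q by rewrite divr_gt0.
have wtEe n : wt (e / L ^+ q) n * E n <= e.
  have [lL|Ll] := leP (lam n) L.
    have -> : wt (e / L ^+ q) n * E n = e * (lam n ^+ q / L ^+ q) *
        (E n / (E n + e / L ^+ q * lam n ^+ q)).
      rewrite /wt; field.
      by apply/andP; split; rewrite gt_eqF// addr_gt0// mulr_gt0.
    { rewrite -mulrA -[leRHS]mulr1 ler_wpM2l ?(ltW e0)// mulr_ile1//.
    + by rewrite divr_ge0 ?ltW.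
    + by rewrite divr_ge0 ?ltW ?den_gt0.
    + rewrite ler_pdivrMr// mul1r; apply: lerXn2r lL; rewrite nnegrE ltW//.
    + by rewrite ler_pdivrMr ?den_gt0// mul1r lerDl; exact: ltW (mulr_gt0 b0 _). }
  apply: (@le_trans _ _ (E n)).
    by rewrite -[leRHS]mul1r ler_wpM2r ?wt_le1// ltW.
  have /andP[_ /le_trans] := E_bounds n; apply.
  rewrite ler_pdivrMr ?exprn_gt0//.
  have L1 : 1 <= L by rewrite le_max lexx.
  have Lc : c10 <= e * L by rewrite mulrC -ler_pdivrMr// le_max lexx orbT.
  apply: le_trans Lc _; rewrite ler_wpM2l ?(ltW e0)// (le_trans (ltW Ll))//.
  by rewrite expr2 ler_peMr ?(ltW (lam_gt0 n))// (le_trans L1)// ltW.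
have := smooth_resid b0; rewrite ler_distl => /andP[+ _].
have : norm2 (smooth (e / L ^+ q)) <= e * norm2 g.
  apply: (norm2_le_coef phi_basis); first exact: ltW.
  move=> n; rewrite inner_smooth// normrM ler_wpM2r// ger0_norm ?wtEe//.
  by rewrite mulr_ge0 ?wt_ge0// ltW.
have : e * norm2 g <= e * (norm2 g + 1) by rewrite ler_wpM2l ?(ltW e0)// lerDl.
rewrite {2}/e divfK ?gt_eqF//; lra.
Qed.

(** The weights tend to 1 as [b] grows, uniformly in [n] because the eigenvalues are at least
    [lam 0]. *)
Let resid_large t : t < norm2 v ->
  exists2 b0, 0 < b0 & forall b, b0 <= b -> t <= norm2 (resid b).
Proof.
move=> tv; pose b0 := (Emax / lam 0%N ^+ q) * (norm2 v + 1) / (norm2 v - t).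
have Em : 0 < Emax by rewrite divr_gt0// exprn_gt0.
have v1 : 0 < norm2 v + 1 by rewrite ltr_wpDl ?norm2_ge0.
have b00 : 0 < b0 by rewrite divr_gt0 ?subr_gt0// mulr_gt0// divr_gt0.
exists b0 => // b b0b; have b_gt0 := lt_le_trans b00 b0b.
have : `|norm2 v - norm2 (resid b)| <= Emax / lam 0%N ^+ q / b * norm2 v.
  apply: le_trans (norm2_dist _ _) _; apply: (norm2_le_coef phi_basis).
    exact: divr_ge0 (divr_ge0 Emax_ge0 (ltW (lamq_gt0 0%N))) (ltW b_gt0).
  move=> n; rewrite innerBl inner_resid// -{1}[vc n]mul1r -mulrBl normrM ler_wpM2r//.
  rewrite wtE// subKr ger0_norm; last exact: divr_ge0 (ltW (E_gt0 n)) (ltW (den_gt0 n b_gt0)).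
  rewrite -mulrA -invfM [lam _ ^+ _ * b]mulrC.
  apply: ler_pM => //; rewrite ?invr_ge0 ?(ltW (E_gt0 n)) ?(ltW (den_gt0 n b_gt0))//.
  rewrite lef_pV2 ?posrE ?den_gt0 ?mulr_gt0// (le_trans (ler_bl n b_gt0))// lerDr.
  exact: ltW.
rewrite ler_distl => /andP[_]; rewrite -lerBlDr; apply: le_trans.
rewrite lerBrDr -lerBrDl -mulrA [b^-1 * _]mulrC mulrA ler_pdivrMr//.
apply: (@le_trans _ _ ((norm2 v - t) * b0)).
  rewrite /b0 mulrCA mulfV ?subr_eq0 ?gt_eqF// mulr1 ler_wpM2l ?lerDl//.
  by rewrite divr_ge0 ?ltW.
by rewrite ler_wpM2l// subr_ge0 ltW.
Qed.

Lemma discrepancy_principle t : eps < t -> t < norm2 v ->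
  exists b, unique (fun b => 0 < b /\ tikhonov_discrepancy b = t) b.
Proof.
move=> et tv; have [a a0 at_] := resid_small et.
have [b1 b10 tb] := resid_large tv.
pose b := Num.max a b1.
have ab : a <= b by rewrite le_max lexx.
have cts : {within `[a, b], continuous (fun x => norm2 (resid x))}.
  apply: continuous_subspaceW (_ : `[a, b] `<=` `]0, +oo[) _.
    by move=> x /=; rewrite !in_itv/= andbT => /andP[/(lt_le_trans a0)].
  apply/continuous_in_subspaceT => x /set_mem /=; rewrite in_itv/= andbT => x0.
  apply/cvgrPdist_le => e e0.
  pose r := e * x / (norm2 v + 1).
  have v1 : 0 < norm2 v + 1 by rewrite ltr_wpDl ?norm2_ge0.
  have r0 : 0 < r by rewrite !mulr_gt0 ?invr_gt0.
  near=> y.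
  have y0 : 0 < y by near: y; exact: lt_nbhsr.
  apply: le_trans (resid_lip x0 y0) _.
  have yx : `|y - x| <= r.
    by rewrite distrC; near: y; apply: cvgr_dist_le => //; exact: cvg_id.
  apply: (@le_trans _ _ (r / x * (norm2 v + 1))).
    by rewrite ler_pM ?divr_ge0 ?norm2_ge0 ?(ltW x0) ?lerDl// ler_wpM2r// invr_ge0 ltW.
  by rewrite /r le_eqVlt; apply/orP; left; apply/eqP; field; rewrite !gt_eqF.
have [|c] := IVT ab cts (v := t).
  apply/andP; split; first by rewrite ge_min at_.
  by rewrite le_max (tb b) ?orbT// le_max lexx orbT.
rewrite in_itv/= => /andP[ac _] ct; have c0 := lt_le_trans a0 ac.
exists c; split => [|x [x0]]; first by rewrite discrepancyE.
rewrite discrepancyE// -ct.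
have v0 : norm2 v != 0 by rewrite gt_eqF// (le_lt_trans eps_ge0)// (lt_trans et).
by case: (ltgtP c x) => // h xc; [have := resid_lt v0 c0 h|have := resid_lt v0 x0 h];
  rewrite xc ltxx.
Unshelve. all: by end_near.
Qed.

Variables (rho p b t : R).
Hypothesis rho_gt0 : 0 < rho.
Hypothesis p_gt0 : 0 < p.
Hypothesis source : forall N, \sum_(n < N) (lam n `^ p * gc n) ^+ 2 <= rho ^+ 2.
Hypothesis b_gt0 : 0 < b.
Hypothesis bt : tikhonov_discrepancy b = t.
Hypothesis t_gt0 : 0 < t.

Let norm2_smooth : norm2 (smooth b) <= t + eps.
Proof.
have := smooth_resid b_gt0; rewrite -discrepancyE// bt ler_distl => /andP[_].
by rewrite addrC.
Qed.

(** In the applications [k] is a constant times a power of [b], so this is the lower bound on the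
    parameter. *)
Lemma tikhonov_parameter_ge (k : R) : 0 <= k ->
  (forall n, b * lam n ^+ q / (E n + b * lam n ^+ q) * E n <= k * lam n `^ p) ->
  t - eps <= k * rho.
Proof.
move=> k0 hk.
have h : t - eps <= norm2 (smooth b).
  by have := smooth_resid b_gt0; rewrite -discrepancyE// bt ler_distl => /andP[].
apply: le_trans h _; apply: (norm2_le phi_basis); first exact: mulr_ge0 k0 (ltW rho_gt0).
move=> N; rewrite exprMn; apply: le_trans (ler_wpM2l (sqr_ge0 k) (source N)).
rewrite mulr_sumr; apply: ler_sum => n _; rewrite inner_smooth// -exprMn mulrA.
rewrite [leLHS]exprMn [leRHS]exprMn ler_wpM2r ?sqr_ge0//.
apply: lerXn2r (hk n); rewrite nnegrE; last by rewrite mulr_ge0 ?powR_ge0.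
exact: mulr_ge0 (wt_ge0 n b_gt0) (ltW (E_gt0 n)).
Qed.

(** [k] is the amplification of the noise; [c4^-1 * (t + eps)] bounds the norm weighted by
    [lam n ^- 2] of the noise-free error. *)
Lemma tikhonov_error (k : R) :
  (forall n, (E n + b * lam n ^+ q)^-1 <= k) ->
  norm2 (g - tikhonov b) <=
  rho `^ (2 / (p + 2)) * (c4^-1 * (t + eps)) `^ (p / (p + 2)) + k * eps.
Proof.
move=> hk.
have [wg inner_wg] : exists w, forall n, inner w (phi n) = wt b n * gc n.
  exists (L2_sum phi (fun n => wt b n * gc n)) => n.
  apply: (inner_L2_sum phi_basis (v := g) (M := 1)) => // j.
  by rewrite normrM ger0_norm ?wt_ge0// ler_wpM2r// wt_le1.
have k0 : 0 <= k.
  by apply: le_trans (hk 0%N); rewrite invr_ge0 ltW// den_gt0.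
have -> : g - tikhonov b = wg + (g - tikhonov b - wg) by rewrite [RHS]addrC subrK.
apply: le_trans (norm2D _ _) _; apply: lerD.
  { apply: (norm2_interpolation phi_basis) => //.
  - by rewrite mulr_gt0 ?invr_gt0// ltr_pwDl.
  - move=> N; apply: le_trans (source N); apply: ler_sum => n _.
    rewrite inner_wg mulrCA exprMn -[leRHS]mul1r ler_wpM2r ?sqr_ge0//.
    by rewrite exprn_ile1 ?wt_ge0 ?wt_le1.
  - move=> N; apply: (@le_trans _ _ ((c4^-1 * norm2 (smooth b)) ^+ 2)); last first.
      rewrite lerXn2r ?nnegrE ?mulr_ge0 ?norm2_ge0 ?invr_ge0 ?addr_ge0//
        ?(ltW c4_gt0) ?(ltW t_gt0)//.
      by rewrite ler_wpM2l// invr_ge0 ltW.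
    rewrite exprMn; apply: le_trans (ler_wpM2l (sqr_ge0 _) (bessel phi_basis _ N)).
    rewrite mulr_sumr; apply: ler_sum => n _; rewrite inner_smooth// inner_wg -exprMn.
    move: (wt_ge0 n b_gt0); move: (wt b n) => w w0.
    have lw : lam n ^- 2 * w <= c4^-1 * (w * E n).
      rewrite mulrCA [leLHS]mulrC ler_wpM2l// ler_pdivlMl//.
      by have /andP[] := E_bounds n.
    rewrite [c4^-1 * _]mulrA [lam n ^- 2 * _]mulrA [leLHS]exprMn [leRHS]exprMn.
    rewrite ler_wpM2r ?sqr_ge0//; apply: lerXn2r lw; rewrite nnegrE.
    + by rewrite mulr_ge0// invr_ge0 sqr_ge0.
    + by rewrite mulr_ge0 ?invr_ge0 ?mulr_ge0// ltW. }
apply: le_trans (ler_wpM2l k0 noise_norm2).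
apply: (norm2_le_coef phi_basis k0) => n.
rewrite noise_coef !innerBl inner_wg (inner_tikhonov n b_gt0).
have -> : gc n - vc n / (E n + b * lam n ^+ q) - wt b n * gc n =
    (E n + b * lam n ^+ q)^-1 * (E n * gc n - vc n).
  by rewrite /wt; field; rewrite gt_eqF ?den_gt0.
by rewrite normrM ler_wpM2r// ger0_norm// invr_ge0 ltW ?den_gt0.
Qed.
End tikhonov.

(** * From the parameter bound to powers of the noise level *)

Section rates.
Context {R : realType}.
Implicit Types (a b c m p r x E : R) (q : nat).

(** With [z = b * x^(q+2) / c4] the weight is at most [z / (1 + z) <= z^r], which requires [r <= 1],
    that is [p <= q]. The exponent [r] is chosen so that [z^r / x^2] is proportional to [x^p]; the
    constant is [C11]. *)
Lemma tikhonov_weight_le q c4 c10 p b x E : 0 < c4 -> 0 < p -> p < q%:R ->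
  0 < b -> 0 < x -> c4 / x ^+ 2 <= E -> E <= c10 / x ^+ 2 ->
  b * x ^+ q / (E + b * x ^+ q) * E <=
  c10 * c4 `^ (- ((p + 2) / (q%:R + 2))) * b `^ ((p + 2) / (q%:R + 2)) * x `^ p.
Proof.
move=> c40 p0 pq b0 x0 E1 E2; set r := (p + 2) / (q%:R + 2).
have q20 : 0 < q%:R + 2 :> R by rewrite ltr_wpDl.
have p20 : 0 < p + 2 by rewrite addr_gt0.
have x20 : 0 < x ^+ 2 by rewrite exprn_gt0.
have xq0 : 0 < x ^+ q by rewrite exprn_gt0.
have bx0 : 0 < b * x ^+ q by rewrite mulr_gt0.
have E0 : 0 < E by apply: lt_le_trans E1; rewrite divr_gt0.
pose z := b * x ^+ q * x ^+ 2 / c4.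
have z0 : 0 < z by rewrite divr_gt0// mulr_gt0.
have r01 : 0 <= 1 - r <= 1.
  have r0 : 0 <= r by rewrite divr_ge0// ltW.
  have r1 : r <= 1 by rewrite ler_pdivrMr// mul1r lerD2r ltW.
  by rewrite subr_ge0 r1 gerBl.
have wz : b * x ^+ q / (E + b * x ^+ q) <= z `^ r.
  apply: (@le_trans _ _ (z / (1 + z))).
    have -> : z / (1 + z) = b * x ^+ q / (c4 / x ^+ 2 + b * x ^+ q).
      rewrite /z; field; rewrite !gt_eqF//=.
      by rewrite addr_gt0// mulr_gt0.
    rewrite ler_wpM2l ?(ltW bx0)// lef_pV2 ?posrE ?addr_gt0// ?divr_gt0//.
    by rewrite lerD2r.
  rewrite ler_pdivrMr ?addr_gt0// -[leLHS](powRr1 (ltW z0)).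
  have -> : 1 = r + (1 - r) :> R by rewrite addrC subrK.
  rewrite powRD ?(gt_eqF z0) ?implybT// ler_wpM2l ?powR_ge0//.
  have := young_powR r01 z0 ltr01; rewrite powR1 mulr1 => /le_trans; apply.
  have /andP[r0 r1] := r01; have : (1 - r) * z <= z by rewrite ler_piMl// ltW.
  lra.
apply: (@le_trans _ _ (z `^ r * (c10 / x ^+ 2))).
  by rewrite ler_pM// ?ltW// divr_gt0// addr_gt0.
have -> : z `^ r = c4 `^ (- r) * b `^ r * (x `^ p * x ^+ 2).
  rewrite -[x ^+ 2](powR_mulrn _ (ltW x0)) !powR_expR_ln// -!expRD; congr expR.
  rewrite /z ln_div ?posrE ?mulr_gt0// !lnM ?posrE ?mulr_gt0// !lnXn// -[_ *+ q]mulr_natr mulr2n.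
  by rewrite /r; field; rewrite gt_eqF.
by rewrite le_eqVlt; apply/orP; left; apply/eqP; field; rewrite gt_eqF.
Qed.

(** The exponent [a] is free so that [r * a] can be matched with the exponent [2 / (q + 2)] of the
    noise amplification. *)
Lemma parameter_rate c rho m de b r a : 0 < c -> 0 < rho -> 0 < m -> 0 < de ->
  0 < b -> 0 <= a -> m * de <= c * b `^ r * rho ->
  b `^ (- (r * a)) * de <= (c / m) `^ a * rho `^ a * de `^ (1 - a).
Proof.
move=> c0 rho0 m0 de0 b0 a0 h.
have h1 : m * de / (c * rho) <= b `^ r.
  by rewrite ler_pdivrMr ?mulr_gt0// mulrCA mulrA.
have h2 : (m * de / (c * rho)) `^ a <= (b `^ r) `^ a.
  by apply: ge0_ler_powR => //; rewrite nnegrE ?powR_ge0// divr_ge0 ?mulr_ge0// ltW.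
have h3 : 0 < (m * de / (c * rho)) `^ a by rewrite powR_gt0// divr_gt0 ?mulr_gt0.
apply: (@le_trans _ _ (((m * de / (c * rho)) `^ a)^-1 * de)).
  rewrite ler_wpM2r ?(ltW de0)// powRN powRrM lef_pV2 ?posrE//.
  by rewrite !powR_gt0.
rewrite -powRN le_eqVlt; apply/orP; left; apply/eqP.
rewrite -{2}(lnK (x := de)) ?posrE//.
rewrite !powR_expR_ln ?divr_gt0 ?mulr_gt0// -!expRD; congr expR.
rewrite !ln_div ?posrE ?mulr_gt0// !lnM ?posrE//.
by ring.
Qed.
End rates.

(** * Multipliers of [T], noise level and source condition *)

Section data.
Context {R : realType} {d : nat} {Omega : set 'rV[R]_d}.
Variables (lam : nat -> R) (phi : nat -> L2 Omega) (alpha tau : R).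
Hypothesis phi_basis : orthonormal_basis phi.
Hypothesis lam0_gt0 : 0 < lam 0%N.
Hypothesis lam0_le : forall n, lam 0%N <= lam n.
Hypothesis tau_gt0 : 0 < tau.
Hypothesis alpha01 : 0 < alpha < 1.

Let lam_gt0 n : 0 < lam n.
Proof. exact: lt_le_trans lam0_gt0 (lam0_le n). Qed.

Lemma C3_gt0 (C1 : R) : 0 < C1 -> 0 < C3 C1 (lam 0%N) alpha tau.
Proof.
move=> C10; rewrite /C3 divr_gt0 ?mulr_gt0 ?exprn_gt0// ?Gamma_gt0//.
  by rewrite addr_gt0// mulr_gt0 ?exprn_gt0 ?powR_gt0.
by rewrite subr_gt0; case/andP : alpha01.
Qed.

(** The lower bound holds because [y / (1 + y * A)] is nondecreasing in [y], with [C4] coming from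
    its value at the first eigenvalue; the upper one is [1 / (1 + y * A) <= 1 / (y * A)]. *)
Lemma E_tau_bounds (C1 C2 : R) n : 0 < C1 -> 0 < C2 ->
  (forall x : R, x <= 0 ->
     C1 / Gamma (1 - alpha) * (1 / (1 - x)) <= mittag_leffler alpha 1 x
     <= C2 / Gamma (1 - alpha) * (1 / (1 - x))) ->
  C4 C1 (lam 0%N) alpha tau / lam n ^+ 2 <= E_tau lam alpha tau n
    <= C10 C2 alpha tau / lam n ^+ 2.
Proof.
move=> C1_gt0 C2_gt0 ML; rewrite /E_tau /C4 /C3 /C10.
have G0 : 0 < Gamma (1 - alpha).
  by apply: Gamma_gt0; rewrite subr_gt0; case/andP : alpha01.
set G := Gamma (1 - alpha) in G0 ML *; set A := tau `^ alpha.
have A0 : 0 < A by rewrite powR_gt0.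
have l0 : 0 < lam 0%N ^+ 2 by rewrite exprn_gt0.
have ln : 0 < lam n ^+ 2 by rewrite exprn_gt0.
have l0n : lam 0%N ^+ 2 <= lam n ^+ 2.
  by apply: lerXn2r (lam0_le n); rewrite nnegrE ltW.
move: l0 ln l0n; set x := lam 0%N ^+ 2; set y := lam n ^+ 2 => x0 y0 xy.
have yA : 0 < y * A by rewrite mulr_gt0.
have xA : 0 < x * A by rewrite mulr_gt0.
have /ML/andP[] : - (y * A) <= 0 by rewrite oppr_le0 ltW.
rewrite opprK => lo hi; apply/andP; split.
  apply: le_trans lo.
  rewrite -subr_ge0.
  have -> : C1 / G * (1 / (1 + y * A)) - ((1 + x * A) * G / (C1 * x))^-1 / y =
      C1 / G * (y - x) / ((1 + y * A) * (1 + x * A) * y).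
    by field; rewrite !gt_eqF// addr_gt0.
  apply: divr_ge0; last by rewrite !mulr_ge0 ?addr_ge0// ltW.
  by rewrite mulr_ge0 ?subr_ge0// divr_ge0// ltW.
apply: (le_trans hi); rewrite -subr_ge0.
have -> : C2 / (G * A) / y - C2 / G * (1 / (1 + y * A)) =
    C2 / (G * A * y * (1 + y * A)).
  by field; rewrite !gt_eqF// addr_gt0.
by rewrite divr_ge0 ?mulr_ge0 ?addr_ge0// ltW.
Qed.

Lemma theta_ge N : ((\sum_(n < N) lam n ^- 4)%:E <= theta lam)%E.
Proof.
rewrite /theta -sumEFin; apply: le_trans (nneseries_lim_ge (m := 0) N _).
  by rewrite big_mkord.
by move=> n _ _; rewrite lee_fin invr_ge0 exprn_ge0// ltW.
Qed.

(** Transfers the budget from extended to real numbers: as [theta] is positive, an infinite [u]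
    would make the left-hand side infinite. *)
Lemma noise_budget (u : \bar R) (a de : R) :
  ((a ^+ 2)%:E + theta lam * u ^+ 2 <= (de ^+ 2)%:E)%E ->
  exists m : R, [/\ 0 <= m, (u <= m%:E)%E &
    forall N, a ^+ 2 + (\sum_(n < N) lam n ^- 4) * m ^+ 2 <= de ^+ 2].
Proof.
have th0 : (0 < theta lam)%E.
  apply: lt_le_trans (theta_ge 1); rewrite big_ord_recl big_ord0 addr0 lte_fin.
  by rewrite invr_gt0 exprn_gt0.
have noo : ~ ((a ^+ 2)%:E + theta lam * +oo <= (de ^+ 2)%:E)%E.
  by rewrite gt0_muley// addey// leye_eq.
case: u => [r|/noo []|].
- move=> h; exists `|r|; split; [by []|by rewrite lee_fin ler_norm|move=> N].
  rewrite -lee_fin; apply: le_trans h; rewrite EFinD leeD2l// EFinM.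
  rewrite real_normK ?num_real// EFin_expe.
  by apply: lee_wpmul2r (theta_ge N); rewrite -EFin_expe lee_fin sqr_ge0.
- by rewrite expe2 => /noo.
Qed.

(** The factor [sqrt 2] comes from [(A - B)^2 <= 2 * (A^2 + B^2)], which separates the error in [h]
    from the error in [f]. *)
Lemma Upsilon_coef_dist (h hd : L2 Omega) (f fd : R -> L2 Omega) (de : R) :
  (forall n, 0 <= E_tau lam alpha tau n) -> Linfty tau f -> Linfty tau fd ->
  0 <= de ->
  ((norm2 (h - hd) ^+ 2)%:E
     + theta lam * Linfty_norm tau (fun t => f t - fd t)%R ^+ 2
   <= (de ^+ 2)%:E)%E ->
  forall N, \sum_(n < N) (Upsilon_coef lam phi alpha tau h f n
      - Upsilon_coef lam phi alpha tau hd fd n) ^+ 2 <= (Num.sqrt 2 * de) ^+ 2.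
Proof.
move=> E0 Lf Lfd de0 /noise_budget[m [m0 fm hm]] N.
rewrite exprMn sqr_sqrtr//.
apply: le_trans (ler_wpM2l (ler0n _ 2) (hm N)).
apply: (@le_trans _ _ (2 * (\sum_(n < N) (inner (h - hd) (phi n) ^+ 2 + lam n ^- 4 * m ^+ 2)))).
  rewrite mulr_sumr; apply: ler_sum => n _.
  have phi1 : norm2 (phi n) = 1.
    apply/eqP; rewrite -(@eqrXn2 _ 2) ?norm2_ge0// expr1n -inner_norm2.
    by have [-> _] := phi_basis; rewrite eqxx.
  have := Psi_dist alpha01 tau_gt0 (lam_gt0 n) phi1 (E0 n) Lf Lfd fm m0.
  rewrite /Upsilon_coef innerBl.
  move: (Psi _ _ _ f _ _) (Psi _ _ _ fd _ _) (inner h _) (inner hd _) => P Q x y PQ.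
  have {}PQ : (P - Q) ^+ 2 <= lam n ^- 4 * m ^+ 2.
    have -> : lam n ^- 4 * m ^+ 2 = (m / lam n ^+ 2) ^+ 2.
      by rewrite expr_div_n -exprM mulrC.
    rewrite -real_normK ?num_real//; apply: lerXn2r PQ; rewrite nnegrE//.
    by rewrite divr_ge0// sqr_ge0.
  have : 0 <= (x - y + (P - Q)) ^+ 2 by exact: sqr_ge0.
  have -> : (x - P - (y - Q)) ^+ 2 = 2 * ((x - y) ^+ 2 + (P - Q) ^+ 2) - (x - y + (P - Q)) ^+ 2.
    by ring.
  by move=> ?; lra.
rewrite big_split/= ler_wpM2l// lerD//; first exact: bessel.
by rewrite mulr_suml.
Qed.

Lemma source_set_le (rho p : R) (g : L2 Omega) : 0 < rho ->
  source_set lam phi rho p g ->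
  forall N, \sum_(n < N) (lam n `^ p * inner g (phi n)) ^+ 2 <= rho ^+ 2.
Proof.
move=> rho0; rewrite /source_set/= /Hp_norm => h N.
set c := \sum_(n < N) _.
have c0 : 0 <= c by apply: sumr_ge0 => n _; exact: sqr_ge0.
have cS : (c%:E <= \sum_(0 <= n <oo) (lam n `^ (2 * p) * inner g (phi n) ^+ 2)%:E)%E.
  rewrite /c -sumEFin; apply: le_trans (nneseries_lim_ge (m := 0) N _).
    rewrite big_mkord; apply: lee_sum => n _; rewrite lee_fin.
    by rewrite exprMn [2 * p]mulrC powRrM powR_mulrn ?powR_ge0.
  by move=> n _ _; rewrite lee_fin mulr_ge0 ?powR_ge0 ?sqr_ge0.
have : (c%:E `^ 2^-1 <= rho%:E)%E.
  { apply: le_trans h; apply: gt0_ler_poweR => //.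
  - by rewrite in_itv/= lee_fin c0 leey.
  - by rewrite in_itv/= leey andbT (le_trans _ cS)// lee_fin. }
rewrite poweR_EFin lee_fin powR12_sqrt// => cr.
rewrite -(sqr_sqrtr c0); apply: lerXn2r cr; rewrite nnegrE ?sqrtr_ge0//.
exact: ltW.
Qed.
End data.

(** * Convergence rates for abstract multipliers, with noise level [s * delta] *)

Section tikhonov_rates.
Context {R : realType} {d : nat} {Omega : set 'rV[R]_d}.
Variables (phi : nat -> L2 Omega) (lam E : nat -> R) (q : nat).
Variables (c4 c10 s xi delta rho p b : R) (g v : L2 Omega).
Hypothesis phi_basis : orthonormal_basis phi.
Hypothesis lam0_gt0 : 0 < lam 0%N.
Hypothesis lam0_le : forall n, lam 0%N <= lam n.
Hypothesis c4_gt0 : 0 < c4.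
Hypothesis E_bounds : forall n, c4 / lam n ^+ 2 <= E n <= c10 / lam n ^+ 2.
Hypothesis s_gt0 : 0 < s.
Hypothesis s_xi : s < xi.
Hypothesis delta_gt0 : 0 < delta.
Hypothesis noise : forall N,
  \sum_(n < N) (E n * inner g (phi n) - inner v (phi n)) ^+ 2 <= (s * delta) ^+ 2.
Hypothesis rho_gt0 : 0 < rho.
Hypothesis p_gt0 : 0 < p.
Hypothesis source : forall N,
  \sum_(n < N) (lam n `^ p * inner g (phi n)) ^+ 2 <= rho ^+ 2.
Hypothesis b_gt0 : 0 < b.

Let lam_gt0 n : 0 < lam n.
Proof. exact: lt_le_trans lam0_gt0 (lam0_le n). Qed.

Let E_gt0 n : 0 < E n.
Proof.
have /andP[+ _] := E_bounds n; apply: lt_le_trans.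
by rewrite divr_gt0// exprn_gt0.
Qed.

Let c4_le_c10 : c4 <= c10.
Proof.
have /andP[lo hi] := E_bounds 0%N; have := le_trans lo hi.
by rewrite ler_pM2r// invr_gt0 exprn_gt0.
Qed.

Let c10_gt0 : 0 < c10.
Proof. exact: lt_le_trans c4_gt0 c4_le_c10. Qed.

Let xi_gt0 : 0 < xi.
Proof. exact: lt_trans s_gt0 s_xi. Qed.

Let xis_gt0 : 0 < xi - s.
Proof. by rewrite subr_gt0. Qed.

Let eps_ge0 : 0 <= s * delta.
Proof. by rewrite mulr_ge0// ltW. Qed.

Let p2_gt0 : 0 < p + 2.
Proof. by rewrite addr_gt0. Qed.

Let approximation_le D : 0 < D -> delta <= D ->
  (c4^-1 * (xi * D + s * delta)) `^ (p / (p + 2)) <=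
  (c4^-1 * (xi + s)) `^ (p / (p + 2)) * D `^ (p / (p + 2)).
Proof.
move=> D0 dD; have xs : 0 <= c4^-1 * (xi + s).
  by rewrite mulr_ge0 ?invr_ge0 ?addr_ge0// ltW.
rewrite -powRM ?(ltW D0)//; apply: ge0_ler_powR.
- by rewrite divr_ge0// ltW.
- by rewrite nnegrE mulr_ge0 ?invr_ge0 ?addr_ge0 ?mulr_ge0// ltW.
- by rewrite nnegrE mulr_ge0 ?(ltW D0).
- by rewrite -mulrA ler_wpM2l ?invr_ge0 ?(ltW c4_gt0)// mulrDl lerD2l ler_wpM2l ?(ltW s_gt0).
Qed.

Let filter_const := (2 * c4 / q%:R) `^ (2 / (q%:R + 2)) * (q%:R / (c4 * (1 + q%:R))).

(** Common to both cases with [q > 0], which differ only in the power [r] of [b] that controls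
    [w_n E_n]. *)
Let rate c r a : tikhonov_discrepancy phi lam E q v b = xi * delta ->
  (0 < q)%N -> 0 < c -> 0 <= a -> r * a = 2 / (q%:R + 2) ->
  (forall n, b * lam n ^+ q / (E n + b * lam n ^+ q) * E n
    <= c * b `^ r * lam n `^ p) ->
  norm2 (g - tikhonov phi lam E q v b) <=
  (c4^-1 * (xi + s)) `^ (p / (p + 2)) * rho `^ (2 / (p + 2)) * delta `^ (p / (p + 2)) +
  s * filter_const * (c / (xi - s)) `^ a * rho `^ a * delta `^ (1 - a).
Proof.
move=> bE q0 c0 a0 ra hc; set F := filter_const.
have F0 : 0 <= F by rewrite mulr_ge0 ?powR_ge0 ?divr_ge0 ?mulr_ge0 ?addr_ge0// ltW.
have hF n : (E n + b * lam n ^+ q)^-1 <= F * b `^ (- (2 / (q%:R + 2))).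
  apply: le_trans (tikhonov_filter_le q0 c4_gt0 b_gt0 (lam_gt0 n)).
  have /andP[lo _] := E_bounds n.
  have blq : 0 < b * lam n ^+ q by rewrite mulr_gt0// exprn_gt0.
  have c4l : 0 < c4 / lam n ^+ 2 by rewrite divr_gt0// exprn_gt0.
  by rewrite lef_pV2 ?posrE ?(addr_gt0 c4l blq) ?(addr_gt0 (E_gt0 n) blq)// lerD2r.
apply: le_trans (tikhonov_error phi_basis lam0_gt0 lam0_le c4_gt0 E_bounds eps_ge0 noise
  rho_gt0 p_gt0 source b_gt0 bE (mulr_gt0 xi_gt0 delta_gt0) hF) _.
apply: lerD.
  rewrite [_ * rho `^ _]mulrC -mulrA ler_wpM2l ?powR_ge0//.
  exact: approximation_le.
have := tikhonov_parameter_ge phi_basis lam0_gt0 lam0_le c4_gt0 E_bounds eps_ge0 noise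
  rho_gt0 source b_gt0 bE (mulr_ge0 (ltW c0) (powR_ge0 b r)) hc.
rewrite -mulrBl => /(parameter_rate c0 rho_gt0 xis_gt0 delta_gt0 b_gt0 a0); rewrite ra => hr.
have -> : F * b `^ (- (2 / (q%:R + 2))) * (s * delta) =
    s * F * (b `^ (- (2 / (q%:R + 2))) * delta) by ring.
apply: le_trans (ler_wpM2l (mulr_ge0 (ltW s_gt0) F0) hr) _.
by rewrite !mulrA.
Qed.

Lemma tikhonov_rate_lt : tikhonov_discrepancy phi lam E q v b = xi * delta ->
  (0 < q)%N -> p < q%:R ->
  norm2 (g - tikhonov phi lam E q v b) <=
  (c4^-1 * (xi + s)) `^ (p / (p + 2)) * rho `^ (2 / (p + 2)) * delta `^ (p / (p + 2)) +
  s * (2 * c4 / q%:R) `^ (2 / (q%:R + 2)) * (q%:R / (c4 * (1 + q%:R))) *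
  (c10 * c4 `^ (- ((p + 2) / (q%:R + 2))) / (xi - s)) `^ (2 / (p + 2)) *
  rho `^ (2 / (p + 2)) * delta `^ (p / (p + 2)).
Proof.
move=> bE q0 pq; have q20 : 0 < q%:R + 2 :> R by rewrite ltr_wpDl.
(* All occurrences are rewritten and the first two restored: only the last power of [delta] must
   have the form [1 - a]. *)
have -> : p / (p + 2) = 1 - 2 / (p + 2) by field; rewrite gt_eqF.
have {1 2}-> : 1 - 2 / (p + 2) = p / (p + 2) by field; rewrite gt_eqF.
rewrite -[s * _ * _]mulrA; apply: (rate (r := (p + 2) / (q%:R + 2))) => //.
- by rewrite mulr_gt0// powR_gt0.
- by rewrite divr_ge0// ltW.
- by field; rewrite !gt_eqF.
- move=> n; have /andP[lo hi] := E_bounds n.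
  exact: tikhonov_weight_le c4_gt0 p_gt0 pq b_gt0 (lam_gt0 n) lo hi.
Qed.

(** Saturation: the power of [b] stays at [r = 1], and the surplus [lam n ^ (p - q)] is only
    compared with its value at the first eigenvalue. Hence the exponents depend on [q]; [c4 <= c10]
    puts the constant in the form [C12]. *)
Lemma tikhonov_rate_ge : tikhonov_discrepancy phi lam E q v b = xi * delta ->
  (0 < q)%N -> q%:R <= p ->
  norm2 (g - tikhonov phi lam E q v b) <=
  (c4^-1 * (xi + s)) `^ (p / (p + 2)) * rho `^ (2 / (p + 2)) * delta `^ (p / (p + 2)) +
  s * (2 * c4 / q%:R) `^ (2 / (q%:R + 2)) * (q%:R / (c4 * (1 + q%:R))) *
  (c10 / (c4 * lam 0%N `^ (p - q%:R)) / (xi - s)) `^ (2 / (q%:R + 2)) *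
  rho `^ (2 / (q%:R + 2)) * delta `^ (q%:R / (q%:R + 2)).
Proof.
move=> bE q0 qp; have q20 : 0 < q%:R + 2 :> R by rewrite ltr_wpDl.
have -> : q%:R / (q%:R + 2) = 1 - 2 / (q%:R + 2) :> R by field; rewrite gt_eqF.
have lpq : 0 < lam 0%N `^ (p - q%:R) by rewrite powR_gt0.
rewrite -[s * _ * _]mulrA; apply: (rate (r := 1)) => //.
- by rewrite divr_gt0// mulr_gt0.
- by rewrite mul1r.
- move=> n; have lq0 : 0 < lam n ^+ q by rewrite exprn_gt0.
  have blq : 0 < b * lam n ^+ q by rewrite mulr_gt0.
  rewrite powRr1 ?(ltW b_gt0)//; apply: (@le_trans _ _ (b * lam n ^+ q)).
    rewrite mulrAC ler_pdivrMr ?addr_gt0// ler_wpM2l ?(ltW blq)//.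
    by rewrite lerDl ltW.
  rewrite [_ * b]mulrC -mulrA ler_wpM2l ?(ltW b_gt0)//.
  have -> : lam n `^ p = lam n ^+ q * lam n `^ (p - q%:R).
    rewrite -powR_mulrn ?(ltW (lam_gt0 n))// -powRD ?(gt_eqF (lam_gt0 n)) ?implybT//.
    by rewrite addrC subrK.
  rewrite mulrCA ler_peMr ?(ltW lq0)// mulrAC ler_pdivlMr ?mulr_gt0// mul1r.
  apply: ler_pM; rewrite ?(ltW c4_gt0) ?(ltW lpq)//.
  by apply: ge0_ler_powR; rewrite ?subr_ge0 ?nnegrE ?(ltW lam0_gt0) ?(ltW (lam_gt0 n)).
Qed.

(** Here [b] is at least a multiple of [delta^nu / rho], so the noise amplified by [b^-1] is of
    order [rho * delta^(1 - nu)]. *)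
Lemma tikhonov_rate0 nu : q = 0%N -> delta <= delta `^ nu ->
  tikhonov_discrepancy phi lam E q v b = xi * delta `^ nu ->
  norm2 (g - tikhonov phi lam E q v b) <=
  (c4^-1 * (xi + s)) `^ (p / (p + 2)) * rho `^ (2 / (p + 2)) *
  delta `^ (p * nu / (p + 2)) +
  s / (lam 0%N `^ p * (xi - s)) * rho * delta `^ (1 - nu).
Proof.
move=> q0 ddn bE; have dn0 : 0 < delta `^ nu by rewrite powR_gt0.
have hb n : (E n + b * lam n ^+ q)^-1 <= b^-1.
  by rewrite q0 expr0 mulr1 lef_pV2 ?posrE ?addr_gt0// lerDr ltW.
apply: le_trans (tikhonov_error phi_basis lam0_gt0 lam0_le c4_gt0 E_bounds eps_ge0 noise
  rho_gt0 p_gt0 source b_gt0 bE (mulr_gt0 xi_gt0 dn0) hb) _.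
apply: lerD.
  rewrite [p * nu]mulrC -[nu * p / _]mulrA [delta `^ (nu * _)]powRrM.
  rewrite [_ * rho `^ _]mulrC -mulrA ler_wpM2l ?powR_ge0//.
  exact: approximation_le.
have lp0 : 0 < lam 0%N `^ p by rewrite powR_gt0.
have hc n : b * lam n ^+ q / (E n + b * lam n ^+ q) * E n
    <= b / lam 0%N `^ p * lam n `^ p.
  rewrite q0 expr0 mulr1; apply: (@le_trans _ _ b).
    by rewrite mulrAC ler_pdivrMr ?addr_gt0// ler_wpM2l ?(ltW b_gt0)// lerDl ltW.
  rewrite -mulrA ler_peMr ?(ltW b_gt0)// mulrC ler_pdivlMr// mul1r.
  by apply: ge0_ler_powR; rewrite ?nnegrE ?(ltW p_gt0) ?(ltW lam0_gt0) ?(ltW (lam_gt0 n)).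
have := tikhonov_parameter_ge phi_basis lam0_gt0 lam0_le c4_gt0 E_bounds eps_ge0 noise
  rho_gt0 source b_gt0 bE (divr_ge0 (ltW b_gt0) (ltW lp0)) hc.
have mdn : (xi - s) * delta `^ nu <= xi * delta `^ nu - s * delta.
  by rewrite mulrBl lerD2l lerN2 ler_wpM2l ?(ltW s_gt0).
move=> /(le_trans mdn) {}hb.
rewrite powRD; last by rewrite (gt_eqF delta_gt0) implybT.
rewrite powRr1 ?(ltW delta_gt0)// powRN.
have -> : s / (lam 0%N `^ p * (xi - s)) * rho * (delta * (delta `^ nu)^-1) =
    (rho / (lam 0%N `^ p * ((xi - s) * delta `^ nu))) * (s * delta).
  by field; rewrite !gt_eqF.
rewrite ler_wpM2r// ler_pdivlMr ?mulr_gt0// mulrC ler_pdivrMr//.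
by move: hb; rewrite mulrAC ler_pdivlMr// mulrC [b * _]mulrC.
Qed.
End tikhonov_rates.

(** * Rates for the parameter chosen by the discrepancy principle *)

Theorem theorem4p11 (R : realType) :
  exists (C13 : R -> R -> R -> R) (C14 : R -> R -> R -> R -> R)
         (C15 : R -> R -> R -> nat -> R) (C16 : R -> R -> R -> R),
  [/\ forall a b c, 0 < C13 a b c, forall a b c e, 0 < C14 a b c e,
      forall a b c q, 0 < C15 a b c q & forall a b c, 0 < C16 a b c] /\
  forall (d : nat) (Omega : set 'rV[R]_d) (k : nat)
    (lam : nat -> R) (phi : nat -> L2 Omega) (tau alpha C1 C2 : R),
  (1 <= d <= 7)%N ->
  bounded_domain Omega -> (1 <= k)%N -> Ck_boundary k Omega ->
  dirichlet_eigensystem lam phi ->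
  0 < tau -> 0 < alpha < 1 ->
  0 < C1 -> 0 < C2 ->
  (forall x : R, x <= 0 ->
     C1 / Gamma (1 - alpha) * (1 / (1 - x)) <= mittag_leffler alpha 1 x
     <= C2 / Gamma (1 - alpha) * (1 / (1 - x))) ->
  forall (q : nat) (xi nu : R),
  Num.sqrt 2 < xi -> 0 < nu < 1 ->
  forall (h : L2 Omega) (f : R -> L2 Omega) (g : L2 Omega) (rho p : R),
  Linfty tau f ->
  {ae lebesgue_measure_on Omega, forall x,
     T_op lam phi alpha tau g x = Upsilon lam phi alpha tau h f x} ->
  0 < rho -> 0 < p -> source_set lam phi rho p g ->
  exists delta0 : R, 0 < delta0 /\
  forall delta : R, 0 < delta < delta0 ->
  (xi + Num.sqrt 2) * delta `^ nu <= norm2 (Upsilon lam phi alpha tau h f) ->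
  forall (hd : L2 Omega) (fd : R -> L2 Omega),
  Linfty tau fd ->
  ((norm2 (h - hd) ^+ 2)%:E
     + theta lam * Linfty_norm tau (fun t => f t - fd t)%R ^+ 2
   <= (delta ^+ 2)%:E)%E ->
  let Phi := discrepancy lam phi alpha tau q hd fd in
  let u := u_reg lam phi alpha tau q hd fd in
  let lam1 := lam 0%N in
  let c13 := C13 (C3 C1 lam1 alpha tau) p xi in
  let c14 := C14 (C5 C1 lam1 alpha tau q) (C11 C1 C2 lam1 alpha tau p q) xi p in
  let c15 := C15 (C5 C1 lam1 alpha tau q) (C12 C1 C2 lam1 alpha tau p q) xi q in
  let c16 := C16 xi lam1 p in
  exists beta betat : R,
  [/\ unique (fun b => 0 < b /\ Phi b = xi * delta) beta,
      unique (fun b => 0 < b /\ Phi b = xi * delta `^ nu) betat,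
      q <> 0%N -> p < q%:R ->
        norm2 (g - u beta)
        <= c13 * rho `^ (2 / (p + 2)) * delta `^ (p / (p + 2))
           + c14 * rho `^ (2 / (p + 2)) * delta `^ (p / (p + 2)),
      q <> 0%N -> q%:R <= p ->
        norm2 (g - u beta)
        <= c13 * rho `^ (2 / (p + 2)) * delta `^ (p / (p + 2))
           + c15 * rho `^ (2 / (q%:R + 2)) * delta `^ (q%:R / (q%:R + 2)) &
      q = 0%N ->
        norm2 (g - u betat)
        <= c13 * rho `^ (2 / (p + 2)) * delta `^ (p * nu / (p + 2))
           + c16 * rho * delta `^ (1 - nu)].
Proof.
(* The constants are required to be positive for all values of their
   arguments, not only for the meaningful ones. *)
pose pos (x : R) := if 0 < x then x else 1.
have pos_gt0 x : 0 < pos x by rewrite /pos; case: ifP.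
have posE x : 0 < x -> pos x = x by rewrite /pos => ->.
set s2 : R := Num.sqrt 2; have s20 : 0 < s2 by rewrite sqrtr_gt0.
(* [xi + s2] is discrepancy plus noise, from the interpolation; [xi - s2] is discrepancy minus
   noise, from the lower bound on the parameter. The noise factor [s2] of the second term is already
   contained in [C5]. *)
exists (fun c3 p xi => pos ((c3 * (xi + s2)) `^ (p / (p + 2)))),
  (fun c5 c11 xi p => pos (c5 * (c11 / (xi - s2)) `^ (2 / (p + 2)))),
  (fun c5 c12 xi q => pos (c5 * (c12 / (xi - s2)) `^ (2 / (q%:R + 2)))),
  (fun xi lam1 p => pos (s2 / (lam1 `^ p * (xi - s2)))).
split=> [//|d Omega k lam phi tau alpha C1 C2 _ _ _ _ [[lam0 _] lam_nd _ _ basis]].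
move=> tau0 alpha01 C10_gt0 C20_gt0 ML q xi nu xi2 nu01 h f g rho p Lf Tg rho0 p0 src.
have lam0_le n : lam 0%N <= lam n by exact: lam_nd.
have lam_gt0 n : 0 < lam n := lt_le_trans lam0 (lam0_le n).
have c3_gt0 := C3_gt0 lam0 tau0 alpha01 C10_gt0.
set c3 := C3 _ _ _ _ in c3_gt0.
have c4_gt0 : 0 < c3^-1 by rewrite invr_gt0.
pose E n := E_tau lam alpha tau n.
set c10 := C10 C2 alpha tau.
have Eb n : c3^-1 / lam n ^+ 2 <= E n <= c10 / lam n ^+ 2.
  have bounds := E_tau_bounds lam0 lam0_le tau0 alpha01.
  exact: (bounds C1 C2 n C10_gt0 C20_gt0 ML).
have E_gt0 n : 0 < E n.
  by have /andP[+ _] := Eb n; apply: lt_le_trans; rewrite divr_gt0// exprn_gt0.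
have c410 : c3^-1 <= c10.
  have /andP[lo hi] := Eb 0%N; have := le_trans lo hi.
  by rewrite ler_pM2r// invr_gt0 exprn_gt0.
have c10_gt0 := lt_le_trans c4_gt0 c410.
have source := source_set_le rho0 src.
have m0 : 0 < xi - s2 by rewrite subr_gt0.
have xi0 : 0 < xi := lt_trans s20 xi2.
have p20 : 0 < p + 2 by rewrite addr_gt0.
have /andP[nu0 nu1] := nu01.
(* Below 1, [delta < delta^nu], the only smallness of [delta] that is used. *)
exists 1; split=> // delta /andP[de0 de1] big hd fd Lfd budget Phi u lam1 c13 c14 c15 c16.
have dn0 : 0 < delta `^ nu by rewrite powR_gt0.
have ddn : delta < delta `^ nu.
  rewrite powR_expR_ln// -{1}(lnK (x := delta)) ?posrE// ltr_expR -subr_gt0.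
  have -> : nu * ln delta - ln delta = (1 - nu) * - ln delta by ring.
  by rewrite mulr_gt0 ?subr_gt0// oppr_gt0 ln_lt0// de0.
have eps0 : 0 <= s2 * delta by rewrite mulr_ge0 ?ltW.
set U := Upsilon lam phi alpha tau h f in big Tg.
have U_def : U = L2_sum phi (Upsilon_coef lam phi alpha tau h f) := erefl _.
clearbody U.
have U_gt0 : 0 < norm2 U by apply: lt_le_trans big; rewrite mulr_gt0// addr_gt0.
(* [L2_sum] is [0] on divergent series, which the lower bound on [norm2 U]
   excludes. *)
have U_inner n : inner U (phi n) = Upsilon_coef lam phi alpha tau h f n.
  rewrite U_def in U_gt0 *.
  exact: (psum_cvg_coef basis n (L2_sum_cvg_neq0 (lt0r_neq0 U_gt0))).
have U_coef n : Upsilon_coef lam phi alpha tau h f n = E n * inner g (phi n).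
  rewrite -U_inner.
  by rewrite -(ae_eq_inner (phi n) Tg) (inner_E_series basis lam0 lam0_le c4_gt0 Eb).
pose V := Upsilon lam phi alpha tau hd fd.
have V_def : V = Upsilon lam phi alpha tau hd fd := erefl _.
clearbody V.
have dist := Upsilon_coef_dist basis lam0 lam0_le tau0 alpha01
  (fun n => ltW (E_gt0 n)) Lf Lfd (ltW de0) budget.
(* The perturbed series converges because [y^2 <= 2 * x^2 + 2 * (x - y)^2] bounds it by the exact
   data and the noise. *)
have V_coef n : inner V (phi n) = Upsilon_coef lam phi alpha tau hd fd n.
  rewrite V_def; apply: (psum_cvg_coef basis); apply: (L2_sum_cvg basis
    (M := 2 * norm2 U ^+ 2 + 2 * (s2 * delta) ^+ 2)) => N.
  apply: le_trans (lerD (ler_wpM2l (ler0n _ 2) (bessel basis U N))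
                        (ler_wpM2l (ler0n _ 2) (dist N))).
  rewrite !mulr_sumr -big_split; apply: ler_sum => i _ /=.
  rewrite U_inner.
  move: (Upsilon_coef _ _ _ _ h f i) (Upsilon_coef _ _ _ _ hd fd i) => x y.
  rewrite -subr_ge0.
  have -> : 2 * x ^+ 2 + 2 * (x - y) ^+ 2 - y ^+ 2 = (2 * x - y) ^+ 2 by ring.
  exact: sqr_ge0.
have noise N : \sum_(n < N) (E n * inner g (phi n) - inner V (phi n)) ^+ 2 <=
    (s2 * delta) ^+ 2.
  by apply: le_trans (dist N); apply: ler_sum => n _; rewrite V_coef U_coef.
have UV : norm2 U - s2 * delta <= norm2 V.
  rewrite lerBlDl -lerBlDr; apply: le_trans (ler_norm _) _.
  apply: le_trans (norm2_dist _ _) _; apply: (norm2_le basis) => // N.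
  by apply: le_trans (noise N); apply: ler_sum => n _; rewrite innerBl U_inner U_coef.
have uE : u = tikhonov phi lam E q V.
  apply/funext => b; congr (L2_sum phi _); apply/funext => n.
  by rewrite V_coef.
have PhiE : Phi = tikhonov_discrepancy phi lam E q V.
  by apply/funext => b; rewrite /Phi /discrepancy -V_def /tikhonov_discrepancy -uE.
(* Of the assumed [(xi + s2) * delta^nu], the noise takes away [s2 * delta < s2 * delta^nu]; what
   remains puts both discrepancy levels below [norm2 V]. *)
have V_gt : xi * delta `^ nu < norm2 V.
  apply: lt_le_trans UV; rewrite ltrBrDr; apply: lt_le_trans big.
  by rewrite mulrDl ltrD2l ltr_pM2l.
have xid : xi * delta < xi * delta `^ nu by rewrite ltr_pM2l.
have s2xi : s2 * delta < xi * delta by rewrite ltr_pM2r.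
have [b b_uniq] := discrepancy_principle q basis lam0 lam0_le c4_gt0 Eb eps0 noise
  s2xi (lt_trans xid V_gt).
have [bt bt_uniq] := discrepancy_principle q basis lam0 lam0_le c4_gt0 Eb eps0 noise
  (lt_trans s2xi xid) V_gt.
exists b, bt; rewrite -PhiE in b_uniq bt_uniq; rewrite uE.
have [[b0 bE] _] := b_uniq; have [[bt0 btE] _] := bt_uniq.
rewrite PhiE in bE btE.
have c13E : c13 = (c3^-1^-1 * (xi + s2)) `^ (p / (p + 2)).
  by rewrite invrK; apply: posE; exact: powR_gt0 (mulr_gt0 c3_gt0 (addr_gt0 xi0 s20)).
have c5_gt0 : (0 < q)%N -> 0 < C5 C1 lam1 alpha tau q.
  move=> q0; have q1 : 0 < q%:R :> R by rewrite ltr0n.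
  apply: mulr_gt0; first apply: mulr_gt0 s20 _.
    exact: powR_gt0 (divr_gt0 (mulr_gt0 (ltr0n _ 2) c4_gt0) q1).
  exact: divr_gt0 q1 (mulr_gt0 c4_gt0 (addr_gt0 ltr01 q1)).
have ratio_gt0 (c a : R) : 0 < c -> 0 < (c / (xi - s2)) `^ a.
  by move=> c0; exact: powR_gt0 (divr_gt0 c0 m0).
split.
- exact: b_uniq.
- exact: bt_uniq.
- move=> /eqP; rewrite -lt0n => q0 pq.
  have -> : c14 = C5 C1 lam1 alpha tau q *
      (C11 C1 C2 lam1 alpha tau p q / (xi - s2)) `^ (2 / (p + 2)).
    apply: posE; apply: mulr_gt0 (c5_gt0 q0) (ratio_gt0 _ _ _).
    exact: mulr_gt0 c10_gt0 (powR_gt0 _ c4_gt0).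
  rewrite c13E.
  exact: (tikhonov_rate_lt basis lam0 lam0_le c4_gt0 Eb s20 xi2 de0 noise rho0 p0 source
    b0 bE q0 pq).
- move=> /eqP; rewrite -lt0n => q0 qp.
  have -> : c15 = C5 C1 lam1 alpha tau q *
      (C12 C1 C2 lam1 alpha tau p q / (xi - s2)) `^ (2 / (q%:R + 2)).
    apply: posE; apply: mulr_gt0 (c5_gt0 q0) (ratio_gt0 _ _ _).
    exact: divr_gt0 c10_gt0 (mulr_gt0 c4_gt0 (powR_gt0 _ lam0)).
  rewrite c13E.
  exact: (tikhonov_rate_ge basis lam0 lam0_le c4_gt0 Eb s20 xi2 de0 noise rho0 p0 source
    b0 bE q0 qp).
- move=> q0; have -> : c16 = s2 / (lam1 `^ p * (xi - s2)).
    by apply: posE; exact: divr_gt0 s20 (mulr_gt0 (powR_gt0 _ lam0) m0).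
  rewrite c13E.
  exact: (tikhonov_rate0 basis lam0 lam0_le c4_gt0 Eb s20 xi2 de0 noise rho0 p0 source
    bt0 q0 (ltW ddn) btE).
Qed.
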